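(* The system $\mathsf{ACA}_0^\omega$ proves $\mathsf{LUS}\leftrightarrow\mathsf{LUS}_{\mathsf{RM}}$ and $\mathsf{LUS}\to\mathsf{WHBU}_{\mathbf m}$.
   Context: Finite types: $0$ is the type of natural numbers, $\sigma\to\tau$ is the type of maps from type $\sigma$ objects to type $\tau$ objects; $1=0\to0$, $n+1=n\to0$. The language $L_\omega$ has variables of all finite types and constants $0,1,<_0,+_0,\times_0,=_0$, combinators and recursors; for $\tau=\tau_1\to\dots\to\tau_k\to0$, $x=_\tau y$ abbreviates $\forall z_1^{\tau_1}\dots z_k^{\tau_k}(xz_1\dots z_k=_0yz_1\dots z_k)$. $\mathsf{RCA}_0^\omega$ is the theory in classical logic with axioms: (1) $0,1,<_0,+_0,\times_0$ form an ordered semi-ring with equality $=_0$; (2) the defining axioms of the combinators $\Pi,\Sigma$ (giving $\lambda$-abstraction); (3) $\mathbf R_0(f,m,0)=m$, $\mathbf R_0(f,m,n+1)=f(n,\mathbf R_0(f,m,n))$; (4) extensionality: $x=_\rho y\to\varphi(x)=_\tau\varphi(y)$ for all $\varphi^{\rho\to\tau}$ and all types; (5) induction for quantifier-free formulas of $L_\omega$ (variables of any type allowed); (6) $\mathsf{QF\text{-}AC}^{1,0}$: $(\forall x^1)(\exists y^0)A(x,y)\to(\exists Y^{2})(\forall x^1)A(x,Y(x))$ for quantifier-free $A$. $\mathsf{ACA}_0^\omega$ is $\mathsf{RCA}_0^\omega$ plus $(\mu^2)$: there is $\mu^2$ such that for all $f^1$, if $(\exists n)(f(n)=0)$ then $\mu(f)$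 is the least such $n$, and otherwise $\mu(f)=0$. Reals are represented by sequences of rationals $(q_n)$ with $|q_n-q_{n+i}|<2^{-n}$ for all $n,i$; $(q_n)=_{\mathbb R}(r_n)$ iff $|q_n-r_n|\le2^{-n+1}$ for all $n$; functions on $\mathbb R$ or $I=[0,1]$ are type $1\to1$ objects mapping equal reals to equal reals. A subset of $\mathbb R$ is given by $Y:\mathbb R\to\mathbb R$, with $x\in Y$ iff $Y(x)>_{\mathbb R}0$. An RM-closed subset of $[0,1]$ is one given as $[0,1]\setminus\bigcup_n(a_n,b_n)$ for a sequence of open intervals with rational end-points. Continuity is epsilon–delta continuity. Measure convention: statements about Lebesgue measure $\lambda(E)=\inf\{\sum_k|J_k|:(J_k)_{k\in\mathbb N}\text{ a sequence of open intervals with }E\subset\bigcup_kJ_k\}$ are read comparatively, without assuming the infimum exists: $\lambda(E)\ge a$ means that $a\le\sum_k|J_k|$ for each such cover of $E$; $\lambda(E)\le a$ means that for each $\delta>0$ there is such a cover with $\sum_k|J_k|\le a+\delta$; and so on. $E\subseteq[0,1]$ is measurable if $\lambda(E)+\lambda([0,1]\setminus E)\le1$. $f$ is measurable if for all $t\in\mathbb R$ the set $\{x:f(x)>t\}$ is measurable. $\mathsf{LUS}$: for measurable $f:I\to\mathbb R$ and $\varepsilon>0$, there is measurable $E\subset[0,1]$ with measure at least $1-\varepsilon$ such that $f$ restricted to $E$ is continuous. $\mathsf{LUS}_{\mathsf{RM}}$: the same statement with $E$ additionally RM-closed. $\mathsf{WHBU}_{\mathbf m}$: for every measurable $\Psi:[0,1]\to\mathbb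 R^+$ and $\varepsilon>0$ there are $y_0,\dots,y_n\in[0,1]$ such that the measure of $\bigcup_{i\le n}(y_i-\Psi(y_i),y_i+\Psi(y_i))$ is at least $1-\varepsilon$. *)

(* Defs.v *)
From Stdlib Require Import List.

Set Implicit Arguments.
Unset Strict Implicit.
Unset Printing Implicit Defensive.

(** * The language of finite types *)

Inductive ty : Type :=
| tN : ty
| arr : ty -> ty -> ty.

Declare Scope ty_scope.
Delimit Scope ty_scope with ty.
Bind Scope ty_scope with ty.
Notation "A ~> B" := (arr A B) (at level 65, right associativity) : ty_scope.
Open Scope ty_scope.

Definition t1 : ty := tN ~> tN.
Definition t2 : ty := t1 ~> tN.

Definition ctx : Type := list ty.

(* Terms and formulas are well typed by construction; a context lists the types
   of the free variables, most recently bound first (de Bruijn indices). *)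
Inductive var : ctx -> ty -> Type :=
| vz : forall Γ A, var (A :: Γ) A
| vs : forall Γ A B, var Γ A -> var (B :: Γ) A.

Arguments vz {Γ A}.
Arguments vs {Γ A B} _.

Inductive con : ty -> Type :=
| c0 : con tN
| c1 : con tN
| cadd : con (tN ~> tN ~> tN)
| cmul : con (tN ~> tN ~> tN)
| cPi : forall A B, con (A ~> B ~> A)
| cSigma : forall A B C, con ((A ~> B ~> C) ~> (A ~> B) ~> A ~> C)
| cR0 : con ((tN ~> tN ~> tN) ~> tN ~> tN ~> tN).

Arguments cPi {A B}.
Arguments cSigma {A B C}.

Inductive tm (Γ : ctx) : ty -> Type :=
| Var : forall A, var Γ A -> tm Γ A
| Con : forall A, con A -> tm Γ A
| App : forall A B, tm Γ (A ~> B) -> tm Γ A -> tm Γ B.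

Arguments Con {Γ A} _.

Inductive fm (Γ : ctx) : Type :=
| Eq : tm Γ tN -> tm Γ tN -> fm Γ
| Lt : tm Γ tN -> tm Γ tN -> fm Γ
| Bot : fm Γ
| Imp : fm Γ -> fm Γ -> fm Γ
| And : fm Γ -> fm Γ -> fm Γ
| Or : fm Γ -> fm Γ -> fm Γ
| All : forall A, fm (A :: Γ) -> fm Γ
| Ex : forall A, fm (A :: Γ) -> fm Γ.

Arguments Bot {Γ}.

Fixpoint qf {Γ} (φ : fm Γ) : Prop :=
  match φ with
  | Eq _ _ | Lt _ _ | Bot => True
  | Imp p q | And p q | Or p q => qf p /\ qf q
  | All _ | Ex _ => False
  end.

(** * Renaming and substitution *)

Definition renaming (Γ Δ : ctx) : Type := forall A, var Γ A -> var Δ A.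
Definition substitution (Γ Δ : ctx) : Type := forall A, var Γ A -> tm Δ A.

Definition rup {Γ Δ B} (r : renaming Γ Δ) : renaming (B :: Γ) (B :: Δ) :=
  fun A v =>
    match v in var Γ' A'
      return match Γ' with
             | nil => unit
             | B' :: Γ0 => renaming Γ0 Δ -> var (B' :: Δ) A'
             end
    with
    | vz => fun _ => vz
    | vs w => fun r => vs (r _ w)
    end r.

Fixpoint tren {Γ Δ} (r : renaming Γ Δ) {A} (t : tm Γ A) : tm Δ A :=
  match t with
  | Var v => Var (r _ v)
  | Con c => Con c
  | App s u => App (tren r s) (tren r u)
  end.

Fixpoint fren {Γ} (φ : fm Γ) {Δ} (r : renaming Γ Δ) : fm Δ :=
  match φ with
  | Eq s t => Eq (tren r s) (tren r t)
  | Lt s t => Lt (tren r s) (tren r t)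
  | Bot => Bot
  | Imp p q => Imp (fren p r) (fren q r)
  | And p q => And (fren p r) (fren q r)
  | Or p q => Or (fren p r) (fren q r)
  | All p => All (fren p (rup r))
  | Ex p => Ex (fren p (rup r))
  end.

Definition wk {Γ B} : renaming Γ (B :: Γ) := fun A v => vs v.

Definition scons {Γ Δ B} (t : tm Δ B) (s : substitution Γ Δ) :
    substitution (B :: Γ) Δ :=
  fun A v =>
    match v in var Γ' A'
      return match Γ' with
             | nil => unit
             | B' :: Γ0 => tm Δ B' -> substitution Γ0 Δ -> tm Δ A'
             end
    with
    | vz => fun t _ => t
    | vs w => fun _ s => s _ w
    end t s.

Definition sid {Γ} : substitution Γ Γ := fun A v => Var v.

Definition swk {Γ Δ B} (s : substitution Γ Δ) : substitution Γ (B :: Δ) :=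
  fun A v => tren wk (s _ v).

Definition sup {Γ Δ B} (s : substitution Γ Δ) : substitution (B :: Γ) (B :: Δ) :=
  scons (Var vz) (swk s).

Fixpoint tsubst {Γ Δ} (σ : substitution Γ Δ) {A} (t : tm Γ A) : tm Δ A :=
  match t with
  | Var v => σ _ v
  | Con c => Con c
  | App s u => App (tsubst σ s) (tsubst σ u)
  end.

Fixpoint fsubst {Γ} (φ : fm Γ) {Δ} (σ : substitution Γ Δ) : fm Δ :=
  match φ with
  | Eq s t => Eq (tsubst σ s) (tsubst σ t)
  | Lt s t => Lt (tsubst σ s) (tsubst σ t)
  | Bot => Bot
  | Imp p q => Imp (fsubst p σ) (fsubst q σ)
  | And p q => And (fsubst p σ) (fsubst q σ)
  | Or p q => Or (fsubst p σ) (fsubst q σ)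
  | All p => All (fsubst p (sup σ))
  | Ex p => Ex (fsubst p (sup σ))
  end.

Definition inst {Γ A} (φ : fm (A :: Γ)) (t : tm Γ A) : fm Γ :=
  fsubst φ (scons t sid).

(** * Named binders

    [∀ x : A, φ] binds [x] as a Rocq variable that stands for de Bruijn index 0;
    [! x] weakens [x] from the context where it was introduced to the context
    where it is used, the weakening being found by type class resolution. *)

Class weakening (Γ Δ : ctx) := weaken : renaming Γ Δ.
#[global] Hint Mode weakening ! ! : typeclass_instances.
#[global] Instance weakening_refl Γ : weakening Γ Γ | 0 := fun _ v => v.
#[global] Instance weakening_step Γ Δ B (w : weakening Γ Δ) :
  weakening Γ (B :: Δ) | 1 := fun _ v => vs (w _ v).

Definition lift {Γ Δ} {w : weakening Γ Δ} {A} (t : tm Γ A) : tm Δ A := tren w t.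

Definition all_ {Γ} A (F : tm (A :: Γ) A -> fm (A :: Γ)) : fm Γ := All (F (Var vz)).
Definition ex_ {Γ} A (F : tm (A :: Γ) A -> fm (A :: Γ)) : fm Γ := Ex (F (Var vz)).
Definition Not {Γ} (φ : fm Γ) : fm Γ := Imp φ Bot.
Definition Iff {Γ} (φ ψ : fm Γ) : fm Γ := And (Imp φ ψ) (Imp ψ φ).

Declare Scope fm_scope.
Delimit Scope fm_scope with fm.
Bind Scope fm_scope with fm.
Open Scope fm_scope.

Notation "! x" := (lift x) (at level 1, x at level 0, format "! x").
Notation "s · t" := (App s t) (at level 40, left associativity).
Notation "s ⊕ t" := (Con cadd · s · t) (at level 50, left associativity).
Notation "s ⊗ t" := (Con cmul · s · t) (at level 45, left associativity).
Notation "s ≐ t" := (Eq s t) (at level 70) : fm_scope.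
Notation "s ≺ t" := (Lt s t) (at level 70) : fm_scope.
Notation "¬ φ" := (Not φ) (at level 75, right associativity) : fm_scope.
Notation "φ ∧ ψ" := (And φ ψ) (at level 80, right associativity) : fm_scope.
Notation "φ ∨ ψ" := (Or φ ψ) (at level 85, right associativity) : fm_scope.
Notation "φ ⇒ ψ" := (Imp φ ψ) (at level 90, right associativity) : fm_scope.
Notation "φ ⇔ ψ" := (Iff φ ψ) (at level 95) : fm_scope.
Notation "∀ x : A , φ" := (all_ (A := A) (fun x => φ))
  (at level 200, x name, A at level 99, φ at level 200) : fm_scope.
Notation "∃ x : A , φ" := (ex_ (A := A) (fun x => φ))
  (at level 200, x name, A at level 99, φ at level 200) : fm_scope.

(* Equality at higher types is the usual abbreviation. *)
Fixpoint eqT {A} : forall Γ, tm Γ A -> tm Γ A -> fm Γ :=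
  match A return forall Γ, tm Γ A -> tm Γ A -> fm Γ with
  | tN => fun Γ s t => s ≐ t
  | B ~> C => fun Γ s t => ∀ z : B, eqT (!s · z) (!t · z)
  end.

(** * Classical natural deduction *)

Definition theory : Type := forall Γ, fm Γ -> Prop.

Section Deduction.
Variable T : theory.

Inductive prf : forall Γ, list (fm Γ) -> fm Γ -> Prop :=
| prf_hyp : forall Γ (H : list (fm Γ)) φ, In φ H -> prf H φ
| prf_ax : forall Γ (H : list (fm Γ)) φ, T φ -> prf H φ
| prf_raa : forall Γ (H : list (fm Γ)) φ, prf ((¬ φ) :: H) Bot -> prf H φ
| prf_impI : forall Γ (H : list (fm Γ)) φ ψ, prf (φ :: H) ψ -> prf H (φ ⇒ ψ)
| prf_impE : forall Γ (H : list (fm Γ)) φ ψ, prf H (φ ⇒ ψ) -> prf H φ -> prf H ψ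
| prf_andI : forall Γ (H : list (fm Γ)) φ ψ, prf H φ -> prf H ψ -> prf H (φ ∧ ψ)
| prf_andE1 : forall Γ (H : list (fm Γ)) φ ψ, prf H (φ ∧ ψ) -> prf H φ
| prf_andE2 : forall Γ (H : list (fm Γ)) φ ψ, prf H (φ ∧ ψ) -> prf H ψ
| prf_orI1 : forall Γ (H : list (fm Γ)) φ ψ, prf H φ -> prf H (φ ∨ ψ)
| prf_orI2 : forall Γ (H : list (fm Γ)) φ ψ, prf H ψ -> prf H (φ ∨ ψ)
| prf_orE : forall Γ (H : list (fm Γ)) φ ψ χ,
    prf H (φ ∨ ψ) -> prf (φ :: H) χ -> prf (ψ :: H) χ -> prf H χ
| prf_allI : forall Γ (H : list (fm Γ)) A (φ : fm (A :: Γ)),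
    prf (map (fun h => fren h wk) H) φ -> prf H (All φ)
| prf_allE : forall Γ (H : list (fm Γ)) A (φ : fm (A :: Γ)) t,
    prf H (All φ) -> prf H (inst φ t)
| prf_exI : forall Γ (H : list (fm Γ)) A (φ : fm (A :: Γ)) t,
    prf H (inst φ t) -> prf H (Ex φ)
| prf_exE : forall Γ (H : list (fm Γ)) A (φ : fm (A :: Γ)) ψ,
    prf H (Ex φ) -> prf (φ :: map (fun h => fren h wk) H) (fren ψ wk) -> prf H ψ.

End Deduction.

Definition proves (T : theory) (φ : fm nil) : Prop := prf T nil φ.
Notation "T ⊢ φ" := (proves T φ%fm) (at level 99).

(** * The systems *)

Notation "'zero'" := (Con c0).
Notation "'one'" := (Con c1).
Notation "'R0'" := (Con cR0).

(* Free variables in axioms are implicitly universally quantified. *)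
Inductive RCA0w : theory :=
| ax_refl : forall Γ (s : tm Γ tN), RCA0w (s ≐ s)
| ax_sym : forall Γ (s t : tm Γ tN), RCA0w (s ≐ t ⇒ t ≐ s)
| ax_trans : forall Γ (s t u : tm Γ tN), RCA0w (s ≐ t ⇒ t ≐ u ⇒ s ≐ u)
| ax_lt_eq : forall Γ (s s' t t' : tm Γ tN), RCA0w (s ≐ s' ⇒ t ≐ t' ⇒ s ≺ t ⇒ s' ≺ t')
| ax_addC : forall Γ (s t : tm Γ tN), RCA0w (s ⊕ t ≐ t ⊕ s)
| ax_addA : forall Γ (s t u : tm Γ tN), RCA0w (s ⊕ (t ⊕ u) ≐ s ⊕ t ⊕ u)
| ax_add0 : forall Γ (s : tm Γ tN), RCA0w (s ⊕ zero ≐ s)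
| ax_mulC : forall Γ (s t : tm Γ tN), RCA0w (s ⊗ t ≐ t ⊗ s)
| ax_mulA : forall Γ (s t u : tm Γ tN), RCA0w (s ⊗ (t ⊗ u) ≐ s ⊗ t ⊗ u)
| ax_mul1 : forall Γ (s : tm Γ tN), RCA0w (s ⊗ one ≐ s)
| ax_mul0 : forall Γ (s : tm Γ tN), RCA0w (s ⊗ zero ≐ zero)
| ax_mulD : forall Γ (s t u : tm Γ tN), RCA0w (s ⊗ (t ⊕ u) ≐ s ⊗ t ⊕ s ⊗ u)
| ax_lt_irr : forall Γ (s : tm Γ tN), RCA0w (¬ s ≺ s)
| ax_lt_trans : forall Γ (s t u : tm Γ tN), RCA0w (s ≺ t ⇒ t ≺ u ⇒ s ≺ u)
| ax_lt_total : forall Γ (s t : tm Γ tN), RCA0w (s ≺ t ∨ s ≐ t ∨ t ≺ s)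
| ax_lt01 : forall Γ, RCA0w (Γ := Γ) (zero ≺ one)
| ax_lt_add : forall Γ (s t u : tm Γ tN), RCA0w (s ≺ t ⇒ s ⊕ u ≺ t ⊕ u)
| ax_lt_mul : forall Γ (s t u : tm Γ tN), RCA0w (s ≺ t ⇒ zero ≺ u ⇒ s ⊗ u ≺ t ⊗ u)
| ax_Pi : forall Γ A B (s : tm Γ A) (t : tm Γ B), RCA0w (eqT (Con cPi · s · t) s)
| ax_Sigma : forall Γ A B C (s : tm Γ (A ~> B ~> C)) (t : tm Γ (A ~> B)) (u : tm Γ A),
    RCA0w (eqT (Con cSigma · s · t · u) (s · u · (t · u)))
| ax_R0_zero : forall Γ (f : tm Γ (tN ~> tN ~> tN)) m, RCA0w (R0 · f · m · zero ≐ m)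
| ax_R0_succ : forall Γ (f : tm Γ (tN ~> tN ~> tN)) m n,
    RCA0w (R0 · f · m · (n ⊕ one) ≐ f · n · (R0 · f · m · n))
| ax_ext : forall Γ A B (s t : tm Γ A) (u : tm Γ (A ~> B)),
    RCA0w (eqT s t ⇒ eqT (u · s) (u · t))
| ax_QFind : forall Γ (φ : fm (tN :: Γ)), qf φ ->
    RCA0w (inst φ zero ∧
           All (φ ⇒ fsubst φ (scons (Var vz ⊕ one) (swk sid))) ⇒ All φ)
(* [φ] has free variables y (index 0) and x (index 1); on the right they become
   Y x and x, in a context where x has index 0 and Y has index 1. *)
| ax_QFAC10 : forall Γ (φ : fm (tN :: t1 :: Γ)), qf φ ->
    RCA0w (All (Ex φ) ⇒
           Ex (A := t2) (All (A := t1)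
             (fsubst φ (scons (Var (vs vz) · Var vz) (scons (Var vz) (swk (swk sid))))))).

Definition mu_axiom {Γ} : fm Γ :=
  ∃ μ : t2, ∀ f : t1,
    ((∃ n : tN, !f · n ≐ zero) ⇒
       f · (!μ · f) ≐ zero ∧ (∀ i : tN, i ≺ !μ · !f ⇒ ¬ !f · i ≐ zero))
    ∧ (¬ (∃ n : tN, !f · n ≐ zero) ⇒ !μ · f ≐ zero).

Inductive ACA0w : theory :=
| ACA0w_RCA0w : forall Γ (φ : fm Γ), RCA0w φ -> ACA0w φ
| ACA0w_mu : forall Γ, ACA0w (Γ := Γ) mu_axiom.

(** * λ-abstraction by the combinators *)

Definition abs_var {Γ A B} (v : var (A :: Γ) B) : tm Γ (A ~> B) :=
  match v in var Γ' B'
    return match Γ' with nil => unit | A' :: Γ0 => tm Γ0 (A' ~> B') end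
  with
  | @vz Γ0 A' => Con (@cSigma A' (A' ~> A') A') · Con cPi · Con cPi
  | vs w => Con cPi · Var w
  end.

Fixpoint abs {Γ A B} (t : tm (A :: Γ) B) : tm Γ (A ~> B) :=
  match t with
  | Var v => abs_var v
  | Con c => Con cPi · Con c
  | App s u => Con cSigma · abs s · abs u
  end.

Definition lam {Γ A B} (F : tm (A :: Γ) A -> tm (A :: Γ) B) : tm Γ (A ~> B) :=
  abs (F (Var vz)).

Notation "'λ' x : A , t" := (lam (A := A) (fun x => t))
  (at level 200, x name, A at level 99, t at level 200).

(** * Primitive recursive functions *)

Definition tle {Γ} (s t : tm Γ tN) : fm Γ := s ≺ t ∨ s ≐ t.

Definition tpred {Γ} (s : tm Γ tN) : tm Γ tN :=
  R0 · (λ n : tN, λ r : tN, !n) · zero · s.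

Definition tsub {Γ} (s t : tm Γ tN) : tm Γ tN :=
  R0 · (λ n : tN, λ r : tN, tpred r) · s · t.

(* [b] if [a] is zero, [c] otherwise *)
Definition tif0 {Γ} (a b c : tm Γ tN) : tm Γ tN :=
  R0 · (λ n : tN, λ r : tN, !c) · b · a.

Definition pow2 {Γ} (s : tm Γ tN) : tm Γ tN :=
  R0 · (λ n : tN, λ r : tN, r ⊕ r) · one · s.

(* s (s + 1) / 2 *)
Definition tri {Γ} (s : tm Γ tN) : tm Γ tN :=
  R0 · (λ n : tN, λ r : tN, r ⊕ !n ⊕ one) · zero · s.

Definition tdist {Γ} (s t : tm Γ tN) : tm Γ tN := tsub s t ⊕ tsub t s.

(* Cantor pairing <a, b> = tri (a + b) + b; [diag s] is the largest w such that
   tri w <= s, that is, a + b for s = <a, b>. *)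
Definition diag {Γ} (s : tm Γ tN) : tm Γ tN :=
  R0 · (λ n : tN, λ r : tN, tif0 (tdist (!n ⊕ one) (tri (r ⊕ one))) (r ⊕ one) r)
     · zero · s.

Definition tpair {Γ} (a b : tm Γ tN) : tm Γ tN := tri (a ⊕ b) ⊕ b.
Definition tsnd {Γ} (s : tm Γ tN) : tm Γ tN := tsub s (tri (diag s)).
Definition tfst {Γ} (s : tm Γ tN) : tm Γ tN := tsub (diag s) (tsnd s).

(** * Rational numbers: the code <<a, b>, c> stands for (a - b) / (c + 1)

    Every natural number is the code of exactly one rational number; a rational
    number has many codes. *)

Definition mkQ {Γ} (a b c : tm Γ tN) : tm Γ tN := tpair (tpair a b) c.
Definition qpos {Γ} (q : tm Γ tN) : tm Γ tN := tfst (tfst q).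
Definition qneg {Γ} (q : tm Γ tN) : tm Γ tN := tsnd (tfst q).
Definition qden {Γ} (q : tm Γ tN) : tm Γ tN := tsnd q ⊕ one.

Definition qzero {Γ} : tm Γ tN := mkQ zero zero zero.
Definition qone {Γ} : tm Γ tN := mkQ one zero zero.
Definition qadd {Γ} (p q : tm Γ tN) : tm Γ tN :=
  mkQ (qpos p ⊗ qden q ⊕ qpos q ⊗ qden p)
      (qneg p ⊗ qden q ⊕ qneg q ⊗ qden p)
      (tpred (qden p ⊗ qden q)).
Definition qopp {Γ} (q : tm Γ tN) : tm Γ tN := mkQ (qneg q) (qpos q) (tsnd q).
Definition qsub {Γ} (p q : tm Γ tN) : tm Γ tN := qadd p (qopp q).
Definition qabs {Γ} (q : tm Γ tN) : tm Γ tN :=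
  mkQ (tdist (qpos q) (qneg q)) zero (tsnd q).

(* 2 ^ (- n) *)
Definition qpow2 {Γ} (n : tm Γ tN) : tm Γ tN := mkQ one zero (tpred (pow2 n)).

Definition qlt {Γ} (p q : tm Γ tN) : fm Γ :=
  qpos p ⊗ qden q ⊕ qneg q ⊗ qden p ≺ qpos q ⊗ qden p ⊕ qneg p ⊗ qden q.
Definition qle {Γ} (p q : tm Γ tN) : fm Γ :=
  tle (qpos p ⊗ qden q ⊕ qneg q ⊗ qden p) (qpos q ⊗ qden p ⊕ qneg p ⊗ qden q).

(** * Real numbers *)

Definition is_real {Γ} (x : tm Γ t1) : fm Γ :=
  ∀ n : tN, ∀ i : tN, qlt (qabs (qsub (!x · !n) (!x · (!n ⊕ i)))) (qpow2 !n).

Definition req {Γ} (x y : tm Γ t1) : fm Γ :=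
  ∀ n : tN, qle (qabs (qsub (!x · n) (!y · n))) (qadd (qpow2 n) (qpow2 n)).
Definition rlt {Γ} (x y : tm Γ t1) : fm Γ :=
  ∃ n : tN, qlt (qadd (!x · n) (qadd (qpow2 n) (qpow2 n))) (!y · n).
Definition rle {Γ} (x y : tm Γ t1) : fm Γ := ¬ rlt y x.

Definition rconst {Γ} (q : tm Γ tN) : tm Γ t1 := λ n : tN, !q.
Definition rzero {Γ} : tm Γ t1 := rconst qzero.
Definition rone {Γ} : tm Γ t1 := rconst qone.

(* The index shift restores the rate of convergence. *)
Definition radd {Γ} (x y : tm Γ t1) : tm Γ t1 :=
  λ n : tN, qadd (!x · (n ⊕ one)) (!y · (n ⊕ one)).
Definition ropp {Γ} (x : tm Γ t1) : tm Γ t1 := λ n : tN, qopp (!x · n).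
Definition rsub {Γ} (x y : tm Γ t1) : tm Γ t1 := radd x (ropp y).
Definition rabs {Γ} (x : tm Γ t1) : tm Γ t1 := λ n : tN, qabs (!x · n).

(* [rsum z n] is the sum of [z · k] for k < n; its m-th approximation adds the
   (m + n)-th approximations, which is precise enough since n <= 2 ^ n. *)
Definition rsum {Γ} (z : tm Γ (tN ~> t1)) (n : tm Γ tN) : tm Γ t1 :=
  λ m : tN, R0 · (λ k : tN, λ s : tN, qadd s (!z · !k · (!m ⊕ !n))) · qzero · !n.

Definition in_I {Γ} (x : tm Γ t1) : fm Γ := rle rzero x ∧ rle x rone.

Definition allR {Γ} (F : tm (t1 :: Γ) t1 -> fm (t1 :: Γ)) : fm Γ :=
  all_ (fun x => is_real x ⇒ F x).
Definition exR {Γ} (F : tm (t1 :: Γ) t1 -> fm (t1 :: Γ)) : fm Γ :=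
  ex_ (fun x => is_real x ∧ F x).

Notation "∀ x '∈ℝ' , φ" := (allR (fun x => φ))
  (at level 200, x name, φ at level 200) : fm_scope.
Notation "∃ x '∈ℝ' , φ" := (exR (fun x => φ))
  (at level 200, x name, φ at level 200) : fm_scope.

(** * Lebesgue outer measure, read comparatively

    A class of reals is a formula with a distinguished variable, at index 0. *)

Definition cls (Γ : ctx) : Type := fm (t1 :: Γ).

Definition comprehension {Γ} (F : tm (t1 :: Γ) t1 -> fm (t1 :: Γ)) : cls Γ := F (Var vz).
Notation "⟦ x | φ ⟧" := (comprehension (fun x => φ)) (at level 0, x name, φ at level 200).

Definition wkcls {Γ Δ} {w : weakening Γ Δ} (P : cls Γ) : cls Δ := fren P (rup w).
Definition is_in {Γ} (x : tm Γ t1) (P : cls Γ) : fm Γ := inst P x.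

(* The open intervals (a k, b k), possibly empty, with real end-points; the
   condition a k <= b k makes b k - a k the length. *)
Definition intervals {Γ} (a b : tm Γ (tN ~> t1)) : fm Γ :=
  ∀ k : tN, is_real (!a · k) ∧ is_real (!b · k) ∧ rle (!a · k) (!b · k).
Definition covers {Γ} (a b : tm Γ (tN ~> t1)) (P : cls Γ) : fm Γ :=
  ∀ x ∈ℝ, is_in x (wkcls P) ⇒ ∃ k : tN, rlt (!a · k) !x ∧ rlt !x (!b · k).
Definition lengths {Γ} (a b : tm Γ (tN ~> t1)) : tm Γ (tN ~> t1) :=
  λ k : tN, rsub (!b · k) (!a · k).
Definition is_cover {Γ} (a b : tm Γ (tN ~> t1)) (P : cls Γ) : fm Γ :=
  intervals a b ∧ covers a b P.

(* r <= sum of z, for z with nonnegative terms *)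
Definition le_series {Γ} (r : tm Γ t1) (z : tm Γ (tN ~> t1)) : fm Γ :=
  ∀ t ∈ℝ, rlt t !r ⇒ ∃ n : tN, rlt !t (rsum !z n).
(* sum of z + sum of z' <= r, for z and z' with nonnegative terms *)
Definition series2_le {Γ} (z z' : tm Γ (tN ~> t1)) (r : tm Γ t1) : fm Γ :=
  ∀ n : tN, ∀ m : tN, rle (radd (rsum !z !n) (rsum !z' m)) !r.

Definition measure_ge {Γ} (P : cls Γ) (r : tm Γ t1) : fm Γ :=
  ∀ a : tN ~> t1, ∀ b : tN ~> t1,
    is_cover !a b (wkcls P) ⇒ le_series !r (lengths !a b).

(* λ(P) + λ([0,1] \ P) <= 1, for P included in [0,1] *)
Definition measurable {Γ} (P : cls Γ) : fm Γ :=
  ∀ δ ∈ℝ, rlt rzero δ ⇒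
    ∃ a : tN ~> t1, ∃ b : tN ~> t1, ∃ c : tN ~> t1, ∃ d : tN ~> t1,
      is_cover !a !b (wkcls P)
      ∧ is_cover !c d ⟦ x | in_I x ∧ ¬ is_in x (wkcls P) ⟧
      ∧ series2_le (lengths !a !b) (lengths !c d) (radd rone !δ).

(** * Functions and sets *)

Definition fun_I {Γ} (f : tm Γ (t1 ~> t1)) : fm Γ :=
  (∀ x ∈ℝ, in_I x ⇒ is_real (!f · x))
  ∧ (∀ x ∈ℝ, ∀ y ∈ℝ, in_I !x ⇒ in_I y ⇒ req !x y ⇒ req (!f · !x) (!f · y)).

Definition fun_R {Γ} (f : tm Γ (t1 ~> t1)) : fm Γ :=
  (∀ x ∈ℝ, is_real (!f · x))
  ∧ (∀ x ∈ℝ, ∀ y ∈ℝ, req !x y ⇒ req (!f · !x) (!f · y)).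

Definition mem {Γ} (x : tm Γ t1) (Y : tm Γ (t1 ~> t1)) : fm Γ := rlt rzero (Y · x).

Definition subset_I {Γ} (Y : tm Γ (t1 ~> t1)) : fm Γ := ∀ x ∈ℝ, mem x !Y ⇒ in_I x.

Definition measurable_fun {Γ} (f : tm Γ (t1 ~> t1)) : fm Γ :=
  ∀ t ∈ℝ, measurable ⟦ x | in_I x ∧ rlt !t (!f · x) ⟧.

Definition continuous_on {Γ} (f Y : tm Γ (t1 ~> t1)) : fm Γ :=
  ∀ x ∈ℝ, mem x !Y ⇒ ∀ ε ∈ℝ, rlt rzero ε ⇒
    ∃ δ ∈ℝ, rlt rzero δ ∧
      ∀ y ∈ℝ, mem y !Y ⇒
        rlt (rabs (rsub !x y)) !δ ⇒ rlt (rabs (rsub (!f · !x) (!f · y))) !ε.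

(* Y = [0,1] \ U_n (a n, b n) for sequences a, b of rationals *)
Definition RM_closed {Γ} (Y : tm Γ (t1 ~> t1)) : fm Γ :=
  ∃ a : t1, ∃ b : t1, ∀ x ∈ℝ,
    mem x !Y ⇔
      in_I x ∧ ¬ ∃ n : tN, rlt (rconst (!a · n)) !x ∧ rlt !x (rconst (!b · n)).

Definition lusin_set {Γ} (f : tm Γ (t1 ~> t1)) (ε : tm Γ t1)
    (Y : tm Γ (t1 ~> t1)) : fm Γ :=
  fun_R Y ∧ subset_I Y
  ∧ measurable ⟦ x | mem x !Y ⟧
  ∧ measure_ge ⟦ x | mem x !Y ⟧ (rsub rone ε)
  ∧ continuous_on f Y.

(** * The principles *)

Definition LUS : fm nil :=
  ∀ f : t1 ~> t1, fun_I f ∧ measurable_fun f ⇒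
    ∀ ε ∈ℝ, rlt rzero ε ⇒ ∃ E : t1 ~> t1, lusin_set !f !ε E.

Definition LUS_RM : fm nil :=
  ∀ f : t1 ~> t1, fun_I f ∧ measurable_fun f ⇒
    ∀ ε ∈ℝ, rlt rzero ε ⇒ ∃ E : t1 ~> t1, lusin_set !f !ε E ∧ RM_closed E.

Definition WHBU_m : fm nil :=
  ∀ Ψ : t1 ~> t1,
    fun_I Ψ ∧ (∀ x ∈ℝ, in_I x ⇒ rlt rzero (!Ψ · x)) ∧ measurable_fun Ψ ⇒
    ∀ ε ∈ℝ, rlt rzero ε ⇒
      ∃ y : tN ~> t1, ∃ n : tN,
        (∀ i : tN, tle i !n ⇒ is_real (!y · i) ∧ in_I (!y · i))
        ∧ measure_ge
            ⟦ x | ∃ i : tN, tle i !n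
                  ∧ rlt (rsub (!y · i) (!Ψ · (!y · i))) !x
                  ∧ rlt !x (radd (!y · i) (!Ψ · (!y · i))) ⟧
            (rsub rone !ε).

(* Main.v *)
(** The calculus is complete for extensional structures: a Henkin theory has a
    term model in which provably equal terms are identified. So we argue in an
    arbitrary model M. Its numbers form a possibly nonstandard ordered semiring,
    whose fractions have a completion K; names of reals have values in K, and by
    the search operator induction holds for all arithmetical predicates.

    In M the unit interval is compact for arithmetical families of dyadic
    intervals: from an interval that is covered at no level, descending to a
    child of the same kind yields a point. Hence a cover of [0,1] by a sequence
    of intervals has a finite subcover, and its total length is at least 1.

    Let E be given by LUS for a smaller ε. Measurability gives a cover of
    [0,1] \ E of small total length. Enlarge it to rational end-points and remove
    it from [0,1]: this leaves an RM-closed subset of E, of large measure by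
    compactness, and measurable because the removed sequence has small tails.

    For WHBU, let E be such a closed set on which Ψ is continuous. The descent
    above yields a point of E in each dyadic interval that meets E. By continuity
    the balls around these points cover E, so together with the removed intervals
    they cover [0,1]. By compactness finitely many of the balls cover E. *)

From HB Require Import structures.
From mathcomp Require Import all_boot all_order all_algebra boolp ring lra.
From Stdlib Require Import Eqdep Cantor.
Require Import Defs.
Set Implicit Arguments.
Unset Strict Implicit.
Unset Printing Implicit Defensive.
Unset Asymmetric Patterns.

(** * Substitution calculus *)

(** The obstacle is arithmetic inside M. A number of M may be nonstandard, so induction, finite sums
    and finite choices of the metatheory do not apply to it. Induction is available only for
    predicates whose characteristic function is an element of M, and each argument therefore carries
    a proof of definability, found by the tactic [dfn]. The search operator closes these predicates
    under number quantifiers. The field K stays outside of M. It serves to settle inequalities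
    between reals of M by linear arithmetic, whereas the covers, points and closed sets that the
    principles ask for must be elements of M. In WHBU the balls form a family indexed by reals, but
    compactness holds for sequences. The descent bridges the gap: one arithmetical functional gives
    a point for each pair of a level and an index, so that the balls around these points are a
    sequence. *)

Definition var_case Γ B (P : forall A, var (B :: Γ) A -> Type)
    (Hz : P B vz) (Hs : forall A v, P A (vs v)) A (v : var (B :: Γ) A) : P A v :=
  (* The type of [P] mentions the context that the match refines, so [P] is quantified again inside
     the return clause. *)
  match v in var Γ' A' return
    match Γ' return var Γ' A' -> Type with
    | nil => fun _ => unit
    | B' :: Γ0 => fun v => forall P : forall A, var (B' :: Γ0) A -> Type,
        P B' vz -> (forall A w, P A (vs w)) -> P A' v
    end v
  with
  | vz => fun P hz hs => hz
  | vs w => fun P hz hs => hs _ w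
  end P Hz Hs.

Lemma vfun_ext Γ (X : ty -> Type) (f g : forall A, var Γ A -> X A) :
  (forall A v, f A v = g A v) -> f = g.
Proof.
by move=> e; do 2! [apply: functional_extensionality_dep => ?]; apply: e.
Qed.

(** Renamings, substitutions and environments are all of this shape, whence the general [X]. *)
Lemma vfun_consE Γ B (X : ty -> Type) (f g : forall A, var (B :: Γ) A -> X A) :
  f B vz = g B vz -> (forall A v, f A (vs v) = g A (vs v)) -> f = g.
Proof. by move=> ez es; apply: vfun_ext; apply: var_case. Qed.

Lemma tsubst_tren Γ Δ Θ (r : renaming Γ Δ) (s : substitution Δ Θ) A (t : tm Γ A) :
  tsubst s (tren r t) = tsubst (fun A v => s A (r A v)) t.
Proof. by elim: t => //= ? ? ? -> ? ->. Qed.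

Lemma tren_tsubst Γ Δ Θ (s : substitution Γ Δ) (r : renaming Δ Θ) A (t : tm Γ A) :
  tren r (tsubst s t) = tsubst (fun A v => tren r (s A v)) t.
Proof. by elim: t => //= ? ? ? -> ? ->. Qed.

Lemma tsubst_comp Γ Δ Θ (s : substitution Γ Δ) (s' : substitution Δ Θ) A (t : tm Γ A) :
  tsubst s' (tsubst s t) = tsubst (fun A v => tsubst s' (s A v)) t.
Proof. by elim: t => //= ? ? ? -> ? ->. Qed.

Lemma tren_as_tsubst Γ Δ (r : renaming Γ Δ) A (t : tm Γ A) :
  tren r t = tsubst (fun A v => Var (r A v)) t.
Proof. by elim: t => //= ? ? ? -> ? ->. Qed.

Lemma tsubst_sid Γ A (t : tm Γ A) : tsubst sid t = t.
Proof. by elim: t => //= ? ? ? -> ? ->. Qed.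

Lemma fren_as_fsubst Γ (φ : fm Γ) Δ (r : renaming Γ Δ) :
  fren φ r = fsubst φ (fun A v => Var (r A v)).
Proof.
elim: φ Δ r => //= {Γ}.
- by move=> Γ s t Δ r; rewrite !tren_as_tsubst.
- by move=> Γ s t Δ r; rewrite !tren_as_tsubst.
- by move=> Γ p IHp q IHq Δ r; rewrite IHp IHq.
- by move=> Γ p IHp q IHq Δ r; rewrite IHp IHq.
- by move=> Γ p IHp q IHq Δ r; rewrite IHp IHq.
- by move=> Γ A p IHp Δ r; rewrite IHp; do 2! congr (_ _); apply: vfun_consE.
- by move=> Γ A p IHp Δ r; rewrite IHp; do 2! congr (_ _); apply: vfun_consE.
Qed.

Lemma sup_comp Γ Δ Θ B (s : substitution Γ Δ) (s' : substitution Δ Θ) :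
  (fun A v => tsubst (sup s') (sup (B := B) s v))
  = sup (fun A v => tsubst s' (s A v)).
Proof.
apply: vfun_consE => //= A v.
by rewrite /swk tsubst_tren tren_tsubst.
Qed.

Lemma fsubst_comp Γ (φ : fm Γ) Δ Θ (s : substitution Γ Δ) (s' : substitution Δ Θ) :
  fsubst (fsubst φ s) s' = fsubst φ (fun A v => tsubst s' (s A v)).
Proof.
elim: φ Δ Θ s s' => //= {Γ}.
- by move=> Γ s t *; rewrite !tsubst_comp.
- by move=> Γ s t *; rewrite !tsubst_comp.
- by move=> Γ p IHp q IHq *; rewrite IHp IHq.
- by move=> Γ p IHp q IHq *; rewrite IHp IHq.
- by move=> Γ p IHp q IHq *; rewrite IHp IHq.
- by move=> Γ A p IHp *; rewrite IHp sup_comp.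
- by move=> Γ A p IHp *; rewrite IHp sup_comp.
Qed.

Lemma sup_sid Γ B : sup (B := B) (@sid Γ) = sid.
Proof. exact: vfun_consE. Qed.

Lemma fsubst_sid Γ (φ : fm Γ) : fsubst φ sid = φ.
Proof.
elim: φ => //= {Γ}.
- by move=> Γ s t; rewrite !tsubst_sid.
- by move=> Γ s t; rewrite !tsubst_sid.
- by move=> Γ p -> q ->.
- by move=> Γ p -> q ->.
- by move=> Γ p -> q ->.
- by move=> Γ A p IHp; rewrite sup_sid IHp.
- by move=> Γ A p IHp; rewrite sup_sid IHp.
Qed.

Lemma inst_fsubst_sup Γ Δ A (φ : fm (A :: Γ)) (s : substitution Γ Δ) t :
  inst (fsubst φ (sup s)) t = fsubst φ (scons t s).
Proof.
rewrite /inst fsubst_comp; congr fsubst; apply: vfun_consE => //= B v.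
by rewrite /swk tsubst_tren /= -[RHS]tsubst_sid.
Qed.

Lemma fren_inst Γ Δ A (φ : fm (A :: Γ)) t (r : renaming Γ Δ) :
  fren (inst φ t) r = inst (fren φ (rup r)) (tren r t).
Proof.
rewrite !fren_as_fsubst /inst !fsubst_comp; congr fsubst.
by apply: vfun_consE => //=; rewrite tren_as_tsubst.
Qed.

Lemma fren_comp Γ Δ Θ (φ : fm Γ) (r : renaming Γ Δ) (r' : renaming Δ Θ) :
  fren (fren φ r) r' = fren φ (fun A v => r' A (r A v)).
Proof. by rewrite !fren_as_fsubst fsubst_comp. Qed.

Lemma fren_wk_rup Γ Δ B (φ : fm Γ) (r : renaming Γ Δ) :
  fren (fren φ wk) (rup (B := B) r) = fren (fren φ r) wk.
Proof. by rewrite !fren_comp. Qed.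

(** This lets a freshly added variable serve as the witness of an existential formula. *)
Lemma inst_wk_rup Γ B (φ : fm (B :: Γ)) :
  inst (fren φ (rup wk)) (Var vz) = φ.
Proof.
rewrite fren_as_fsubst /inst fsubst_comp -[RHS]fsubst_sid.
by congr fsubst; apply: vfun_consE.
Qed.

Lemma fsubst_eqT A Γ Δ (s t : tm Γ A) (σ : substitution Γ Δ) :
  fsubst (eqT s t) σ = eqT (tsubst σ s) (tsubst σ t).
Proof.
elim: A Γ Δ s t σ => //= B _ C IH Γ Δ s t σ.
by rewrite IH /= /lift !tsubst_tren !tren_tsubst.
Qed.

Lemma fren_eqT A Γ Δ (s t : tm Γ A) (r : renaming Γ Δ) :
  fren (eqT s t) r = eqT (tren r s) (tren r t).
Proof. by rewrite fren_as_fsubst fsubst_eqT -!tren_as_tsubst. Qed.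

Lemma inst_eqT_app Γ A B (s t : tm Γ (A ~> B)) u :
  inst (eqT (lift s · Var vz) (lift t · Var vz)) u = eqT (s · u) (t · u).
Proof.
by rewrite /inst fsubst_eqT /= /lift !tsubst_tren /= -/(@sid Γ) !tsubst_sid.
Qed.

Lemma qf_fren Γ (φ : fm Γ) Δ (r : renaming Γ Δ) : qf φ -> qf (fren φ r).
Proof.
elim: φ Δ r => //= {Γ} Γ p IHp q IHq Δ r [/IHp ? /IHq ?]; by split.
Qed.

(** The axioms are schemata over all contexts, so a renamed instance is an instance. Only induction
    and choice, which contain substitutions, require a commutation. *)
Lemma RCA0w_fren Γ Δ (φ : fm Γ) (r : renaming Γ Δ) : RCA0w φ -> RCA0w (fren φ r).
Proof.
move=> a; case: a r => {Γ φ}; try by move=> *; constructor.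
- by move=> Γ A B s t r; rewrite fren_eqT; constructor.
- by move=> Γ A B C s t u r; rewrite fren_eqT; constructor.
- by move=> Γ A B s t u r; rewrite /= !fren_eqT; constructor.
- move=> Γ φ /qf_fren h r.
  have := ax_QFind (h _ (rup r)); congr RCA0w; rewrite /= fren_inst.
  set p := fsubst _ _; set q := fren (fsubst _ _) _; suff -> : p = q by [].
  rewrite /p /q !fren_as_fsubst !fsubst_comp; congr fsubst.
  exact: vfun_consE.
- move=> Γ φ /qf_fren h r.
  have := ax_QFAC10 (h _ (rup (rup r))); congr RCA0w => /=.
  set p := fsubst _ _; set q := fren (fsubst _ _) _; suff -> : p = q by [].
  rewrite /p /q !fren_as_fsubst !fsubst_comp; congr fsubst.
  by apply: vfun_consE => //; apply: var_case.
Qed.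

Lemma ACA0w_fren Γ Δ (φ : fm Γ) (r : renaming Γ Δ) : ACA0w φ -> ACA0w (fren φ r).
Proof.
move=> a; case: a Δ r => {Γ φ} [Γ φ h|Γ] Δ r; last exact: ACA0w_mu.
exact: ACA0w_RCA0w (RCA0w_fren r h).
Qed.

(** * Derivations *)

Lemma In_map X Y (f : X -> Y) (s : list X) x :
  List.In x s -> List.In (f x) (List.map f s).
Proof. exact: List.in_map. Qed.

(** Inclusion of the renamed hypotheses, instead of equality, gives renaming and weakening at once
    and passes through every rule. *)
Lemma prf_fren (T : theory)
    (T_fren : forall Γ Δ (φ : fm Γ) (r : renaming Γ Δ), T Γ φ -> T Δ (fren φ r))
    Γ (H : list (fm Γ)) φ : prf T H φ ->
  forall Δ (r : renaming Γ Δ) (H' : list (fm Δ)),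
    (forall h, List.In h H -> List.In (fren h r) H') -> prf T H' (fren φ r).
Proof.
have cons_incl Γ' Δ (r : renaming Γ' Δ) h0 (K : list (fm Γ')) (K' : list (fm Δ)) :
    (forall h, List.In h K -> List.In (fren h r) K') ->
    forall h, List.In h (h0 :: K) -> List.In (fren h r) (fren h0 r :: K').
  by move=> i h /= [->|/i]; [left|right].
have wk_incl Γ' Δ (r : renaming Γ' Δ) B (K : list (fm Γ')) (K' : list (fm Δ)) :
    (forall h, List.In h K -> List.In (fren h r) K') ->
    forall h, List.In h (List.map (fun h => fren h (@wk _ B)) K) ->
      List.In (fren h (rup r)) (List.map (fun h => fren h wk) K').
  move=> i h /List.in_map_iff [h' [<- /i]].
  by rewrite fren_wk_rup; apply: In_map.
elim=> {Γ H φ}.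
- by move=> Γ H φ h Δ r H' i; apply/prf_hyp/i.
- by move=> Γ H φ h Δ r H' i; apply/prf_ax/T_fren.
- by move=> Γ H φ _ IH Δ r H' i; apply/prf_raa/(IH _ r)/(cons_incl _ _ r (Not φ)).
- by move=> Γ H φ ψ _ IH Δ r H' i; apply/prf_impI/IH/cons_incl.
- by move=> Γ H φ ψ _ IH _ IH' Δ r H' i; apply: prf_impE (IH _ _ _ i) (IH' _ _ _ i).
- by move=> Γ H φ ψ _ IH _ IH' Δ r H' i; apply: prf_andI (IH _ _ _ i) (IH' _ _ _ i).
- by move=> Γ H φ ψ _ IH Δ r H' i; apply: prf_andE1 (IH _ _ _ i).
- by move=> Γ H φ ψ _ IH Δ r H' i; apply: prf_andE2 (IH _ _ _ i).
- by move=> Γ H φ ψ _ IH Δ r H' i; apply/prf_orI1/IH.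
- by move=> Γ H φ ψ _ IH Δ r H' i; apply/prf_orI2/IH.
- move=> Γ H φ ψ χ _ IH _ IH1 _ IH2 Δ r H' i.
  by apply: prf_orE (IH _ _ _ i) (IH1 _ _ _ _) (IH2 _ _ _ _); apply: cons_incl.
- by move=> Γ H A φ _ IH Δ r H' i; apply/prf_allI/IH/wk_incl.
- by move=> Γ H A φ t _ IH Δ r H' i; rewrite fren_inst; apply/prf_allE/IH.
- move=> Γ H A φ t _ IH Δ r H' i /=; apply: (prf_exI (t := tren r t)).
  by rewrite -fren_inst; apply: IH.
- move=> Γ H A φ ψ _ IH _ IH' Δ r H' i; apply: (prf_exE (IH _ _ _ i)).
  by rewrite -fren_wk_rup; apply: IH'; apply/cons_incl/wk_incl.
Qed.

(** * Formulas are countable *)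

Local Notation tree := (GenTree.tree nat).

Fixpoint ty_tree (A : ty) : tree :=
  if A is B ~> C then GenTree.Node 1 [:: ty_tree B; ty_tree C] else GenTree.Leaf 0.

Fixpoint var_index Γ A (v : var Γ A) : nat :=
  match v with vz => 0 | vs w => (var_index w).+1 end.

Definition con_tree A (c : con A) : tree :=
  match c with
  | c0 => GenTree.Leaf 0
  | c1 => GenTree.Leaf 1
  | cadd => GenTree.Leaf 2
  | cmul => GenTree.Leaf 3
  | cR0 => GenTree.Leaf 4
  | @cPi A B => GenTree.Node 0 [:: ty_tree A; ty_tree B]
  | @cSigma A B C => GenTree.Node 0 [:: ty_tree A; ty_tree B; ty_tree C]
  end.

Fixpoint tm_tree Γ A (t : tm Γ A) : tree :=
  match t with
  | Var v => GenTree.Leaf (var_index v)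
  | Con c => GenTree.Node 0 [:: con_tree c]
  | App s u => GenTree.Node 1 [:: tm_tree s; tm_tree u]
  end.

Fixpoint fm_tree Γ (φ : fm Γ) : tree :=
  match φ with
  | Eq s t => GenTree.Node 0 [:: tm_tree s; tm_tree t]
  | Lt s t => GenTree.Node 1 [:: tm_tree s; tm_tree t]
  | Bot => GenTree.Leaf 0
  | Imp p q => GenTree.Node 2 [:: fm_tree p; fm_tree q]
  | And p q => GenTree.Node 3 [:: fm_tree p; fm_tree q]
  | Or p q => GenTree.Node 4 [:: fm_tree p; fm_tree q]
  | @All _ A p => GenTree.Node 5 [:: ty_tree A; fm_tree p]
  | @Ex _ A p => GenTree.Node 6 [:: ty_tree A; fm_tree p]
  end.

Lemma ty_tree_inj : injective ty_tree.
Proof. by elim=> [|A IHA B IHB] [|A' B'] //= [/IHA -> /IHB ->]. Qed.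

(** The trees of variables, constants and terms do not record types, so injectivity is stated for
    dependent pairs and recovers the type along with the object. *)
Lemma var_index_inj Γ A (v : var Γ A) A' (v' : var Γ A') :
  var_index v = var_index v' -> existT _ A v = existT (var Γ) A' v'.
Proof.
elim: v A' v' => {Γ A} [Γ A|Γ A B v IH] A' v'; move: A' v'; apply: var_case => //=.
move=> A' v' [/IH e].
exact: (f_equal (fun x => existT _ (projT1 x) (vs (projT2 x))) e).
Qed.

Lemma con_tree_inj A (c : con A) A' (c' : con A') :
  con_tree c = con_tree c' -> existT _ A c = existT con A' c'.
Proof.
case: c => [||||A1 A2|A1 A2 A3|]; case: c' => [||||B1 B2|B1 B2 B3|] //=.
- by move=> [/ty_tree_inj -> /ty_tree_inj ->].
- by move=> [/ty_tree_inj -> /ty_tree_inj -> /ty_tree_inj ->].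
Qed.

Lemma tm_tree_inj Γ A (t : tm Γ A) A' (t' : tm Γ A') :
  tm_tree t = tm_tree t' -> existT _ A t = existT (tm Γ) A' t'.
Proof.
elim: t A' t' => {A} [A v|A c|A B s IHs u IHu] A' [A2 v'|A2 c'|A2 B2 s' u'] //=.
- move=> [/var_index_inj e].
  exact: (f_equal (fun x => existT _ (projT1 x) (Var (projT2 x))) e).
- move=> [/con_tree_inj e].
  exact: (f_equal (fun x => existT _ (projT1 x) (Con (projT2 x))) e).
- move=> [/IHs e /IHu e2].
  (* The result type does not determine the argument type, but the function part carries both. *)
  have [? ?] : B = B2 /\ A = A2 by case: (EqdepFacts.eq_sigT_fst e).
  by subst B2 A2; rewrite (inj_pair2 _ _ _ _ _ e) (inj_pair2 _ _ _ _ _ e2).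
Qed.

Lemma fm_tree_inj Γ : injective (@fm_tree Γ).
Proof.
elim=> {Γ} [Γ s t|Γ s t|Γ|Γ p IHp q IHq|Γ p IHp q IHq|Γ p IHp q IHq|Γ A p IHp|Γ A p IHp]
    [s' t'|s' t'||p' q'|p' q'|p' q'|A' p'|A' p'] //=.
- move=> [/tm_tree_inj e /tm_tree_inj e2].
  by rewrite (inj_pair2 _ _ _ _ _ e) (inj_pair2 _ _ _ _ _ e2).
- move=> [/tm_tree_inj e /tm_tree_inj e2].
  by rewrite (inj_pair2 _ _ _ _ _ e) (inj_pair2 _ _ _ _ _ e2).
- by move=> [/IHp -> /IHq ->].
- by move=> [/IHp -> /IHq ->].
- by move=> [/IHp -> /IHq ->].
- by move=> [/ty_tree_inj e]; subst A' => /IHp ->.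
- by move=> [/ty_tree_inj e]; subst A' => /IHp ->.
Qed.

(** Only surjectivity matters; a number that codes no formula yields [Bot]. *)
Definition nth_fm Γ (k : nat) : fm Γ :=
  if pselect (exists φ : fm Γ, pickle (fm_tree φ) = k) is left e
  then projT1 (cid e) else Bot.

Lemma nth_fm_pickle Γ (φ : fm Γ) : nth_fm Γ (pickle (fm_tree φ)) = φ.
Proof.
rewrite /nth_fm; case: pselect => [e|[]]; last by exists φ.
by case: (cid e) => ψ /= /(pcan_inj pickleK) /fm_tree_inj.
Qed.

(** * Extensional structures *)

(** Equality is no component: [sat] reads it as identity, which the term model achieves by being a
    quotient. *)
Record structure := Structure {
  dom : ty -> Type;
  app : forall A B, dom (A ~> B) -> dom A -> dom B;
  cval : forall A, con A -> dom A;
  lt0 : dom tN -> dom tN -> Prop;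
}.

Section Satisfaction.
Variable M : structure.

Definition env (Γ : ctx) := forall A, var Γ A -> dom M A.

Definition enil : env nil := fun A v => match v with end.

Definition econs Γ B (d : dom M B) (ρ : env Γ) : env (B :: Γ) :=
  @var_case Γ B (fun A _ => dom M A) d ρ.

Definition etail Γ B (ρ : env (B :: Γ)) : env Γ := fun A v => ρ A (vs v).

Fixpoint eval Γ (ρ : env Γ) A (t : tm Γ A) : dom M A :=
  match t with
  | Var v => ρ _ v
  | Con c => cval M c
  | App s u => app (eval ρ s) (eval ρ u)
  end.

Fixpoint sat Γ (φ : fm Γ) : env Γ -> Prop :=
  match φ with
  | Eq s t => fun ρ => eval ρ s = eval ρ t
  | Lt s t => fun ρ => lt0 (eval ρ s) (eval ρ t)
  | Bot => fun _ => False
  | Imp p q => fun ρ => sat p ρ -> sat q ρ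
  | And p q => fun ρ => sat p ρ /\ sat q ρ
  | Or p q => fun ρ => sat p ρ \/ sat q ρ
  | @All _ A p => fun ρ => forall d, sat p (econs d ρ)
  | @Ex _ A p => fun ρ => exists d, sat p (econs d ρ)
  end.

Lemma econs_etail Γ B (ρ : env (B :: Γ)) : econs (ρ B vz) (etail ρ) = ρ.
Proof. exact: vfun_consE. Qed.

Lemma eval_tren Γ Δ (r : renaming Γ Δ) (ρ : env Δ) A (t : tm Γ A) :
  eval ρ (tren r t) = eval (fun A v => ρ A (r A v)) t.
Proof. by elim: t => //= ? ? ? -> ? ->. Qed.

Lemma eval_tsubst Γ Δ (s : substitution Γ Δ) (ρ : env Δ) A (t : tm Γ A) :
  eval ρ (tsubst s t) = eval (fun A v => eval ρ (s A v)) t.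
Proof. by elim: t => //= ? ? ? -> ? ->. Qed.

Lemma sat_fsubst Γ (φ : fm Γ) Δ (s : substitution Γ Δ) (ρ : env Δ) :
  sat (fsubst φ s) ρ = sat φ (fun A v => eval ρ (s A v)).
Proof.
have sup_env Γ' Δ' B (s' : substitution Γ' Δ') d (ρ' : env Δ') :
    (fun A v => eval (econs d ρ') (sup (B := B) s' v))
    = econs d (fun A v => eval ρ' (s' A v)).
  by apply: vfun_consE => //= A v; rewrite /swk eval_tren.
elim: φ Δ s ρ => //= {Γ}.
- by move=> *; rewrite !eval_tsubst.
- by move=> *; rewrite !eval_tsubst.
- by move=> Γ p IHp q IHq *; rewrite IHp IHq.
- by move=> Γ p IHp q IHq *; rewrite IHp IHq.
- by move=> Γ p IHp q IHq *; rewrite IHp IHq.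
- by move=> Γ A p IHp Δ s ρ; apply: eq_forall => d; rewrite IHp sup_env.
- by move=> Γ A p IHp Δ s ρ; apply: eq_exists => d; rewrite IHp sup_env.
Qed.

Lemma sat_fren Γ (φ : fm Γ) Δ (r : renaming Γ Δ) (ρ : env Δ) :
  sat (fren φ r) ρ = sat φ (fun A v => ρ A (r A v)).
Proof. by rewrite fren_as_fsubst sat_fsubst. Qed.

Definition valid (T : theory) := forall Γ (φ : fm Γ), T Γ φ -> forall ρ, sat φ ρ.

Definition extensional :=
  forall A B (f g : dom M (A ~> B)), (forall x, app f x = app g x) -> f = g.

Lemma sat_eqT Γ A (s t : tm Γ A) ρ :
  extensional -> sat (eqT s t) ρ <-> eval ρ s = eval ρ t.
Proof.
move=> ext; elim: A Γ s t ρ => //= B _ C IH Γ s t ρ.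
have eq_lift d (u : tm Γ (B ~> C)) :
    eval (econs d ρ) (lift u) = eval ρ u by rewrite /lift eval_tren.
split=> [h|e d]; last by apply/IH; rewrite /= !eq_lift e.
by apply: ext => d; have /IH /= := h d; rewrite !eq_lift.
Qed.

End Satisfaction.

(** * Quotients *)

(** Quotients occur three times: terms up to provable equality, pairs of numbers as differences, and
    Cauchy families. *)
Record equivalence (T : Type) := Equivalence {
  equ :> T -> T -> Prop;
  equ_refl : forall s, equ s s;
  equ_sym : forall s t, equ s t -> equ t s;
  equ_trans : forall s t u, equ s t -> equ t u -> equ s u
}.

Section Quotient.
Variables (T : Type) (R : equivalence T).

Definition quot := {P : T -> Prop | exists s, P = R s}.
Definition qcls (s : T) : quot := exist _ (equ R s) (ex_intro _ s erefl).

Lemma qclsP s t : qcls s = qcls t <-> R s t.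
Proof.
split=> [/(f_equal (@proj1_sig _ _)) /= -> |e]; first exact: equ_refl.
apply: eq_exist; apply: funext => u; apply: propext; split.
  exact/equ_trans/equ_sym.
exact: equ_trans.
Qed.

Definition qrep (d : quot) : T := projT1 (cid (proj2_sig d)).

Lemma qrepK d : qcls (qrep d) = d.
Proof. by case: d => P e; apply: eq_exist; rewrite /qrep; case: cid. Qed.

Lemma qrep_cls s : R (qrep (qcls s)) s.
Proof. by apply/qclsP; rewrite qrepK. Qed.

HB.instance Definition _ := gen_eqMixin quot.
HB.instance Definition _ := gen_choiceMixin quot.
End Quotient.

(** * Completeness *)

(** Stage n of the Henkin construction has its own type of terms. A term that appears at stage i
    becomes a family by weakening above i and by default values below. *)
Lemma coherent_extension (X : nat -> Type) (up : forall n, X n -> X n.+1)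
    (dflt : forall n, X n) i (x : X i) :
  exists2 f : forall n, X n, f i = x & forall n, i <= n -> f n.+1 = up n (f n).
Proof.
elim: i X up dflt x => [|i IH] X up dflt x.
  by exists (nat_rect X x up).
have [f fi fS] := IH (fun n => X n.+1) (fun n => up n.+1) (fun n => dflt n.+1) x.
exists (fun n => if n is n'.+1 return X n then f n' else dflt 0) => //.
by case=> // n /fS.
Qed.

Fixpoint closed_tm Γ A : tm Γ A :=
  match A with
  | tN => Con c0
  | B ~> C => Con cPi · closed_tm Γ C
  end.

Section Henkin.
Variable T : theory.
Hypothesis T_fren : forall Γ Δ (φ : fm Γ) (r : renaming Γ Δ), T φ -> T (fren φ r).
Hypothesis T_RCA0w : forall Γ (φ : fm Γ), RCA0w φ -> T φ.

Definition consistent Γ (H : list (fm Γ)) := ~ prf T H Bot.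

Definition wks Γ B (H : list (fm Γ)) := List.map (fun h => fren h (@wk Γ B)) H.

Lemma prf_incl Γ (H H' : list (fm Γ)) φ :
  (forall h, List.In h H -> List.In h H') -> prf T H φ -> prf T H' φ.
Proof.
move=> i /(prf_fren T_fren) /(_ Γ (fun _ v => v) H').
have fren_id h : fren h (fun _ v => v) = h by rewrite fren_as_fsubst fsubst_sid.
by rewrite fren_id; apply=> h; rewrite fren_id; apply: i.
Qed.

Lemma prf_weaken Γ (H : list (fm Γ)) φ ψ : prf T H φ -> prf T (ψ :: H) φ.
Proof. by apply: prf_incl => h; right. Qed.

Lemma prf_wk Γ B (H : list (fm Γ)) φ (H' : list (fm (B :: Γ))) :
  (forall h, List.In h H -> List.In (fren h wk) H') ->
  prf T H φ -> prf T H' (fren φ wk).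
Proof. by move=> i /(prf_fren T_fren); apply. Qed.

Lemma prf_exfalso Γ (H : list (fm Γ)) φ : prf T H Bot -> prf T H φ.
Proof. by move=> p; apply/prf_raa/prf_weaken. Qed.

Lemma prf_hyp0 Γ (H : list (fm Γ)) φ : prf T (φ :: H) φ.
Proof. by apply: prf_hyp; left. Qed.

Lemma prf_cut Γ (H : list (fm Γ)) φ ψ : prf T (φ :: H) ψ -> prf T H φ -> prf T H ψ.
Proof. by move=> /prf_impI; apply: prf_impE. Qed.

(** All types are inhabited by closed terms, so a contradiction derived with a fresh variable can be
    instantiated back. *)
Lemma wks_consistent Γ B (H : list (fm Γ)) : consistent H -> consistent (wks B H).
Proof. by move=> c /prf_allI /prf_allE p; apply: c; exact: (p (closed_tm Γ B)). Qed.

(** Each step adds exactly one variable, a dummy of type [tN] if no witness is wanted, so that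
    passing to the next stage is always the weakening [wk]. *)
Definition next Γ (H : list (fm Γ)) (χ : fm Γ) : {B & list (fm (B :: Γ))} :=
  if pselect (consistent (χ :: H)) then
    match χ with
    | @Ex _ A ψ => existT _ A (ψ :: wks A (χ :: H))
    | _ => existT _ tN (wks tN (χ :: H))
    end
  else existT _ tN (wks tN H).

Lemma next_consistent Γ (H : list (fm Γ)) χ :
  consistent H -> consistent (projT2 (next H χ)).
Proof.
rewrite /next; case: pselect => /= [c _|_ c]; last exact: wks_consistent.
case: χ c => [s t|s t||p q|p q|p q|A p|A p] c /=; try exact: (wks_consistent (B := tN) c).
by move=> h; apply: c; exact: (@prf_exE T Γ (Ex p :: H) A p Bot (prf_hyp0 _ _) h).
Qed.

Lemma next_incl Γ (H : list (fm Γ)) χ h :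
  List.In h H -> List.In (fren h wk) (projT2 (next H χ)).
Proof.
move=> i; have wi B : List.In (fren h wk) (wks B H).
  exact: (In_map (fun h => fren h _)).
rewrite /next; case: pselect => /= [c|_] //.
by case: χ c => [s t|s t||p q|p q|p q|A p|A p] c; right => //; right.
Qed.

Lemma next_hyp Γ (H : list (fm Γ)) χ :
  List.In (fren χ wk) (projT2 (next H χ)) \/ prf T (χ :: H) Bot.
Proof.
rewrite /next; case: pselect => /= [c|/contrapT]; last by right.
by left; case: χ c => [s t|s t||p q|p q|p q|A p|A p] c; first [by left | by right; left].
Qed.

Lemma next_witness Γ (H : list (fm Γ)) A (ψ : fm (A :: Γ)) :
  consistent (Ex ψ :: H) ->
  exists t, List.In (inst (fren ψ (rup wk)) t) (projT2 (next H (Ex ψ))).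
Proof.
rewrite /next; case: pselect => //= c _.
by exists (Var vz); rewrite inst_wk_rup; left.
Qed.

Record stage := Stage {
  sctx : ctx;
  shyp : list (fm sctx);
  (* [sagenda i k] is the formula number k over the context of stage i, weakened
     to the current context. *)
  sagenda : nat -> nat -> fm sctx;
}.

Variable φ0 : fm nil.
Hypothesis φ0_consistent : consistent [:: Not φ0].

(** Row i of the agenda is fixed at stage i as an enumeration of the formulas over the context
    reached there, and is only weakened afterwards; rows beyond the current stage hold placeholders.
    Step n treats the entry whose Cantor code is n. *)
Definition next_stage (n : nat) (s : stage) : stage :=
  let nx := next (shyp s) (sagenda s (of_nat n).1 (of_nat n).2) in
  @Stage (projT1 nx :: sctx s) (projT2 nx)
    (fun i k => if i <= n then fren (sagenda s i k) wk else nth_fm _ k).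

Fixpoint stages (n : nat) : stage :=
  if n is m.+1 then next_stage m (stages m)
  else @Stage nil [:: Not φ0] (fun _ k => nth_fm nil k).

Definition G n := sctx (stages n).
Definition H n := shyp (stages n).
Definition up n : renaming (G n) (G n.+1) := @wk (sctx (stages n)) _.

Lemma H_consistent n : consistent (H n).
Proof. by elim: n => // n; apply: next_consistent. Qed.

Lemma H_incl n h : List.In h (H n) -> List.In (fren h (@up n)) (H n.+1).
Proof. exact: next_incl. Qed.

Lemma prf_up n φ : prf T (H n) φ -> prf T (H n.+1) (fren φ (@up n)).
Proof. by apply: prf_wk => h; apply: H_incl. Qed.

(** The union of the stages is not a context. A formula over it is a family with one formula per
    stage, coherent from some stage on, and it belongs to the theory if it is eventually
    derivable. *)
Definition fms := forall n, fm (G n).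

Definition cohf (φ : fms) := exists i, forall n, i <= n -> φ n.+1 = fren (φ n) (@up n).

Definition Th (φ : fms) := exists i, forall n, i <= n -> prf T (H n) (φ n).

Lemma Th_from (φ : fms) i : (forall n, i <= n -> φ n.+1 = fren (φ n) (@up n)) ->
  (exists2 n, i <= n & prf T (H n) (φ n)) -> Th φ.
Proof.
move=> coh [n in_ p]; exists n => m; elim: m => [|m IH]; first by rewrite leqn0 => /eqP <-.
rewrite leq_eqVlt => /orP [/eqP <- //|]; rewrite ltnS => nm.
by rewrite coh ?(leq_trans in_)//; apply/prf_up/IH.
Qed.

Lemma agenda_coh (φ : fms) i k :
  (forall n, i <= n -> φ n.+1 = fren (φ n) (@up n)) -> nth_fm _ k = φ i ->
  forall n, i <= n -> sagenda (stages n) i k = φ n.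
Proof.
move=> coh e.
have row0 n : n <= i -> sagenda (stages n) i k = nth_fm _ k.
  by case: n => //= n; rewrite ltnNge => /negbTE ->.
elim=> [|n IH]; first by rewrite leqn0 => /eqP i0; rewrite row0 ?i0 // -i0.
rewrite leq_eqVlt => /orP [/eqP <-|]; first by rewrite row0.
by rewrite ltnS => in_; rewrite coh //= in_ IH.
Qed.

Definition goal n : fm (G n) := sagenda (stages n) (of_nat n).1 (of_nat n).2.

(** The Cantor code of (i, k) is at least i, so row i is already fixed when its entry k comes up. *)
Lemma goal_fair (φ : fms) i :
  (forall n, i <= n -> φ n.+1 = fren (φ n) (@up n)) ->
  exists2 n, i <= n & goal n = φ n.
Proof.
move=> coh; set k := pickle (fm_tree (φ i)).
have in_ : i <= to_nat (i, k).
  by apply/leP/(PeanoNat.Nat.le_trans _ (k + i)); [exact/leP/leq_addl|exact: to_nat_non_decreasing].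
exists (to_nat (i, k)) => //; rewrite /goal cancel_of_to /=.
by apply: agenda_coh => //; apply: nth_fm_pickle.
Qed.

Lemma goal_hyp n : List.In (fren (goal n) (@up n)) (H n.+1) \/ prf T (goal n :: H n) Bot.
Proof. exact: next_hyp. Qed.

Lemma goal_witness n A (ψ : fm (A :: G n)) :
  goal n = Ex ψ -> consistent (goal n :: H n) ->
  exists t : tm (G n.+1) A, List.In (inst (fren ψ (rup (@up n))) t) (H n.+1).
Proof.
rewrite /H /G /up /= /goal => e; move: (next_witness (H := H n) (ψ := ψ)).
by rewrite -e.
Qed.

(** When the formula has its turn, it is either added or refuted by the hypotheses of that stage. *)
Lemma Th_or_not (φ : fms) : cohf φ -> Th φ \/ Th (fun n => Not (φ n)).
Proof.
case=> i coh; have [n in_ e] := goal_fair coh.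
case: (goal_hyp n); rewrite e => h.
  by left; apply: (Th_from coh); exists n.+1; rewrite ?leqW// coh//; apply: prf_hyp.
right; apply: (Th_from (i := i)) => [m im|]; first by rewrite coh.
by exists n => //; apply: prf_impI.
Qed.

(** The turn is chosen late enough for the existential formula to be derivable. It is then
    consistent with the stage, and the variable added next is a witness. *)
Lemma Th_witness A (ψ : forall n, fm (A :: G n)) i :
  (forall n, i <= n -> ψ n.+1 = fren (ψ n) (rup (@up n))) ->
  Th (fun n => Ex (ψ n)) ->
  exists2 t : forall n, tm (G n) A,
    exists j, forall n, j <= n -> t n.+1 = tren (@up n) (t n)
    & Th (fun n => inst (ψ n) (t n)).
Proof.
move=> coh [j p].
have [n] := @goal_fair (fun n => Ex (ψ n)) (maxn i j)
  (fun n h => f_equal _ (coh n (leq_trans (leq_maxl _ _) h))).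
rewrite geq_max => /andP [in_ jn] e.
have c : consistent (goal n :: H n).
  by rewrite e => h; apply: (@H_consistent n); apply: prf_cut (p _ jn).
have [t0 t0P] := goal_witness e c.
have [t tn tS] := coherent_extension (X := fun n => tm (G n) A)
  (fun n => @tren _ _ (@up n) A) (fun n => closed_tm _ A) t0.
exists t; first by exists n.+1.
apply: (@Th_from _ n.+1) => [m nm|].
  by rewrite coh ?tS ?fren_inst // (leq_trans _ nm) // leqW.
by exists n.+1 => //; rewrite tn coh //; apply: prf_hyp.
Qed.

Lemma Th_map (φ ψ : fms) :
  (forall n, prf T (H n) (φ n) -> prf T (H n) (ψ n)) -> Th φ -> Th ψ.
Proof. by move=> h [i p]; exists i => n /p /h. Qed.

Lemma Th_map2 (φ ψ χ : fms) :
  (forall n, prf T (H n) (φ n) -> prf T (H n) (ψ n) -> prf T (H n) (χ n)) ->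
  Th φ -> Th ψ -> Th χ.
Proof.
move=> h [i p] [j q]; exists (maxn i j) => n.
by rewrite geq_max => /andP [/p p' /q q']; apply: h.
Qed.

Lemma Th_all (φ : fms) : (forall n, prf T (H n) (φ n)) -> Th φ.
Proof. by move=> h; exists 0 => n _. Qed.

Lemma Th_consistent : ~ Th (fun n => Bot).
Proof. by case=> i /(_ i (leqnn i)) /H_consistent. Qed.

Lemma prf_RCA0w Γ (K : list (fm Γ)) φ : RCA0w φ -> prf T K φ.
Proof. by move=> a; apply/prf_ax/T_RCA0w. Qed.

Lemma eqT_app A B Γ (K : list (fm Γ)) (s t : tm Γ (A ~> B)) u :
  prf T K (eqT s t) -> prf T K (eqT (s · u) (t · u)).
Proof. by move=> p; rewrite -inst_eqT_app; exact: prf_allE p. Qed.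

Lemma eqT_appz A B Γ (K : list (fm Γ)) (s t : tm Γ (A ~> B)) :
  prf T K (eqT s t) ->
  prf T (wks A K) (eqT (lift s · Var vz) (lift t · Var vz)).
Proof.
move=> p; apply: eqT_app.
have /(prf_wk (B := A)) := p; move/(_ (wks A K)); rewrite fren_eqT; apply.
by move=> h; apply: In_map.
Qed.

Lemma eqT_refl A Γ (K : list (fm Γ)) (s : tm Γ A) : prf T K (eqT s s).
Proof.
elim: A Γ K s => [|A _ B IH] Γ K s; first exact/prf_RCA0w/ax_refl.
exact/prf_allI/IH.
Qed.

Lemma eqT_sym A Γ (K : list (fm Γ)) (s t : tm Γ A) :
  prf T K (eqT s t) -> prf T K (eqT t s).
Proof.
elim: A Γ K s t => [|A _ B IH] Γ K s t p; last exact/prf_allI/IH/eqT_appz.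
exact: prf_impE (prf_RCA0w _ (ax_sym _ _)) p.
Qed.

Lemma eqT_trans A Γ (K : list (fm Γ)) (s t u : tm Γ A) :
  prf T K (eqT s t) -> prf T K (eqT t u) -> prf T K (eqT s u).
Proof.
elim: A Γ K s t u => [|A _ B IH] Γ K s t u p q.
  exact: prf_impE (prf_impE (prf_RCA0w _ (ax_trans _ _ _)) p) q.
by apply/prf_allI/IH; apply: eqT_appz; eassumption.
Qed.

Lemma eqT_cong A B Γ (K : list (fm Γ)) (s s' : tm Γ (A ~> B)) (t t' : tm Γ A) :
  prf T K (eqT s s') -> prf T K (eqT t t') -> prf T K (eqT (s · t) (s' · t')).
Proof.
move=> p q; apply: eqT_trans (eqT_app t' p).
exact: prf_impE (prf_RCA0w _ (ax_ext _ _ _)) q.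
Qed.

Record cterm A := CTerm {
  ctm :> forall n, tm (G n) A;
  ctm_coh : exists i, forall n, i <= n -> ctm n.+1 = tren (@up n) (ctm n)
}.

Lemma capp_coh A B (s : cterm (A ~> B)) (t : cterm A) :
  exists i, forall n, i <= n -> s n.+1 · t n.+1 = tren (@up n) (s n · t n).
Proof.
have [[i si] [j tj]] := (ctm_coh s, ctm_coh t); exists (maxn i j) => n.
by rewrite geq_max /= => /andP [/si -> /tj ->].
Qed.

Definition capp A B (s : cterm (A ~> B)) (t : cterm A) : cterm B := CTerm (capp_coh s t).

Definition ccon A (c : con A) : cterm A :=
  @CTerm A (fun n => Con c) (ex_intro _ 0 (fun n _ => erefl)).

Definition eqv A (s t : cterm A) := Th (fun n => eqT (s n) (t n)).

Lemma eqv_sym A (s t : cterm A) : eqv s t -> eqv t s.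
Proof. by apply: Th_map => n; apply: eqT_sym. Qed.

Lemma eqv_trans A (s t u : cterm A) : eqv s t -> eqv t u -> eqv s u.
Proof. by apply: Th_map2 => n; apply: eqT_trans. Qed.

Lemma eqv_refl A (s : cterm A) : eqv s s.
Proof. by apply: Th_all => n; apply: eqT_refl. Qed.

Definition eqv_equivalence A := Equivalence (@eqv_refl A) (@eqv_sym A) (@eqv_trans A).
Definition hdom A := quot (eqv_equivalence A).
Definition tcls A (s : cterm A) : hdom A := qcls (eqv_equivalence A) s.
Definition trep A (d : hdom A) : cterm A := qrep d.

Lemma tclsP A (s t : cterm A) : tcls s = tcls t <-> eqv s t.
Proof. exact: (qclsP (eqv_equivalence A)). Qed.

Lemma trepK A (d : hdom A) : tcls (trep d) = d.
Proof. exact: qrepK. Qed.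

Lemma eqv_rep A (s : cterm A) : eqv (trep (tcls s)) s.
Proof. exact: (qrep_cls (eqv_equivalence A)). Qed.

Definition term_model : structure :=
  @Structure hdom (fun A B f x => tcls (capp (trep f) (trep x)))
    (fun A c => tcls (ccon c)) (fun x y => Th (fun n => trep x n ≺ trep y n)).

Lemma app_cls A B (s : cterm (A ~> B)) (t : cterm A) :
  app (s := term_model) (tcls s) (tcls t) = tcls (capp s t).
Proof.
apply/tclsP; apply: (Th_map2 _ (eqv_rep s) (eqv_rep t)) => n.
exact: eqT_cong.
Qed.

Lemma Th_lt_eqv (s s' t t' : cterm tN) :
  eqv s s' -> eqv t t' -> Th (fun n => s n ≺ t n) -> Th (fun n => s' n ≺ t' n).
Proof.
move=> e e'; have h : Th (fun n => s n ≺ t n ⇒ s' n ≺ t' n).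
  apply: (Th_map2 _ e e') => n p q.
  exact: prf_impE (prf_impE (prf_RCA0w _ (ax_lt_eq _ _ _ _)) p) q.
by apply: (Th_map2 _ h) => n; apply: prf_impE.
Qed.

Lemma lt0_cls (s t : cterm tN) :
  lt0 (s := term_model) (tcls s) (tcls t) <-> Th (fun n => s n ≺ t n).
Proof.
split; apply: Th_lt_eqv; first [exact: eqv_rep | exact/eqv_sym/eqv_rep].
Qed.

Definition at_stage Γ (s : forall A, var Γ A -> cterm A) n : substitution Γ (G n) :=
  fun A v => s A v n.

Lemma at_stage_coh Γ (s : forall A, var Γ A -> cterm A) :
  exists i, forall n, i <= n ->
    at_stage s n.+1 = fun A v => tren (@up n) (at_stage s n v).
Proof.
elim: Γ s => [|B Γ IH] s.
  by exists 0 => n _; apply: vfun_ext => A v; inversion v.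
have [i si] := IH (fun A v => s A (vs v)); have [j sj] := ctm_coh (s B vz).
exists (maxn i j) => n; rewrite geq_max => /andP [/si e /sj e'].
apply: vfun_consE => [|A v]; first exact: e'.
exact: (f_equal (fun f => f A v) e).
Qed.

Lemma fsubst_coh Γ (s : forall A, var Γ A -> cterm A) φ :
  cohf (fun n => fsubst φ (at_stage s n)).
Proof.
have [i si] := at_stage_coh s; exists i => n /si ->.
by rewrite fren_as_fsubst fsubst_comp; congr fsubst; apply: vfun_ext => A v;
  rewrite tren_as_tsubst.
Qed.

Fixpoint csubst Γ (s : forall A, var Γ A -> cterm A) A (t : tm Γ A) : cterm A :=
  match t with
  | Var v => s _ v
  | Con c => ccon c
  | App f u => capp (csubst s f) (csubst s u)
  end.

Lemma csubstE Γ (s : forall A, var Γ A -> cterm A) A (t : tm Γ A) n :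
  csubst s t n = tsubst (at_stage s n) t.
Proof. by elim: t => //= ? ? ? -> ? ->. Qed.

Lemma eval_cls Γ (s : forall A, var Γ A -> cterm A) A (t : tm Γ A) :
  eval (M := term_model) (fun A v => tcls (s A v)) t = tcls (csubst s t).
Proof. by elim: t => //= ? ? t -> u ->; apply: (app_cls (csubst s t)). Qed.

(** This is how a refuted universal formula obtains a counterexample among the Henkin witnesses. *)
Lemma prf_not_all Γ (K : list (fm Γ)) A (φ : fm (A :: Γ)) :
  prf T K (Not (All φ)) -> prf T K (Ex (Not φ)).
Proof.
move=> p; apply: prf_raa; apply: prf_impE (prf_weaken _ p) _.
apply: prf_allI; apply: prf_raa => /=; apply: prf_impE.
  by apply: prf_hyp; right; left.
apply: (prf_exI (t := Var vz)).
by have /= -> := inst_wk_rup (Not φ); apply: prf_hyp0.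
Qed.

Definition ccons Γ B (t : cterm B) (s : forall A, var Γ A -> cterm A) :
  forall A, var (B :: Γ) A -> cterm A := @var_case Γ B (fun A _ => cterm A) t s.

Lemma Th_inst Γ B (φ : fm (B :: Γ)) (t : cterm B) s :
  (fun n => inst (fsubst φ (sup (at_stage s n))) (t n))
  = (fun n => fsubst φ (at_stage (ccons t s) n)).
Proof.
apply: functional_extensionality_dep => n; rewrite inst_fsubst_sup.
by congr fsubst; apply: vfun_consE.
Qed.

(** Completeness of the theory handles implication and disjunction; Henkin witnesses handle the
    quantifiers. *)
Lemma truth Γ (φ : fm Γ) (s : forall A, var Γ A -> cterm A) :
  sat (M := term_model) φ (fun A v => tcls (s A v)) <-> Th (fun n => fsubst φ (at_stage s n)).
Proof.
elim: φ s => {Γ} [Γ t u|Γ t u|Γ|Γ p IHp q IHq|Γ p IHp q IHq|Γ p IHp q IHq|Γ A p IH|Γ A p IH] s.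
- rewrite /= !eval_cls; apply: (iff_trans (tclsP _ _)).
  by split; apply: Th_map => n; rewrite /= !csubstE.
- rewrite /= !eval_cls; apply: (iff_trans (lt0_cls _ _)).
  by split; apply: Th_map => n; rewrite /= !csubstE.
- by split=> // /Th_consistent.
- split=> [/= h|/= h /IHp hp]; last first.
    by apply/IHq; apply: Th_map2 h hp => n; apply: prf_impE.
  have [/IHp /h /IHq|] := Th_or_not (fsubst_coh s p); apply: Th_map => n d.
    exact/prf_impI/prf_weaken.
  apply/prf_impI/prf_exfalso; apply: prf_impE (prf_hyp0 _ _).
  exact: prf_weaken.
- split=> [/= [/IHp hp /IHq hq]|h].
    by apply: Th_map2 hp hq => n; apply: prf_andI.
  split; [apply/IHp|apply/IHq]; apply: Th_map h => n.
    exact: prf_andE1.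
  exact: prf_andE2.
- split=> [/= [/IHp|/IHq]|/= h]; first by apply: Th_map => n; apply: prf_orI1.
    by apply: Th_map => n; apply: prf_orI2.
  have [/IHp|hn] := Th_or_not (fsubst_coh s p); first by left.
  right; apply/IHq; apply: Th_map2 h hn => n d d'.
  apply: prf_orE d _ (prf_hyp0 _ _); apply: prf_exfalso.
  by apply: prf_impE (prf_hyp0 _ _); apply: prf_weaken.
- have env_cons t : econs (M := term_model) (tcls t) (fun A v => tcls (s A v))
      = (fun B v => tcls (ccons t s v)) by apply: vfun_consE.
  split=> /= h; last first.
    move=> d; rewrite -(trepK d) env_cons; apply/IH; rewrite -Th_inst.
    by apply: Th_map h => n; apply: prf_allE.
  (* If the theory refutes the universal formula, it has a witness for the negated matrix, and [h]
     fails at that element. *)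
  have [//|hn] := Th_or_not (fsubst_coh s (All p)).
  have [i si] := at_stage_coh s.
  have := @Th_witness A (fun n => Not (fsubst p (sup (at_stage s n)))) i.
  case=> [n /si ->||t tc].
  + rewrite fren_as_fsubst /= fsubst_comp; do 2! congr (_ _).
    apply: vfun_consE => //= B v; rewrite /swk !tren_as_tsubst !tsubst_comp.
    by congr tsubst.
  + by apply: Th_map hn => n; apply: prf_not_all.
  + have := h (tcls (CTerm tc)); rewrite env_cons => /(IH (ccons (CTerm tc) s)) hp.
    move=> hi; case: Th_consistent; apply: (Th_map2 _ hp hi) => n d d'.
    have e := f_equal (fun f => f n) (Th_inst p (CTerm tc) s).
    by rewrite -e in d; apply: prf_impE d' d.
- have env_cons t : econs (M := term_model) (tcls t) (fun A v => tcls (s A v))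
      = (fun B v => tcls (ccons t s v)) by apply: vfun_consE.
  split=> /= [[d]|h].
    rewrite -(trepK d) env_cons => /(IH (ccons (trep d) s)); rewrite -Th_inst.
    by apply: Th_map => n; apply: prf_exI.
  have [i si] := at_stage_coh s.
  have [n /si ->||t tc ht] := @Th_witness A (fun n => fsubst p (sup (at_stage s n))) i.
  + rewrite fren_as_fsubst /= fsubst_comp; congr fsubst.
    apply: vfun_consE => //= B v; rewrite /swk !tren_as_tsubst !tsubst_comp.
    by congr tsubst.
  + exact: h.
  + exists (tcls (CTerm tc)); rewrite env_cons; apply/(IH (ccons (CTerm tc) s)).
    by rewrite -Th_inst.
Qed.

Lemma term_model_eqT Γ A (t u : tm Γ A) (ρ : env term_model Γ) :
  sat (eqT t u) ρ <-> eval ρ t = eval ρ u.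
Proof.
have -> : ρ = fun A v => tcls (trep (ρ A v)) by apply: vfun_ext => ? ?; rewrite trepK.
rewrite !eval_cls; apply: (iff_trans (truth _ _)); apply: iff_sym.
apply: (iff_trans (tclsP _ _)).
by split; apply: Th_map => n; rewrite fsubst_eqT !csubstE.
Qed.

(** [eqT] at an arrow type is by definition pointwise [eqT], and by the truth lemma [eqT] means
    identity in the term model. *)
Lemma term_model_ext : extensional term_model.
Proof.
move=> A B f g h.
pose ρ : env term_model [:: A ~> B; A ~> B] := econs f (econs g (enil _)).
suff /term_model_eqT : sat (eqT (Var vz) (Var (vs vz))) ρ by [].
by move=> d /=; apply/term_model_eqT; apply: h.
Qed.

(** Universal closure reduces to the empty context, where the derivation can be weakened to every
    stage. *)
Lemma prf_valid Γ (φ : fm Γ) : prf T nil φ -> forall ρ, sat (M := term_model) φ ρ.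
Proof.
elim: Γ φ => [|A Γ IH] φ p ρ; last first.
  by have /= /(_ (ρ A vz)) := IH (All φ) (@prf_allI T Γ nil A φ p) (etail ρ); rewrite econs_etail.
have nil_ext (X : ty -> Type) (f g : forall A, var nil A -> X A) : f = g.
  by apply: vfun_ext => A v; inversion v.
rewrite (nil_ext _ ρ (fun A v => tcls (trep (ρ A v)))); apply/truth; apply: Th_all => n.
rewrite (nil_ext _ (at_stage _ n) (fun A (v : var nil A) => Var match v with end)).
by rewrite -fren_as_fsubst; apply: prf_fren p _ _ _ _.
Qed.

Lemma term_model_refutes : ~ sat (M := term_model) φ0 (enil term_model).
Proof.
have nil_ext (X : ty -> Type) (f g : forall A, var nil A -> X A) : f = g.
  by apply: vfun_ext => A v; inversion v.
pose s A (v : var nil A) : cterm A := match v with end.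
rewrite (nil_ext _ (enil term_model) (fun A v => tcls (s A v) : dom term_model A)).
move=> /truth h.
apply: Th_consistent; apply: (Th_map2 _ h (_ : Th (fun n => Not (fsubst φ0 (at_stage s n))))).
  by move=> n p q; apply: prf_impE q p.
apply: (Th_from (i := 0)) => [n _|].
  rewrite /= fren_as_fsubst fsubst_comp; do 2! congr (_ _); exact: nil_ext.
exists 0 => //; apply: prf_hyp; left; congr Not.
by rewrite (nil_ext _ (at_stage s 0) sid) fsubst_sid.
Qed.

End Henkin.

Theorem completeness (T : theory) (φ : fm nil) :
  (forall Γ Δ (ψ : fm Γ) (r : renaming Γ Δ), T Γ ψ -> T Δ (fren ψ r)) ->
  (forall Γ (ψ : fm Γ), RCA0w ψ -> T Γ ψ) ->
  (forall M, extensional M -> valid M T -> sat φ (enil M)) -> proves T φ.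
Proof.
move=> T_fren T_RCA h; apply: contrapT => np.
have c : consistent T [:: Not φ] by move=> /prf_raa.
case: (@term_model_refutes T T_fren T_RCA φ c); apply: h.
  exact: term_model_ext.
by move=> Γ ψ a; apply: prf_valid => //; apply: prf_ax.
Qed.

Import Order.TTheory GRing.Theory Num.Theory.
Local Open Scope ring_scope.

(** * Ordered fields from positive cones *)

Section PositiveCone.
Variables (R : idomainType) (Pos : R -> Prop).
Hypothesis pos_add : forall x y, Pos x -> Pos y -> Pos (x + y).
Hypothesis pos_mul : forall x y, Pos x -> Pos y -> Pos (x * y).
Hypothesis pos_not0 : ~ Pos 0.
Hypothesis pos_total : forall x, x = 0 \/ Pos x \/ Pos (- x).

Definition cone_lt : rel R := fun x y => `[< Pos (y - x) >].
Definition cone_le : rel R := fun x y => (x == y) || cone_lt x y.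
Definition cone_norm x := if cone_lt x 0 then - x else x.

Lemma cone_lt0 x : cone_lt 0 x = `[< Pos x >].
Proof. by rewrite /cone_lt subr0. Qed.

Lemma cone_gt0 x : cone_lt x 0 = `[< Pos (- x) >].
Proof. by rewrite /cone_lt sub0r. Qed.

Lemma cone_add x y : cone_lt 0 x -> cone_lt 0 y -> cone_lt 0 (x + y).
Proof. by rewrite !cone_lt0 => /asboolP px /asboolP py; apply/asboolP/pos_add. Qed.

Lemma cone_mul x y : cone_lt 0 x -> cone_lt 0 y -> cone_lt 0 (x * y).
Proof. by rewrite !cone_lt0 => /asboolP px /asboolP py; apply/asboolP/pos_mul. Qed.

Lemma cone_ngt0 x : cone_lt 0 x -> ~~ cone_lt x 0.
Proof.
rewrite cone_lt0 cone_gt0 => /asboolP px; apply/asboolP => /(pos_add px).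
by rewrite subrr.
Qed.

Lemma cone_sub x y : cone_lt 0 (y - x) = cone_lt x y.
Proof. by rewrite cone_lt0. Qed.

Lemma cone_total x : x != 0 -> cone_lt 0 x || cone_lt x 0.
Proof.
rewrite cone_lt0 cone_gt0 => /eqP x0; apply/orP.
by have [//|[px|px]] := pos_total x; [left|right]; apply/asboolP.
Qed.

Lemma cone_normN x : cone_norm (- x) = cone_norm x.
Proof.
have [->|x0] := eqVneq x 0; first by rewrite oppr0.
rewrite /cone_norm; have e : cone_lt (- x) 0 = cone_lt 0 x.
  by rewrite cone_lt0 cone_gt0 opprK.
rewrite e; have /orP[p|p] := cone_total x0.
  by rewrite p (negbTE (cone_ngt0 p)) opprK.
rewrite p ifF //; apply/negbTE; apply: contraL p; exact: cone_ngt0.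
Qed.

Lemma cone_ge0_norm x : cone_le 0 x -> cone_norm x = x.
Proof.
rewrite /cone_norm => /orP[/eqP <-|/cone_ngt0/negbTE -> //].
by rewrite oppr0 if_same.
Qed.
End PositiveCone.

(** * Ordered semirings and their fractions *)

(** The last three laws make this the nonnegative part of a discretely ordered ring; its elements
    need not be standard numbers. *)
Record osemiring := OSemiring {
  ocar :> Type;
  ozero : ocar; oone : ocar;
  oadd : ocar -> ocar -> ocar;
  omul : ocar -> ocar -> ocar;
  olt : ocar -> ocar -> Prop;
  oaddA : associative oadd;
  oaddC : commutative oadd;
  oadd0 : left_id ozero oadd;
  omulA : associative omul;
  omulC : commutative omul;
  omul1 : left_id oone omul;
  omulDl : left_distributive omul oadd;
  omul0 : left_zero ozero omul;
  olt_irr : forall a, ~ olt a a;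
  olt_trans : forall a b c, olt a b -> olt b c -> olt a c;
  olt_total : forall a b, olt a b \/ a = b \/ olt b a;
  olt01 : olt ozero oone;
  olt_add : forall a b c, olt a b -> olt (oadd a c) (oadd b c);
  olt_mul : forall a b c, olt a b -> olt ozero c -> olt (omul a c) (omul b c);
  olt_sub : forall a b, olt a b -> exists2 d, olt ozero d & b = oadd a d;
  oge0 : forall a, ozero = a \/ olt ozero a;
  oge1 : forall a, olt ozero a -> oone = a \/ olt oone a
}.

HB.instance Definition _ S := gen_eqMixin (ocar S).
HB.instance Definition _ S := gen_choiceMixin (ocar S).
HB.instance Definition _ S :=
  GRing.isNmodule.Build (ocar S) (@oaddA S) (@oaddC S) (@oadd0 S).
HB.instance Definition _ S :=
  GRing.Nmodule_isComPzSemiRing.Build (ocar S)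
    (@omulA S) (@omulC S) (@omul1 S) (@omulDl S) (@omul0 S).

Section Fractions.
Variable S : osemiring.
Implicit Types a b c d : S.

Lemma olt_neq a b : olt a b -> a <> b.
Proof. by move=> h e; rewrite e in h; apply: (olt_irr h). Qed.

Lemma o_addI a b c : a + c = b + c -> a = b.
Proof.
move=> e; have [l|[//|l]] := olt_total a b.
  by have /olt_neq := olt_add c l; case.
by have /olt_neq := olt_add c l; case.
Qed.

Lemma o_mulI a b c : olt 0 c -> a * c = b * c -> a = b.
Proof.
move=> c0 e; have [l|[//|l]] := olt_total a b.
  by have /olt_neq := olt_mul l c0; case.
by have /olt_neq := olt_mul l c0; case.
Qed.

Lemma olt0_mul a b : olt 0 a -> olt 0 b -> olt 0 (a * b).
Proof. by move=> a0 /(olt_mul a0); rewrite -[omul _ _]/(0 * b) mul0r. Qed.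

Lemma olt0_add a b : olt 0 a -> olt 0 b -> olt 0 (a + b).
Proof.
move=> a0 b0; apply: olt_trans b0 _.
by have := olt_add b a0; rewrite -[oadd _ b]/(0 + b) add0r.
Qed.

Definition zeq (p q : S * S) := p.1 + q.2 = q.1 + p.2.

Lemma zeq_trans p q r : zeq p q -> zeq q r -> zeq p r.
Proof.
rewrite /zeq => e e'; apply: (@o_addI _ _ q.2).
have -> : p.1 + r.2 + q.2 = (p.1 + q.2) + r.2 by ring.
by rewrite e addrAC e'; ring.
Qed.

Definition zequ := @Equivalence (S * S) zeq (fun _ => erefl)
  (fun _ _ e => esym e) zeq_trans.

Definition Zs := quot zequ.
HB.instance Definition _ := Choice.on Zs.

Definition zc : S * S -> Zs := @qcls _ zequ.
Definition zr : Zs -> S * S := @qrep _ zequ.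
Definition zadd (x y : Zs) := zc ((zr x).1 + (zr y).1, (zr x).2 + (zr y).2).
Definition zopp (x : Zs) := zc ((zr x).2, (zr x).1).
Definition zmul (x y : Zs) := zc
  ((zr x).1 * (zr y).1 + (zr x).2 * (zr y).2, (zr x).1 * (zr y).2 + (zr x).2 * (zr y).1).

Lemma zrc p : zeq (zr (zc p)) p. Proof. exact: (@qrep_cls _ zequ). Qed.
Lemma zcr x : zc (zr x) = x. Proof. exact: (@qrepK _ zequ). Qed.
Lemma zcP p q : zc p = zc q <-> zeq p q. Proof. exact: (@qclsP _ zequ). Qed.

Lemma zaddE p q : zadd (zc p) (zc q) = zc (p.1 + q.1, p.2 + q.2).
Proof.
have := zrc p; have := zrc q; rewrite /zadd /zmul.
move: (zr (zc q)) (zr (zc p)) => [a b] [c d].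
case: p q => [e f] [g h] e1 e2; apply/zcP; move: e1 e2; rewrite /zeq /= => e1 e2.
have -> : c + a + (f + h) = (c + f) + (a + h) by ring.
by rewrite e1 e2; ring.
Qed.

Lemma zoppE p : zopp (zc p) = zc (p.2, p.1).
Proof.
rewrite /zopp; case: p (zr (zc p)) (zrc p) => [c d] [a b] e; apply/zcP.
move: e; rewrite /zeq /= => e.
by rewrite addrC -e addrC.
Qed.

Lemma zmulE p q : zmul (zc p) (zc q)
  = zc (p.1 * q.1 + p.2 * q.2, p.1 * q.2 + p.2 * q.1).
Proof.
have := zrc p; have := zrc q; rewrite /zadd /zmul.
move: (zr (zc q)) (zr (zc p)) => [a b] [c d].
case: p q => [e f] [g h] e1 e2; apply/zcP; move: e1 e2; rewrite /zeq /= => e1 e2.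
(* There is no subtraction, so the same cross terms are added to both sides; they group the sums of
   [e1] and [e2] for rewriting. *)
apply: (@o_addI _ _ (f * a + e * b + e * a + f * b)).
have -> : c * a + d * b + (e * h + f * g) + (f * a + e * b + e * a + f * b)
  = (c + f) * a + (d + e) * b + e * (a + h) + f * (g + b) by ring.
have -> : e * g + f * h + (c * b + d * a) + (f * a + e * b + e * a + f * b)
  = (c + f) * b + (d + e) * a + e * (g + b) + f * (a + h) by ring.
by rewrite e1 e2; ring.
Qed.

Lemma zind (P : Zs -> Prop) : (forall a b, P (zc (a, b))) -> forall x, P x.
Proof. by move=> h x; rewrite -(zcr x); case: (zr x). Qed.

Ltac zax := repeat (elim/zind => ? ?); rewrite ?(zaddE, zoppE, zmulE) /=;
  apply/zcP; rewrite /zeq /=; try ring.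

Definition z0 := zc (0, 0).
Definition z1 := zc (1, 0).

Lemma zaddA : associative zadd. Proof. by zax. Qed.
Lemma zaddC : commutative zadd. Proof. by zax. Qed.
Lemma zadd0 : left_id z0 zadd. Proof. by zax. Qed.
Lemma zaddN : left_inverse z0 zopp zadd. Proof. by zax. Qed.
Lemma zmulA : associative zmul. Proof. by zax. Qed.
Lemma zmulC : commutative zmul. Proof. by zax. Qed.
Lemma zmul1 : left_id z1 zmul. Proof. by zax. Qed.
Lemma zmulDl : left_distributive zmul zadd. Proof. by zax. Qed.
Lemma z1_neq0 : z1 != z0.
Proof.
apply/eqP => /zcP; rewrite /zeq /= !addr0 => e.
by have := olt01 S; rewrite -[oone S]/(1 : S) e => /olt_irr.
Qed.

HB.instance Definition _ := GRing.isZmodule.Build Zs zaddA zaddC zadd0 zaddN.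
HB.instance Definition _ :=
  GRing.Zmodule_isComNzRing.Build Zs zmulA zmulC zmul1 zmulDl z1_neq0.

Definition zunit : pred Zs := fun x => `[< exists y, y * x = 1 >].
Definition zinv (x : Zs) : Zs :=
  if pselect (exists y, y * x = 1) is left e then projT1 (cid e) else x.

Lemma zmulV : {in zunit, left_inverse 1 zinv *%R}.
Proof.
move=> x /asboolP e; rewrite /zinv; case: pselect => // e'.
by case: (cid e').
Qed.

Lemma zunitP (x y : Zs) : y * x = 1 -> zunit x.
Proof. by move=> e; apply/asboolP; exists y. Qed.

Lemma zinv_out : {in [predC zunit], zinv =1 id}.
Proof. by move=> x /asboolP; rewrite /zinv; case: pselect. Qed.

HB.instance Definition _ :=
  GRing.ComNzRing_hasMulInverse.Build Zs zmulV zunitP zinv_out.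

(** If a and b differ, write the larger one as the smaller plus k; the equation then reduces to one
    between c k and d k, and k cancels. *)
Lemma zintegral (x y : Zs) : x * y = 0 -> (x == 0) || (y == 0).
Proof.
elim/zind: x => a b; elim/zind: y => c d; rewrite -[_ * _]/(zmul _ _) zmulE => /zcP.
rewrite /zeq /= addr0 add0r => e.
have z0P u v : (zc (u, v) == 0 :> Zs) = (u == v).
  by apply/eqP/eqP => [/zcP|->]; first rewrite /zeq /= addr0 add0r //;
    apply/zcP; rewrite /zeq /= addrC.
rewrite !z0P; have [l|[->|l]] := olt_total a b; rewrite ?eqxx //.
  have [k k0 bE] := olt_sub l; apply/orP; right; apply/eqP.
  apply: (@o_mulI _ _ k k0); apply: (@o_addI _ _ (a * c + a * d)).
  rewrite bE -[oadd a k]/(a + k) in e.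
  have -> : c * k + (a * c + a * d) = a * d + (a + k) * c by ring.
  by rewrite -e; ring.
have [k k0 aE] := olt_sub l; apply/orP; right; apply/eqP.
apply: (@o_mulI _ _ k k0); apply: (@o_addI _ _ (b * c + b * d)).
rewrite aE -[oadd b k]/(b + k) in e.
have -> : c * k + (b * c + b * d) = (b + k) * c + b * d by ring.
by rewrite e; ring.
Qed.

HB.instance Definition _ := GRing.ComUnitRing_isIntegral.Build Zs zintegral.

Definition Fs := {fraction Zs}.
HB.instance Definition _ := GRing.Field.on Fs.

Definition fr (a : S) : Fs := FracField.tofrac (zc (a, 0)).

Lemma frD a b : fr (a + b) = fr a + fr b.
Proof.
rewrite /fr -rmorphD; congr (FracField.tofrac _).
by rewrite -[RHS]/(zadd _ _) zaddE /= addr0.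
Qed.

Lemma frM a b : fr (a * b) = fr a * fr b.
Proof.
rewrite /fr -rmorphM; congr (FracField.tofrac _).
by rewrite -[RHS]/(zmul _ _) zmulE /= !mulr0 mul0r !addr0.
Qed.

Lemma fr1 : fr 1 = 1. Proof. exact: rmorph1. Qed.
Lemma fr0 : fr 0 = 0. Proof. exact: rmorph0. Qed.

Lemma fr_inj : injective fr.
Proof. by move=> a b /eqP; rewrite tofrac_eq => /eqP/zcP; rewrite /zeq /= !addr0. Qed.

Lemma fr_neq0 a : olt 0 a -> fr a != 0.
Proof.
move=> a0; rewrite -fr0 (inj_eq fr_inj); apply/eqP => e.
by rewrite e in a0; apply: (olt_irr a0).
Qed.

(** The denominator is a difference of two numbers. If it is negative, exchanging the two numbers of
    the numerator makes it positive. *)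
Lemma frP (x : Fs) : exists a b c, olt 0 c /\ x = (fr a - fr b) / fr c.
Proof.
have zfr (z : Zs) : exists a b, FracField.tofrac z = fr a - fr b.
  elim/zind: z => a b; exists a, b; rewrite /fr -rmorphB; congr (FracField.tofrac _).
  by rewrite -[RHS]/(zadd _ (zopp _)) zoppE zaddE /= addr0 add0r.
have [n [d [dn0 ->]]] : exists n d : Zs, d != 0 /\ x = FracField.tofrac n / FracField.tofrac d.
  elim/quotW: x => r; exists \n_r, \d_r; split; first exact: denom_ratioP.
  apply/eqP; rewrite -(can2_eq (mulfK _) (mulfVK _)) ?tofrac_eq0 ?denom_ratioP //.
  apply/eqP; unlock FracField.tofrac; rewrite -[LHS]FracField.pi_mul.
  apply/eqmodP; rewrite /= FracField.equivfE /FracField.mulf.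
  by rewrite !numden_Ratio ?mulf_neq0 ?denom_ratioP ?oner_neq0 // !mulr1 mulrC.
have [a [b ->]] := zfr n; have [c [e de]] := zfr d.
have ce : fr c - fr e != 0 by rewrite -de tofrac_eq0.
have [l|[e1|l]] := olt_total c e.
- have [k k0 eE] := olt_sub l; exists b, a, k; split=> //.
  rewrite de eE -[oadd c k]/(c + k) frD opprD addrA subrr add0r invrN mulrN -mulNr opprB.
  by [].
- by rewrite e1 subrr eqxx in ce.
- have [k k0 cE] := olt_sub l; exists a, b, k; split=> //.
  by rewrite de cE -[oadd e k]/(e + k) frD addrAC subrr add0r.
Qed.

Definition fpos (x : Fs) := exists d c : S, [/\ olt 0 d, olt 0 c & x = fr d / fr c].

Lemma fpos_add x y : fpos x -> fpos y -> fpos (x + y).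
Proof.
move=> [d [c [d0 c0 ->]]] [d' [c' [d0' c0' ->]]].
exists (d * c' + d' * c), (c * c'); split; try exact: olt0_mul.
  by apply: olt0_add; apply: olt0_mul.
by rewrite frD !frM addf_div ?fr_neq0.
Qed.

Lemma fpos_mul x y : fpos x -> fpos y -> fpos (x * y).
Proof.
move=> [d [c [d0 c0 ->]]] [d' [c' [d0' c0' ->]]].
exists (d * d'), (c * c'); split; try exact: olt0_mul.
by rewrite !frM mulf_div.
Qed.

Lemma fpos_not0 : ~ fpos 0.
Proof.
move=> [d [c [d0 c0 /eqP]]].
by rewrite eq_sym mulf_eq0 invr_eq0 (negbTE (fr_neq0 d0)) (negbTE (fr_neq0 c0)).
Qed.

Lemma fpos_total x : x = 0 \/ fpos x \/ fpos (- x).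
Proof.
have [a [b [c [c0 ->]]]] := frP x.
have [l|[->|l]] := olt_total a b; last 2 first.
- by left; rewrite subrr mul0r.
- have [k k0 ->] := olt_sub l; right; left; exists k, c; split=> //.
  by rewrite -[oadd b k]/(b + k) frD addrAC subrr add0r.
- have [k k0 ->] := olt_sub l; right; right; exists k, c; split=> //.
  by rewrite -[oadd a k]/(a + k) frD -mulNr opprB addrC addKr.
Qed.

HB.instance Definition _ := Num.IntegralDomain_isLtReal.Build Fs
  (cone_add fpos_add) (cone_mul fpos_mul) (cone_ngt0 fpos_add fpos_not0)
  (@cone_sub Fs fpos) (cone_total fpos_total)
  (cone_normN fpos_add fpos_not0 fpos_total) (cone_ge0_norm fpos_add fpos_not0)
  (fun _ _ => erefl).

Lemma fr_lt a b : olt a b -> fr a < fr b.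
Proof.
move=> /olt_sub [d d0 ->]; apply/asboolP; exists d, 1; split=> //; first exact: olt01.
by rewrite -[oadd a d]/(a + d) frD fr1 divr1 addrC addKr.
Qed.
End Fractions.

(** * Completion of an ordered field along a directed set *)

(** The index set will be the numbers of a model, which need not be standard, so sequences over
    [nat] would not do. *)
Record directed := Directed {
  dcar :> Type;
  dle : dcar -> dcar -> Prop;
  dbase : dcar;
  dle_refl : forall i, dle i i;
  dle_trans : forall i j k, dle i j -> dle j k -> dle i k;
  dle_dir : forall i j, exists2 k, dle i k & dle j k
}.

Section Completion.
Variables (F : realFieldType) (I : directed).
Local Notation le := (@dle I).

Definition ev (P : I -> Prop) := exists i, forall j, le i j -> P j.

Lemma ev_mono (P Q : I -> Prop) : (forall i, P i -> Q i) -> ev P -> ev Q.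
Proof. by move=> h [i p]; exists i => j /p /h. Qed.

Lemma ev_and (P Q : I -> Prop) : ev P -> ev Q -> ev (fun i => P i /\ Q i).
Proof.
move=> [i p] [j q]; have [k ik jk] := dle_dir i j; exists k => l kl.
by split; [apply: p; apply: dle_trans kl|apply: q; apply: dle_trans kl].
Qed.

Lemma ev_ex P : ev P -> exists i, P i.
Proof. by move=> [i /(_ i (dle_refl i)) p]; exists i. Qed.

Lemma ev_true (P : I -> Prop) : (forall i, P i) -> ev P.
Proof. by move=> h; exists (dbase I). Qed.

(** Equivalent to the condition with two indices; a single approximating constant combines better
    with [ev_and]. *)
Definition cauchy (s : I -> F) :=
  forall e, 0 < e -> exists c, ev (fun i => `|s i - c| < e).

Lemma cauchy_bounded s : cauchy s -> exists2 B, 0 < B & ev (fun i => `|s i| < B).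
Proof.
move=> /(_ 1 ltr01) [c h]; exists (`|c| + 1); first by rewrite ltr_wpDl.
apply: ev_mono h => i h; rewrite -[s i](subrK c) addrC.
by apply: le_lt_trans (ler_normD _ _) _; rewrite ltrD2l.
Qed.

Lemma cauchy_const c : cauchy (fun _ => c).
Proof. by move=> e e0; exists c; apply: ev_true => i; rewrite subrr normr0. Qed.

Lemma cauchy_add s t : cauchy s -> cauchy t -> cauchy (fun i => s i + t i).
Proof.
move=> hs ht e e0; have e2 : 0 < e / 2 by lra.
have [c h] := hs _ e2; have [d k] := ht _ e2; exists (c + d).
apply: ev_mono (ev_and h k) => i []; rewrite !ltr_distlC => /andP[? ?] /andP[? ?].
by apply/andP; split; lra.
Qed.

Lemma cauchy_opp s : cauchy s -> cauchy (fun i => - s i).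
Proof.
move=> hs e /hs [c h]; exists (- c); apply: ev_mono h => i.
by rewrite -opprD normrN.
Qed.

Lemma cauchy_mul s t : cauchy s -> cauchy t -> cauchy (fun i => s i * t i).
Proof.
move=> hs ht e e0.
have [A A0 hA] := cauchy_bounded hs; have [B B0 hB] := cauchy_bounded ht.
(* The error is at most A m + |d| m. As m is at most 1, |d| is below B + 1, and the total is below m
   D. *)
pose D := A + B + 1; have D0 : 0 < D by rewrite /D; lra.
pose m := Order.min 1 (e / D); have m0 : 0 < m by rewrite lt_min ltr01 divr_gt0.
have m1 : m <= 1 by rewrite ge_min lexx.
have mD : m * D <= e by rewrite -ler_pdivlMr // ge_min lexx orbT.
have [c h] := hs _ m0; have [d k] := ht _ m0; exists (c * d).
have dB : `|d| < B + 1.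
  have [i [ti tB]] := ev_ex (ev_and k hB).
  have : `|d| <= `|t i| + `|t i - d| by rewrite -[in X in X <= _](subKr (t i) d) ler_normB.
  lra.
apply: ev_mono (ev_and (ev_and h k) hA) => i [[si ti] sA].
have -> : s i * t i - c * d = s i * (t i - d) + d * (s i - c) by ring.
apply: le_lt_trans (ler_normD _ _) _; rewrite !normrM.
have : `|s i| * `|t i - d| <= A * m by apply: ler_pM => //; apply: ltW.
have : `|d| * `|s i - c| <= `|d| * m by apply: ler_wpM2l => //; apply: ltW.
have : `|d| * m < (B + 1) * m by rewrite ltr_pM2r.
by rewrite /D in mD; lra.
Qed.

Definition null (s : I -> F) := forall e, 0 < e -> ev (fun i => `|s i| < e).

(** A Cauchy family that is not null is eventually bounded away from 0 on one side. This yields both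
    the total order and the inverses of the completion. *)
Lemma cauchy_sign s : cauchy s ->
  null s \/ exists2 b, 0 < b & ev (fun i => b < s i) \/ ev (fun i => b < - s i).
Proof.
move=> hs; have [|] := pselect (null s); [by left|move=> /existsNP[e /not_implyP[e0 he]]].
have e4 : 0 < e / 4 by lra.
right; exists (e / 4) => //; have [c hc] := hs _ e4.
have [c1|c1] := ltP (e / 2) c.
  by left; apply: ev_mono hc => i; rewrite ltr_distlC => /andP[? ?]; lra.
have [c2|c2] := ltP c (- (e / 2)).
  by right; apply: ev_mono hc => i; rewrite ltr_distlC => /andP[? ?]; lra.
case: he; apply: ev_mono hc => i; rewrite ltr_distlC ltr_norml => /andP[? ?].
by apply/andP; split; lra.
Qed.

Lemma cauchy_inv s b : cauchy s -> 0 < b -> ev (fun i => b < `|s i|) ->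
  cauchy (fun i => (s i)^-1).
Proof.
move=> hs b0 hb e e0.
(* The first bound keeps |c| above b / 2; by the second, |s i - c| is less than e |s i| |c|. *)
pose m := Order.min (b / 2) (e * (b * b) / 4).
have bb : 0 < b * b by apply: mulr_gt0.
have m0 : 0 < m by rewrite lt_min; apply/andP; split; [lra|rewrite divr_gt0 ?mulr_gt0].
have m1 : m <= b / 2 by rewrite ge_min lexx.
have m2 : m <= e * (b * b) / 4 by rewrite ge_min lexx orbT.
have [c hc] := hs _ m0; exists c^-1.
have cb : b / 2 < `|c|.
  have [i [ti tB]] := ev_ex (ev_and hc hb).
  have : `|s i| <= `|c| + `|s i - c| by rewrite -[in X in X <= _](subrK c (s i)) addrC ler_normD.
  lra.
apply: ev_mono (ev_and hc hb) => i [sc sb].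
have s0 : s i != 0 by rewrite -normr_gt0; lra.
have c0 : c != 0 by rewrite -normr_gt0; lra.
have -> : (s i)^-1 - c^-1 = (c - s i) / (s i * c) by field; rewrite s0 c0.
rewrite normrM normfV normrM distrC ltr_pdivrMr; last by apply: mulr_gt0; lra.
have : b * (b / 2) <= `|s i| * `|c| by apply: ler_pM; lra.
move=> /(ler_wpM2l (ltW e0)) h; apply: lt_le_trans h.
by nra.
Qed.

Record cseq := CSeq { cfun :> I -> F; cfun_cauchy : cauchy cfun }.

Definition ceq (s t : cseq) := null (fun i => s i - t i).

Lemma null_add s t : null s -> null t -> null (fun i => s i + t i).
Proof.
move=> hs ht e e0; have e2 : 0 < e / 2 by lra.
apply: ev_mono (ev_and (hs _ e2) (ht _ e2)) => i [].
by rewrite !ltr_norml => /andP[? ?] /andP[? ?]; apply/andP; split; lra.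
Qed.

Lemma null_ext s t : (forall i, s i = t i) -> null s -> null t.
Proof. by move=> e hs d /hs; apply: ev_mono => i; rewrite e. Qed.

Lemma null0 : null (fun _ => 0).
Proof. by move=> e e0; apply: ev_true => i; rewrite normr0. Qed.

Lemma null_opp s : null s -> null (fun i => - s i).
Proof. by move=> h e /h; apply: ev_mono => i; rewrite normrN. Qed.

Lemma null_mul s t : null s -> cauchy t -> null (fun i => s i * t i).
Proof.
move=> hs /cauchy_bounded [B B0 hB] e e0.
apply: ev_mono (ev_and hB (hs _ (divr_gt0 e0 B0))) => i [tB].
rewrite normrM ltr_pdivlMr // => h; apply: le_lt_trans h.
by apply: ler_wpM2l => //; apply: ltW.
Qed.

Lemma ceq_refl s : ceq s s.
Proof. by apply: null_ext null0 => i; rewrite subrr. Qed.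
Lemma ceq_sym s t : ceq s t -> ceq t s.
Proof. by move=> /null_opp; apply: null_ext => i; rewrite opprB. Qed.
Lemma ceq_trans s t u : ceq s t -> ceq t u -> ceq s u.
Proof. by move=> h /(null_add h); apply: null_ext => i; ring. Qed.

Definition cequ := Equivalence ceq_refl ceq_sym ceq_trans.
Definition Ks := quot cequ.
HB.instance Definition _ := Choice.on Ks.

Definition kc : cseq -> Ks := @qcls _ cequ.
Definition kr : Ks -> cseq := @qrep _ cequ.

Lemma kcr x : kc (kr x) = x. Proof. exact: (@qrepK _ cequ). Qed.
Lemma kcP s t : kc s = kc t <-> ceq s t. Proof. exact: (@qclsP _ cequ). Qed.
Lemma krc s : ceq (kr (kc s)) s. Proof. exact: (@qrep_cls _ cequ). Qed.

Definition sconst (c : F) : cseq := CSeq (cauchy_const c).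
Definition sadd (s t : cseq) : cseq := CSeq (cauchy_add (cfun_cauchy s) (cfun_cauchy t)).
Definition sopp (s : cseq) : cseq := CSeq (cauchy_opp (cfun_cauchy s)).
Definition smul (s t : cseq) : cseq := CSeq (cauchy_mul (cfun_cauchy s) (cfun_cauchy t)).

Definition kconst (c : F) : Ks := kc (sconst c).
Definition kadd (x y : Ks) := kc (sadd (kr x) (kr y)).
Definition kopp (x : Ks) := kc (sopp (kr x)).
Definition kmul (x y : Ks) := kc (smul (kr x) (kr y)).

Lemma kaddE s t : kadd (kc s) (kc t) = kc (sadd s t).
Proof. by apply/kcP; apply: null_ext (null_add (krc s) (krc t)) => i /=; ring. Qed.

Lemma koppE s : kopp (kc s) = kc (sopp s).
Proof. by apply/kcP; apply: null_ext (null_opp (krc s)) => i /=; ring. Qed.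

Lemma kmulE s t : kmul (kc s) (kc t) = kc (smul s t).
Proof.
apply/kcP; have h1 := null_mul (krc s) (cfun_cauchy (kr (kc t))).
have h2 := null_mul (krc t) (cfun_cauchy s).
by apply: null_ext (null_add h1 h2) => i /=; ring.
Qed.

Lemma kind (P : Ks -> Prop) : (forall s, P (kc s)) -> forall x, P x.
Proof. by move=> h x; rewrite -(kcr x). Qed.

Lemma kc_ext (s t : cseq) : (forall i, s i = t i) -> kc s = kc t.
Proof. by move=> e; apply/kcP; apply: null_ext null0 => i; rewrite e subrr. Qed.

Ltac kax := repeat (elim/kind => ?); rewrite /kconst ?(kaddE, koppE, kmulE);
  apply: kc_ext => i /=; ring.

Lemma kaddA : associative kadd. Proof. by kax. Qed.
Lemma kaddC : commutative kadd. Proof. by kax. Qed.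
Lemma kadd0 : left_id (kconst 0) kadd. Proof. by kax. Qed.
Lemma kaddN : left_inverse (kconst 0) kopp kadd. Proof. by kax. Qed.
Lemma kmulA : associative kmul. Proof. by kax. Qed.
Lemma kmulC : commutative kmul. Proof. by kax. Qed.
Lemma kmul1 : left_id (kconst 1) kmul. Proof. by kax. Qed.
Lemma kmulDl : left_distributive kmul kadd. Proof. by kax. Qed.
Lemma k1_neq0 : kconst 1 != kconst 0.
Proof.
apply/eqP => /kcP /(_ 1 ltr01) /ev_ex [i] /=.
by rewrite subr0 normr1 ltxx.
Qed.

HB.instance Definition _ := GRing.isZmodule.Build Ks kaddA kaddC kadd0 kaddN.
HB.instance Definition _ :=
  GRing.Zmodule_isComNzRing.Build Ks kmulA kmulC kmul1 kmulDl k1_neq0.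

Lemma kc_eq0 s : kc s = 0 <-> null s.
Proof.
apply: (iff_trans (kcP _ _)).
by split; apply: null_ext => i; rewrite /= subr0.
Qed.

Definition kpos (x : Ks) := exists s b, [/\ x = kc s, 0 < b & ev (fun i => b < s i)].

Lemma kposP (x : Ks) : x = 0 \/ kpos x \/ kpos (- x).
Proof.
elim/kind: x => s; have [/kc_eq0|[b b0 [h|h]]] := cauchy_sign (cfun_cauchy s).
- by left.
- by right; left; exists s, b.
- by right; right; exists (sopp s), b; split=> //; rewrite -[LHS]/(kopp _) koppE.
Qed.

Lemma kmulV_ex (x : Ks) : x != 0 -> exists y, y * x = 1.
Proof.
elim/kind: x => s /eqP s0.
have [b b0 hb] : exists2 b, 0 < b & ev (fun i => b < `|s i|).
  have [/kc_eq0 //|[b b0 h]] := cauchy_sign (cfun_cauchy s).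
  exists b => //; case: h; apply: ev_mono => i h.
    by rewrite (lt_le_trans h) // ler_norm.
  by rewrite (lt_le_trans h) // -normrN ler_norm.
exists (kc (CSeq (cauchy_inv (cfun_cauchy s) b0 hb))).
rewrite -[LHS]/(kmul _ _) kmulE; apply/kcP => e e0; apply: (ev_mono _ (hb)) => i /= h.
by rewrite mulVf ?subrr ?normr0 // -normr_gt0 (lt_trans b0).
Qed.

Definition kinv (x : Ks) : Ks :=
  if pselect (exists y, y * x = 1) is left e then projT1 (cid e) else 0.

Lemma kmulV (x : Ks) : x != 0 -> kinv x * x = 1.
Proof. by move=> /kmulV_ex e; rewrite /kinv; case: pselect => // e'; case: cid. Qed.

Lemma kinv0 : kinv 0 = 0.
Proof.
rewrite /kinv; case: pselect => // e; case: (cid e) => y /=.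
by rewrite mulr0 => /eqP; rewrite eq_sym oner_eq0.
Qed.

HB.instance Definition _ := GRing.ComNzRing_isField.Build Ks kmulV kinv0.

Lemma kpos_add x y : kpos x -> kpos y -> kpos (x + y).
Proof.
move=> [s [b [-> b0 hs]]] [t [c [-> c0 ht]]].
exists (sadd s t), (b + c); split; [exact: kaddE|lra|].
by apply: ev_mono (ev_and hs ht) => i [? ?] /=; lra.
Qed.

Lemma kpos_mul x y : kpos x -> kpos y -> kpos (x * y).
Proof.
move=> [s [b [-> b0 hs]]] [t [c [-> c0 ht]]].
exists (smul s t), (b * c); split; [exact: kmulE|exact: mulr_gt0|].
by apply: ev_mono (ev_and hs ht) => i [? ?] /=; apply: ltr_pM => //; apply: ltW.
Qed.

Lemma kpos_not0 : ~ kpos 0.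
Proof.
move=> [s [b [/esym /kc_eq0 h b0 hs]]].
have [i [+ ?]] := ev_ex (ev_and (h _ b0) hs).
by rewrite ltr_norml => /andP[? ?]; lra.
Qed.

HB.instance Definition _ := Num.IntegralDomain_isLtReal.Build Ks
  (cone_add kpos_add) (cone_mul kpos_mul) (cone_ngt0 kpos_add kpos_not0)
  (@cone_sub Ks kpos) (cone_total kposP)
  (cone_normN kpos_add kpos_not0 kposP) (cone_ge0_norm kpos_add kpos_not0)
  (fun _ _ => erefl).

Lemma kltP (x y : Ks) : x < y <-> kpos (y - x).
Proof. by split=> [/asboolP|?] //; apply/asboolP. Qed.

Lemma kconstD a b : kconst (a + b) = kconst a + kconst b.
Proof. by rewrite -[RHS]/(kadd _ _) /kconst kaddE; apply: kc_ext. Qed.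

Lemma kconstN a : kconst (- a) = - kconst a.
Proof. by rewrite -[RHS]/(kopp _) /kconst koppE; apply: kc_ext. Qed.

Lemma kconstM a b : kconst (a * b) = kconst a * kconst b.
Proof. by rewrite -[RHS]/(kmul _ _) /kconst kmulE; apply: kc_ext. Qed.

Lemma kconst_lt a b : a < b -> kconst a < kconst b.
Proof.
move=> ab; apply/kltP; rewrite -kconstN -kconstD.
exists (sconst (b - a)), ((b - a) / 2); split=> //; first by lra.
by apply: ev_true => i /=; lra.
Qed.

Lemma kconst_small (e : Ks) : 0 < e -> exists2 a, 0 < a & kconst a < e.
Proof.
move=> /kltP; rewrite subr0 => -[s [b [-> b0 hs]]]; exists (b / 2); first by lra.
apply/kltP; rewrite -kconstN; exists (sadd s (sconst (- (b / 2)))), (b / 4).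
split; [exact: kaddE|lra|].
by apply: ev_mono hs => i /= ?; lra.
Qed.

Lemma kc_le (s : cseq) c : ev (fun i => s i <= c) -> kc s <= kconst c.
Proof.
move=> h; rewrite leNgt; apply/negP => /kltP.
rewrite -kconstN -[kc s + _]/(kadd _ _) /kconst kaddE => -[t [b [/kcP e b0 ht]]].
have [i [[/= + +] +]] := ev_ex (ev_and (ev_and (e _ b0) ht) h).
by rewrite ltr_norml => /andP[? ?] ? ?; lra.
Qed.

Lemma kc_ge (s : cseq) c : ev (fun i => c <= s i) -> kconst c <= kc s.
Proof.
move=> h; rewrite -lerN2 -kconstN -[- kc s]/(kopp _) koppE; apply: kc_le.
by apply: ev_mono h => i /=; rewrite lerN2.
Qed.

Lemma kconst_le a b : a <= b -> kconst a <= kconst b.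
Proof. by rewrite le_eqVlt => /orP[/eqP -> //|/kconst_lt /ltW]. Qed.

Lemma kconst_ltW a b : kconst a < kconst b -> a < b.
Proof. by rewrite !ltNge; apply: contra => /kconst_le. Qed.

Lemma kconst_norm a : kconst `|a| = `|kconst a|.
Proof.
have [/kconst_le h|/ltW/kconst_le h] := ler0P a; first by rewrite kconstN ler0_norm.
by rewrite ger0_norm.
Qed.

Lemma kconst_div a c : c != 0 -> kconst (a / c) = kconst a / kconst c.
Proof.
move=> c0; have kc0 : kconst c != 0.
  by have [l|l|e] := ltgtP c 0; [rewrite lt_eqF|rewrite gt_eqF|rewrite e eqxx in c0];
    rewrite // -[0]/(kconst 0) kconst_lt.
by apply: (canRL (mulfK kc0)); rewrite -kconstM divfK.
Qed.

(** Names are sequences of rationals, so limits are wanted only for families in [F], and such a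
    family represents its own limit. By [kconst_small] it suffices to consider errors from [F]. *)
Lemma kcomplete (s : I -> F) :
  (forall e : Ks, 0 < e -> exists i, forall j, le i j -> `|kconst (s j) - kconst (s i)| < e) ->
  exists l : Ks, forall e, 0 < e -> ev (fun i => `|l - kconst (s i)| < e).
Proof.
move=> hK; have hs e : 0 < e -> exists i, forall j, le i j -> `|s j - s i| < e.
  move=> /kconst_lt /hK [i h]; exists i => j /h.
  by rewrite -kconstN -kconstD -kconst_norm => /kconst_ltW.
have cs : cauchy s by move=> e /hs [i h]; exists (s i), i.
exists (kc (CSeq cs)) => e /kconst_small [a a0 ae].
have a2 : 0 < a / 2 by lra.
have [i h] := hs _ a2; exists i => j /h; rewrite ltr_distlC => /andP[? ?].
apply: le_lt_trans ae; rewrite ler_distl; apply/andP; split.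
  rewrite -kconstN -kconstD; apply: kc_ge; exists i => k /h /=.
  by rewrite ltr_distlC => /andP[? ?]; lra.
rewrite -kconstD; apply: kc_le; exists i => k /h /=.
by rewrite ltr_distlC => /andP[? ?]; lra.
Qed.
End Completion.

Record fraction_field (S : osemiring) (F : realFieldType) (ι : S -> F) : Prop := {
  fr_0 : ι 0 = 0;
  fr_1 : ι 1 = 1;
  fr_D : forall a b, ι (a + b) = ι a + ι b;
  fr_M : forall a b, ι (a * b) = ι a * ι b;
  fr_L : forall a b, olt a b -> ι a < ι b;
}.

Lemma fraction_field_ex (S : osemiring) :
  exists (F : realFieldType) (ι : S -> F), fraction_field ι
    /\ forall x, 0 < x -> exists d c, [/\ olt 0 d, olt 0 c & x = ι d / ι c].
Proof.
exists (Fs S), (@fr S); split; last by move=> x /asboolP; rewrite subr0.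
by split; [exact: fr0|exact: fr1|exact: frD|exact: frM|exact: fr_lt].
Qed.

(** The Archimedean property and completeness are both relative to [S]: the bounds are elements of
    [S], and the sequences are indexed by [S] with fractions of [S] as values. A positive e lies
    above some fraction d / c with d at least 1, so c is the bound. *)
Theorem complete_ordered_field (S : osemiring) :
  exists (K : realFieldType) (ι : S -> K),
    [/\ fraction_field ι,
        (forall e : K, 0 < e -> exists2 n, olt 0 n & 1 < ι n * e)
      & (forall x : S -> K,
          (forall n, exists a b c, olt 0 c /\ x n = (ι a - ι b) / ι c) ->
          (forall e, 0 < e -> exists n, forall m, n = m \/ olt n m -> `|x m - x n| < e) ->
          exists l, forall e, 0 < e ->
            exists n, forall m, n = m \/ olt n m -> `|l - x m| < e)].
Proof.
pose le (i j : S) := i = j \/ olt i j.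
have le_refl i : le i i by left.
have le_trans i j k : le i j -> le j k -> le i k.
  by move=> [->//|ij] [<-|jk]; right => //; apply: olt_trans jk.
have le_dir i j : exists2 k, le i k & le j k.
  have [l|[->|l]] := olt_total i j; [exists j|exists j|exists i] => //; by right.
pose I : directed := Directed (0 : S) le_refl le_trans le_dir.
have [F [j [[j0 j1 jD jM jL] jP]]] := fraction_field_ex S.
have jgt0 c : olt 0 c -> 0 < j c by move=> /jL; rewrite j0.
pose ι (a : S) : Ks F I := kconst I (j a).
exists (Ks F I), ι; split; first split.
- by rewrite /ι j0.
- by rewrite /ι j1.
- by move=> a b; rewrite /ι jD kconstD.
- by move=> a b; rewrite /ι jM kconstM.
- by move=> a b /jL; apply: kconst_lt.
- move=> e /kconst_small [_ /jP [d [c [d0 c0 ->]]] ae]; exists c => //.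
  have ιc0 : 0 < ι c by apply: (kconst_lt I (jgt0 _ c0)).
  apply: le_lt_trans (_ : ι c * kconst I (j d / j c) < _); last by rewrite ltr_pM2l.
  rewrite /ι -kconstM mulrC divfK ?gt_eqF ?jgt0 //.
  by apply: (kconst_le I (a := 1)); rewrite -j1; case: (oge1 d0) => [<-|/jL /ltW].
- move=> x xQ hx.
  have [y yx] : exists y : S -> F, forall n, x n = kconst I (y n).
    have ex n : exists q, x n = kconst I q.
      have [a [b [c [c0 ->]]]] := xQ n; exists ((j a - j b) / j c).
      by rewrite kconst_div ?gt_eqF ?jgt0 // kconstD kconstN.
    by exists (fun n => projT1 (cid (ex n))) => n; case: cid.
  have [|l hl] := @kcomplete F I y.
    by move=> e /hx [n hn]; exists n => m /hn; rewrite !yx.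
  by exists l => e /hl [n hn]; exists n => m /hn; rewrite yx.
Qed.

(** * Definability in a model *)

Record model := Model {
  mstr :> structure;
  mext : extensional mstr;
  mval : valid mstr ACA0w
}.

Notation "f • x" := (app f x) (at level 40, left associativity).

Section Definability.
Variable M : model.
Implicit Types Γ : ctx.

Let rval Γ (φ : fm Γ) (a : RCA0w φ) ρ : sat (M := M) φ ρ := mval (ACA0w_RCA0w a) ρ.

Lemma m_PiE A B (x : dom M A) (y : dom M B) : cval M cPi • x • y = x.
Proof.
have := rval (ax_Pi (Γ := [:: A; B]) (Var vz) (Var (vs vz))) (econs x (econs y (enil _))).
by move/(sat_eqT _ _ _ (@mext M)).
Qed.

Lemma m_SigmaE A B C (x : dom M (A ~> B ~> C)) (y : dom M (A ~> B)) (u : dom M A) :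
  cval M cSigma • x • y • u = x • u • (y • u).
Proof.
have := rval (ax_Sigma (Γ := [:: A ~> B ~> C; A ~> B; A])
   (Var vz) (Var (vs vz)) (Var (vs (vs vz)))) (econs x (econs y (econs u (enil _)))).
by move/(sat_eqT _ _ _ (@mext M)).
Qed.

(* The functions of an environment that are given by terms with parameters in M. *)
Inductive Def Γ : forall B, (env M Γ -> dom M B) -> Prop :=
| Def_var A (v : var Γ A) : Def (fun ρ => ρ A v)
| Def_const B (d : dom M B) : Def (fun _ => d)
| Def_app A B (f : env M Γ -> dom M (A ~> B)) g :
    Def f -> Def g -> Def (fun ρ => f ρ • g ρ).

Lemma Def_abstract Γ A B (h : env M (A :: Γ) -> dom M B) : Def h ->
  exists2 g : env M Γ -> dom M (A ~> B), Def g & forall ρ d, g ρ • d = h (econs d ρ).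
Proof.
elim=> {B h} [B v|B d|B C f g _ [f' df fE] _ [g' dg gE]].
- move: B v; apply: var_case => [|B v].
    exists (fun _ => cval M cSigma • cval M (@cPi A (A ~> A)) • cval M cPi).
      exact: Def_const.
    by move=> ρ d; rewrite m_SigmaE m_PiE.
  exists (fun ρ => cval M cPi • ρ B v); last by move=> ρ d; rewrite m_PiE.
  by apply: Def_app; [apply: Def_const|apply: Def_var].
- by exists (fun _ => cval M cPi • d) => [|ρ e]; [apply: Def_const|rewrite m_PiE].
- exists (fun ρ => cval M cSigma • f' ρ • g' ρ).
    by do 2! [apply: Def_app => //]; apply: Def_const.
  by move=> ρ d; rewrite m_SigmaE fE gE.
Qed.

(** A total operator with a default, so that equations such as [eval_abs] carry no definability
    condition. Extensionality makes the representing element unique. *)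
Definition LAM A B (f : dom M A -> dom M B) : dom M (A ~> B) :=
  if pselect (exists F : dom M (A ~> B), forall x, F • x = f x) is left e
  then projT1 (cid e) else eval (enil M) (closed_tm nil (A ~> B)).

Lemma LAM_unique A B (f : dom M A -> dom M B) F : (forall x, F • x = f x) -> F = LAM f.
Proof.
move=> FE; rewrite /LAM; case: pselect => [e|[]]; last by exists F.
by case: cid => G GE; apply: mext => x; rewrite FE GE.
Qed.

Lemma Def_LAM Γ A B (f : env M Γ -> dom M A -> dom M B) :
  Def (Γ := A :: Γ) (fun q => f (etail q) (q A vz)) -> Def (fun ρ => LAM (f ρ)).
Proof.
move=> /Def_abstract [g dg gE].
have -> // : (fun ρ => LAM (f ρ)) = g.
by apply: funext => ρ; apply: esym; apply: LAM_unique => x; rewrite gE.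
Qed.

Lemma LAM_env Γ A B (h : env M (A :: Γ) -> dom M B) ρ x :
  Def h -> LAM (fun d => h (econs d ρ)) • x = h (econs x ρ).
Proof. by move=> /Def_abstract [g _ gE]; rewrite -(LAM_unique (gE ρ)) gE. Qed.

Lemma LAME A B (f : dom M A -> dom M B) x :
  Def (Γ := [:: A]) (fun q => f (q A vz)) -> LAM f • x = f x.
Proof. by move=> /(LAM_env (enil M) x). Qed.

Lemma Def_etail Γ A B (f : env M Γ -> dom M B) :
  Def f -> Def (Γ := A :: Γ) (fun q => f (etail q)).
Proof. by elim=> *; [apply: Def_var|apply: Def_const|apply: Def_app]. Qed.

Lemma eval_abs Γ A B (t : tm (A :: Γ) B) (ρ : env M Γ) :
  eval ρ (abs t) = LAM (fun d => eval (econs d ρ) t).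
Proof.
apply: LAM_unique => x.
elim: t => [C v|C c|C D s IHs u IHu] /=; last by rewrite m_SigmaE IHs IHu.
  by move: C v; apply: var_case => [|C v] /=; rewrite ?m_SigmaE m_PiE.
by rewrite m_PiE.
Qed.

Lemma Def_eval Γ A (t : tm Γ A) : Def (fun ρ => eval ρ t).
Proof. by elim: t => *; [apply: Def_var|apply: Def_const|apply: Def_app]. Qed.

Local Notation N := (dom M tN).
Local Notation O := (cval M c0).
Local Notation I := (cval M c1).
Definition nadd (a b : N) : N := cval M cadd • a • b.
Definition nmul (a b : N) : N := cval M cmul • a • b.
Local Notation "a +' b" := (nadd a b) (at level 50, left associativity).
Local Notation "a *' b" := (nmul a b) (at level 45, left associativity).
Local Notation "a <' b" := (@lt0 M a b) (at level 70).

Let e1 (a : N) : env M [:: tN] := econs a (enil M).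
Let e2 (a b : N) : env M [:: tN; tN] := econs a (econs b (enil M)).
Let e3 (a b c : N) : env M [:: tN; tN; tN] := econs a (econs b (econs c (enil M))).

Let v0 {Γ} : tm (tN :: Γ) tN := Var vz.
Let v1 {Γ A} : tm (A :: tN :: Γ) tN := Var (vs vz).
Let v2 {Γ A B} : tm (A :: B :: tN :: Γ) tN := Var (vs (vs vz)).

Lemma naddC : commutative nadd.
Proof. by move=> a b; apply: (rval (ax_addC v0 v1) (e2 a b)). Qed.
Lemma naddA : associative nadd.
Proof. by move=> a b c; apply: (rval (ax_addA v0 v1 v2) (e3 a b c)). Qed.
Lemma nadd0 : left_id O nadd.
Proof. by move=> a; rewrite naddC; apply: (rval (ax_add0 v0) (e1 a)). Qed.
Lemma nmulC : commutative nmul.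
Proof. by move=> a b; apply: (rval (ax_mulC v0 v1) (e2 a b)). Qed.
Lemma nmulA : associative nmul.
Proof. by move=> a b c; apply: (rval (ax_mulA v0 v1 v2) (e3 a b c)). Qed.
Lemma nmul1 : left_id I nmul.
Proof. by move=> a; rewrite nmulC; apply: (rval (ax_mul1 v0) (e1 a)). Qed.
Lemma nmul0 : left_zero O nmul.
Proof. by move=> a; rewrite nmulC; apply: (rval (ax_mul0 v0) (e1 a)). Qed.
Lemma nmulDl : left_distributive nmul nadd.
Proof.
move=> a b c; rewrite nmulC [a *' c]nmulC [b *' c]nmulC.
exact: (rval (ax_mulD v0 v1 v2) (e3 c a b)).
Qed.
Lemma nlt_irr a : ~ a <' a.
Proof. exact: (rval (ax_lt_irr v0) (e1 a)). Qed.
Lemma nlt_trans a b c : a <' b -> b <' c -> a <' c.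
Proof. exact: (rval (ax_lt_trans v0 v1 v2) (e3 a b c)). Qed.
Lemma nlt_total a b : a <' b \/ a = b \/ b <' a.
Proof. exact: (rval (ax_lt_total v0 v1) (e2 a b)). Qed.
Lemma nlt01 : O <' I.
Proof. exact: (rval (ax_lt01 nil) (enil M)). Qed.
Lemma nlt_add a b c : a <' b -> a +' c <' b +' c.
Proof. exact: (rval (ax_lt_add v0 v1 v2) (e3 a b c)). Qed.
Lemma nlt_mul a b c : a <' b -> O <' c -> a *' c <' b *' c.
Proof. exact: (rval (ax_lt_mul v0 v1 v2) (e3 a b c)). Qed.

Lemma ind_qf Γ (φ : fm (tN :: Γ)) ρ : qf φ -> sat φ (econs O ρ) ->
  (forall n, sat φ (econs n ρ) -> sat φ (econs (n +' I) ρ)) ->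
  forall n, sat φ (econs n ρ).
Proof.
move=> q h0 hS n; have /= := rval (ax_QFind q) ρ; rewrite /inst !sat_fsubst; apply.
split=> [|d /hS].
  by have -> : (fun A v => eval ρ (scons (Con c0) sid v)) = econs O ρ by apply: vfun_consE.
by rewrite sat_fsubst; congr sat; apply: vfun_consE.
Qed.

Definition recS (f : N -> N -> N) (m n : N) : N :=
  cval M cR0 • LAM (fun k => LAM (f k)) • m • n.

Definition Def2 A B C (f : dom M A -> dom M B -> dom M C) :=
  Def (Γ := [:: B; A]) (fun q => f (q A (vs vz)) (q B vz)).

Lemma LAM2E A B C (f : dom M A -> dom M B -> dom M C) x y :
  Def2 f -> LAM (fun k => LAM (f k)) • x • y = f x y.
Proof.
move=> df; rewrite LAME; last exact: Def_LAM.
have /Def_abstract [g _ gE] := df.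
have e := LAM_unique (f := f x) (gE (econs x (enil _))).
by rewrite -e gE.
Qed.

Lemma recS0 f m : recS f m O = m.
Proof.
exact: (rval (ax_R0_zero (Γ := [:: tN; tN ~> tN ~> tN]) (Var (vs vz)) (Var vz))
  (econs m (econs (LAM (fun k => LAM (f k))) (enil M)))).
Qed.

Lemma recSS f m n : Def2 f -> recS f m (n +' I) = f n (recS f m n).
Proof.
move=> df.
have := rval (ax_R0_succ (Γ := [:: tN; tN; tN ~> tN ~> tN])
   (Var (vs (vs vz))) (Var (vs vz)) (Var vz))
  (econs n (econs m (econs (LAM (fun k => LAM (f k))) (enil M)))).
by rewrite /= -/(recS f m n) LAM2E.
Qed.

Lemma Def_rec Γ (f : env M Γ -> N -> N -> N) m n :
  Def (Γ := tN :: tN :: Γ) (fun q => f (etail (etail q)) (q tN (vs vz)) (q tN vz)) ->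
  Def m -> Def n -> Def (fun ρ => recS (f ρ) (m ρ) (n ρ)).
Proof.
move=> df dm dn; do 2! [apply: Def_app => //]; apply: Def_app; first exact: Def_const.
by apply: (Def_LAM (f := fun ρ k => LAM (f ρ k))); apply: Def_LAM.
Qed.

Lemma eval_rec Γ (t : tm (tN :: tN :: Γ) tN) a b (ρ : env M Γ) :
  eval ρ (Con cR0 · abs (abs t) · b · a)
  = recS (fun k r => eval (econs r (econs k ρ)) t) (eval ρ b) (eval ρ a).
Proof.
rewrite /= eval_abs /recS; do 3! congr (_ • _).
by congr LAM; apply: funext => k; rewrite eval_abs.
Qed.

Lemma Def_add Γ (f g : env M Γ -> N) : Def f -> Def g -> Def (fun ρ => f ρ +' g ρ).
Proof. by move=> *; do 2! [apply: Def_app => //]; apply: Def_const. Qed.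

Lemma Def_mul Γ (f g : env M Γ -> N) : Def f -> Def g -> Def (fun ρ => f ρ *' g ρ).
Proof. by move=> *; do 2! [apply: Def_app => //]; apply: Def_const. Qed.

Ltac dfn_lem := first [apply Def_add | apply Def_mul | apply Def_rec].
Ltac dfn_app := match goal with |- Def (fun _ => app _ _) => apply Def_app end.
Ltac dfn := rewrite /Def2;
  repeat (cbv beta delta [etail];
    first [assumption | apply Def_const | apply Def_var | dfn_lem | dfn_app]).

Definition dpred (a : N) := recS (fun k _ => k) O a.

Lemma Def_pred Γ (f : env M Γ -> N) : Def f -> Def (fun ρ => dpred (f ρ)).
Proof. by move=> ?; rewrite /dpred; dfn. Qed.

Lemma eval_tpred Γ (t : tm Γ tN) (ρ : env M Γ) : eval ρ (tpred t) = dpred (eval ρ t).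
Proof. exact: eval_rec. Qed.

Lemma dpred0 : dpred O = O. Proof. exact: recS0. Qed.
Lemma dpredS n : dpred (n +' I) = n. Proof. by rewrite /dpred recSS //; dfn. Qed.

Lemma nge0 n : n = O \/ O <' n.
Proof.
apply: (ind_qf (φ := Or (Eq (Var vz) (Con c0)) (Lt (Con c0) (Var vz))) (ρ := enil M)) => //=.
  by left.
move=> m [->|m0]; right; first by rewrite nadd0; apply: nlt01.
apply: nlt_trans nlt01 _; rewrite -{1}[I]nadd0; exact: nlt_add.
Qed.

Let Defn (f : N -> N) := Def (Γ := [:: tN]) (fun q => f (q tN vz)).

Lemma ind_eq_or (f g h k : N -> N) : Defn f -> Defn g -> Defn h -> Defn k ->
  (f O = g O \/ h O = k O) ->
  (forall n, f n = g n \/ h n = k n -> f (n +' I) = g (n +' I) \/ h (n +' I) = k (n +' I)) ->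
  forall n, f n = g n \/ h n = k n.
Proof.
move=> df dg dh dk h0 hS n.
have E (l : N -> N) (dl : Defn l) m : LAM l • m = l m by rewrite LAME.
pose ρ := econs (LAM f) (econs (LAM g) (econs (LAM h) (econs (LAM k) (enil M)))).
have := @ind_qf _ (Or (Eq (Var (vs vz) · Var vz) (Var (vs (vs vz)) · Var vz))
  (Eq (Var (vs (vs (vs vz))) · Var vz) (Var (vs (vs (vs (vs vz)))) · Var vz))) ρ.
rewrite /= !E //; move=> /(_ (conj Logic.I Logic.I) h0 _ n); rewrite !E //; apply.
by move=> m; rewrite !E //; apply: hS.
Qed.

Lemma ind_eq (f g : N -> N) : Defn f -> Defn g -> f O = g O ->
  (forall n, f n = g n -> f (n +' I) = g (n +' I)) -> forall n, f n = g n.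
Proof.
move=> df dg h0 hS n; have [] // := ind_eq_or df dg df dg (or_introl h0) _ n.
by move=> m [/hS|/hS]; left.
Qed.

Lemma nS_or_0 n : n = O \/ exists m, n = m +' I.
Proof.
have [->|->] : n = O \/ n = dpred n +' I; [|by left|by right; exists (dpred n)].
apply: (ind_eq_or (f := id) (g := fun _ => O) (h := id) (k := fun n => dpred n +' I)).
- by rewrite /Defn; dfn.
- by rewrite /Defn; dfn.
- by rewrite /Defn; dfn.
- by rewrite /Defn; dfn; apply: Def_pred; dfn.
- by left.
- by move=> m _; right; rewrite dpredS.
Qed.

Lemma nlt_S n : n <' n +' I.
Proof. by rewrite naddC -{1}[n]nadd0; apply: nlt_add; apply: nlt01. Qed.

Definition dsub (a b : N) := recS (fun _ r => dpred r) a b.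

Lemma Def_sub Γ (f g : env M Γ -> N) : Def f -> Def g -> Def (fun ρ => dsub (f ρ) (g ρ)).
Proof. by move=> ? ?; rewrite /dsub; dfn; apply: Def_pred; dfn. Qed.

Lemma eval_tsub Γ (s t : tm Γ tN) (ρ : env M Γ) :
  eval ρ (tsub s t) = dsub (eval ρ s) (eval ρ t).
Proof.
rewrite /tsub /lam eval_rec /dsub; congr recS.
by apply: funext => k; apply: funext => r; rewrite eval_tpred.
Qed.

Lemma dsub0 a : dsub a O = a. Proof. exact: recS0. Qed.
Lemma dsubS a b : dsub a (b +' I) = dpred (dsub a b).
Proof. by rewrite /dsub recSS //; dfn; apply: Def_pred; dfn. Qed.

Ltac dfn_lem ::= first [apply Def_add | apply Def_mul | apply Def_pred | apply Def_sub | apply Def_rec].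

Lemma dsubSS a b : dsub (a +' I) (b +' I) = dsub a b.
Proof.
apply: (ind_eq (f := fun b => dsub (a +' I) (b +' I))); rewrite ?/Defn; try by dfn.
  by rewrite dsubS !dsub0 dpredS.
by move=> n e; rewrite dsubS e -dsubS.
Qed.

Lemma daddK c b : dsub (c +' b) b = c.
Proof.
apply: (ind_eq (f := fun b => dsub (c +' b) b) (g := fun _ => c)); rewrite ?/Defn; try by dfn.
  by rewrite dsub0 naddC nadd0.
by move=> n e; rewrite naddA dsubSS.
Qed.

Lemma dsub_add c b : dsub b (c +' b) = O.
Proof.
apply: (ind_eq (f := fun b => dsub b (c +' b)) (g := fun _ => O)); rewrite ?/Defn; try by dfn.
  rewrite naddC nadd0.
  apply: (ind_eq (f := fun b => dsub O b) (g := fun _ => O)); rewrite ?/Defn; try by dfn.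
    exact: dsub0.
  by move=> n e; rewrite dsubS e dpred0.
by move=> n e; rewrite naddA dsubSS.
Qed.

(** Truncated differences serve as explicit witnesses, which turns the statement into a disjunction
    of equations and so into a case of [ind_eq_or]. *)
Lemma ncompare a n : (exists c, a = c +' n) \/ (exists c, n = c +' a).
Proof.
suff [->|->] : a = dsub a n +' n \/ n = dsub n a +' a by [left; eexists|right; eexists].
apply: (ind_eq_or (f := fun _ => a) (g := fun n => dsub a n +' n) (h := id)
  (k := fun n => dsub n a +' a)); rewrite ?/Defn; try by dfn.
  by left; rewrite dsub0 naddC nadd0.
move=> m [e|e]; last first.
  right; have mE : m +' I = dsub m a +' I +' a.
    by rewrite {1}e -naddA [a +' I]naddC naddA.
  by rewrite mE daddK.
case: (nS_or_0 (dsub a m)) => [|[d]] de; rewrite de in e.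
  by rewrite nadd0 in e; right; rewrite e [m +' I]naddC daddK.
have aE : a = d +' (m +' I) by rewrite e -naddA [I +' m]naddC.
by left; rewrite {2}aE daddK.
Qed.

Lemma nlt_sub a b : a <' b -> exists2 d, O <' d & b = a +' d.
Proof.
move=> l; have [[c ae]|[c be]] := ncompare a b; case: (nge0 c) => [c0|c0].
- by rewrite ae c0 nadd0 in l; case: (nlt_irr l).
- have := nlt_add b c0; rewrite nadd0 -ae => /(nlt_trans l) /nlt_irr [].
- by rewrite be c0 nadd0 in l; case: (nlt_irr l).
- by exists c => //; rewrite naddC.
Qed.

Lemma nge1 a : O <' a -> I = a \/ I <' a.
Proof.
case: (nS_or_0 a) => [->/nlt_irr//|[m ->] _]; case: (nge0 m) => [->|m0].
  by left; rewrite nadd0.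
by right; rewrite -{1}[I]nadd0; apply: nlt_add.
Qed.

Definition semiring_of : osemiring :=
  @OSemiring N O I nadd nmul (@lt0 M) naddA naddC nadd0 nmulA nmulC nmul1 nmulDl nmul0
    nlt_irr nlt_trans nlt_total nlt01 nlt_add nlt_mul nlt_sub
    (fun a => match nge0 a with or_introl e => or_introl (esym e) | or_intror h => or_intror h end)
    nge1.

End Definability.

(** * Arithmetical predicates, the search operator and induction *)

Section Arithmetic.
Variable M : model.
Local Notation N := (ocar (semiring_of M)).
Implicit Types Γ : ctx.
Implicit Types a b c n m : N.
Notation Def := (@Def M _ _).

Lemma LAM_envE Γ A B (f : env M Γ -> dom M A -> dom M B) ρ x :
  Def (fun q : env M (A :: Γ) => f (etail q) (q A vz)) -> LAM (f ρ) • x = f ρ x.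
Proof. exact: (LAM_env ρ x). Qed.

Definition Def1 A B (f : dom M A -> dom M B) :=
  Def (fun q : env M [:: A] => f (q A vz)).

Lemma Def_comp1 Γ A B (f : dom M A -> dom M B) (g : env M Γ -> dom M A) :
  Def1 f -> Def g -> Def (fun ρ => f (g ρ)).
Proof.
move=> df dg; have -> : (fun ρ => f (g ρ)) = (fun ρ => LAM f • g ρ).
  by apply: funext => ρ; rewrite LAME.
by apply: Def_app => //; apply: Def_const.
Qed.

Lemma Def_comp2 Γ A B C (f : dom M A -> dom M B -> dom M C)
    (g : env M Γ -> dom M A) (h : env M Γ -> dom M B) :
  Def2 f -> Def g -> Def h -> Def (fun ρ => f (g ρ) (h ρ)).
Proof.
move=> df dg dh.
have -> : (fun ρ => f (g ρ) (h ρ)) = (fun ρ => LAM (fun k => LAM (f k)) • g ρ • h ρ).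
  by apply: funext => ρ; rewrite LAM2E.
by do 2! [apply: Def_app => //]; apply: Def_const.
Qed.

Definition dif0 a b c : N := recS (fun _ _ => c) b a.

Lemma dif00 b c : dif0 (0 : N) b c = b. Proof. exact: recS0. Qed.

Lemma dif0S a b c : a <> (0 : N) -> dif0 a b c = c.
Proof.
case: (nS_or_0 a) => [->//|[m ->] _]; rewrite /dif0 recSS //.
exact: Def_const.
Qed.

Lemma Def_if0 Γ (f g h : env M Γ -> N) :
  Def f -> Def g -> Def h -> Def (fun ρ => dif0 (f ρ) (g ρ) (h ρ)).
Proof.
move=> df dg dh; apply: (Def_rec (f := fun ρ _ _ => h ρ)) => //.
exact: (Def_etail tN (Def_etail tN dh)).
Qed.

Lemma dsub_eq0 a b : dsub a b = (0 : N) <-> ~ olt b a.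
Proof.
split=> [|nl].
  move=> + /nlt_sub [d d0 e]; rewrite {}e naddC daddK => e.
  by rewrite e in d0; apply: (nlt_irr d0).
have [[c e]|[c ->]] := ncompare a b; last exact: dsub_add.
case: (nge0 c) => [c0|c0]; first by rewrite e c0 nadd0; have := dsub_add (0 : N) b; rewrite nadd0.
by case: nl; rewrite e; have := nlt_add b c0; rewrite nadd0.
Qed.

(* 0 stands for truth, as in the search operator. *)
Definition chi (P : Prop) : N := if `[< P >] then 0 else 1.

Lemma chi_true (P : Prop) : P -> chi P = 0.
Proof. by move=> p; rewrite /chi asboolT. Qed.

Lemma n1_neq0 : (1 : N) <> 0.
Proof. by move=> e; have := @nlt01 M; rewrite -[X in lt0 _ X]/(1 : N) e => /nlt_irr. Qed.

Lemma chi_false (P : Prop) : ~ P -> chi P = 1.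
Proof. by move=> p; rewrite /chi asboolF. Qed.

Lemma chiP (P : Prop) : chi P = 0 <-> P.
Proof.
split=> [|/chi_true //]; have [//|/chi_false ->] := pselect P.
by move/n1_neq0.
Qed.

Definition DefP Γ (P : env M Γ -> Prop) := Def (fun ρ => chi (P ρ)).

Lemma DefP_ext Γ (P Q : env M Γ -> Prop) :
  (forall ρ, P ρ <-> Q ρ) -> DefP P -> DefP Q.
Proof.
rewrite /DefP => e; have -> // : P = Q.
by apply: funext => ρ; apply/propext.
Qed.

Lemma DefP_const Γ (P : Prop) : DefP (fun _ : env M Γ => P).
Proof. exact: Def_const. Qed.

Lemma DefP_not Γ (P : env M Γ -> Prop) : DefP P -> DefP (fun ρ => ~ P ρ).
Proof.
move=> dP; have := Def_if0 dP (Def_const _ (1 : N)) (Def_const _ (0 : N)).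
rewrite /DefP; congr Def; apply: funext => ρ.
have [p|p] := pselect (P ρ); first by rewrite (chi_true p) dif00 chi_false.
by rewrite (chi_false p) dif0S ?chi_true //; apply: n1_neq0.
Qed.

Lemma DefP_and Γ (P Q : env M Γ -> Prop) :
  DefP P -> DefP Q -> DefP (fun ρ => P ρ /\ Q ρ).
Proof.
move=> dP dQ; have := Def_if0 dP dQ (Def_const _ (1 : N)).
rewrite /DefP; congr Def; apply: funext => ρ.
have [p|p] := pselect (P ρ).
  rewrite (chi_true p) dif00; congr chi; apply: propext.
  by split=> [//|[]].
rewrite (chi_false p) dif0S; last exact: n1_neq0.
by rewrite chi_false // => -[].
Qed.

Lemma DefP_or Γ (P Q : env M Γ -> Prop) :
  DefP P -> DefP Q -> DefP (fun ρ => P ρ \/ Q ρ).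
Proof.
move=> /DefP_not dP /DefP_not dQ; apply: DefP_ext (DefP_not (DefP_and dP dQ)) => ρ.
by rewrite not_andP !notK.
Qed.

Lemma DefP_imp Γ (P Q : env M Γ -> Prop) :
  DefP P -> DefP Q -> DefP (fun ρ => P ρ -> Q ρ).
Proof.
move=> /DefP_not dP dQ; apply: DefP_ext (DefP_or dP dQ) => ρ.
by rewrite implyE.
Qed.

Lemma DefP_iff Γ (P Q : env M Γ -> Prop) :
  DefP P -> DefP Q -> DefP (fun ρ => P ρ <-> Q ρ).
Proof. by move=> dP dQ; apply: DefP_and; apply: DefP_imp. Qed.

Lemma DefP_eq Γ (f g : env M Γ -> N) : Def f -> Def g -> DefP (fun ρ => f ρ = g ρ).
Proof.
move=> df dg.
have d0 : Def (fun ρ => dif0 (dsub (f ρ) (g ρ)) (dif0 (dsub (g ρ) (f ρ)) (0 : N) (1 : N)) (1 : N)).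
  apply: Def_if0; [exact: Def_sub| |exact: Def_const].
  by apply: Def_if0; [exact: Def_sub|exact: Def_const|exact: Def_const].
move: d0; rewrite /DefP; congr Def; apply: funext => ρ.
have [l|[->|l]] := nlt_total (f ρ) (g ρ).
- rewrite (dsub_eq0 _ _).2 ?dif00; last by move=> /(nlt_trans l) /nlt_irr.
  rewrite dif0S ?chi_false //; first by move=> e; apply: (@olt_irr _ (f ρ)); rewrite {2}e.
  by move/dsub_eq0.
- have e : dsub (g ρ) (g ρ) = (0 : N) by apply/dsub_eq0/nlt_irr.
  by rewrite e !dif00 chi_true.
- rewrite dif0S ?chi_false //; first by move=> e; apply: (@olt_irr _ (f ρ)); rewrite {1}e.
  by move/dsub_eq0.
Qed.

Lemma DefP_lt Γ (f g : env M Γ -> N) : Def f -> Def g -> DefP (fun ρ => olt (f ρ) (g ρ)).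
Proof.
move=> df dg; have d := DefP_not (DefP_eq (Def_sub dg df) (Def_const _ (0 : N))).
by apply: DefP_ext d => ρ; rewrite dsub_eq0 notK.
Qed.

Lemma mu_ex : exists μ : dom M t2, forall f : dom M t1, (exists n : N, f • n = (0 : N)) ->
  f • (μ • f) = (0 : N) /\ forall i : N, olt i (μ • f) -> f • i <> (0 : N).
Proof.
have [μ h] := mval (ACA0w_mu nil) (enil M).
by exists μ => f; have [h1 _] := h f.
Qed.

Definition mu : dom M t2 := projT1 (cid mu_ex).

Lemma muP (f : dom M t1) : (exists n : N, f • n = (0 : N)) ->
  f • (mu • f) = (0 : N) /\ forall i : N, olt i (mu • f) -> f • i <> (0 : N).
Proof. by rewrite /mu; case: cid => /= μ h; apply: h. Qed.

(* The search operator makes number quantifiers decidable. *)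
Lemma DefP_ex Γ (P : env M Γ -> N -> Prop) :
  DefP (fun q : env M (tN :: Γ) => P (etail q) (q tN vz)) ->
  DefP (fun ρ => exists n, P ρ n).
Proof.
move=> dP; pose F (ρ : env M Γ) : dom M t1 := LAM (fun n => chi (P ρ n)).
have FE ρ n : F ρ • n = chi (P ρ n) by apply: (LAM_envE (f := fun ρ n => chi (P ρ n))).
have dF : Def F by exact: (Def_LAM (f := fun ρ n => chi (P ρ n))).
have : DefP (fun ρ => F ρ • (mu • F ρ) = (0 : N)).
  apply: DefP_eq; last exact: Def_const.
  exact: Def_app dF (Def_app (Def_const _ mu) dF).
apply: DefP_ext => ρ; split=> [|[n p]]; first by rewrite FE => /chiP p; exists (mu • F ρ).
by apply: (proj1 (muP _)); exists n; rewrite FE chi_true.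
Qed.

Lemma DefP_all Γ (P : env M Γ -> N -> Prop) :
  DefP (fun q : env M (tN :: Γ) => P (etail q) (q tN vz)) ->
  DefP (fun ρ => forall n, P ρ n).
Proof.
move=> /DefP_not /(DefP_ex (P := fun ρ n => ~ P ρ n)) /DefP_not.
apply: DefP_ext => ρ; split=> [h n|h [n]] //.
by apply: contrapT => p; apply: h; exists n.
Qed.

Lemma Def_ite Γ (P : env M Γ -> Prop) (f g : env M Γ -> N) :
  DefP P -> Def f -> Def g -> Def (fun ρ => if `[< P ρ >] then f ρ else g ρ).
Proof.
move=> dP df dg; have := Def_if0 dP df dg; congr Def; apply: funext => ρ.
rewrite /chi; case: asboolP => _; first by rewrite dif00.
by rewrite dif0S //; apply: n1_neq0.
Qed.

Definition least (P : N -> Prop) : N := mu • LAM (fun n => chi (P n)).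

Definition DefP1 A (P : dom M A -> Prop) := DefP (fun q : env M [:: A] => P (q A vz)).
Definition DefP2 A B (P : dom M A -> dom M B -> Prop) :=
  DefP (fun q : env M [:: B; A] => P (q A (vs vz)) (q B vz)).

Lemma leastP (P : N -> Prop) : DefP1 P -> (exists n, P n) ->
  P (least P) /\ forall i, olt i (least P) -> ~ P i.
Proof.
move=> dP [n p]; have FE m : LAM (fun n => chi (P n)) • m = chi (P m) by rewrite LAME.
have [|h1 h2] := @muP (LAM (fun n => chi (P n))); first by exists n; rewrite FE chi_true.
by split=> [|i /h2]; [move: h1; rewrite FE => /chiP|rewrite FE => h /(chi_true)].
Qed.

Lemma Def_least Γ (P : env M Γ -> N -> Prop) :
  DefP (fun q : env M (tN :: Γ) => P (etail q) (q tN vz)) ->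
  Def (fun ρ => least (P ρ)).
Proof.
move=> dP; exact: Def_app (Def_const _ mu) (Def_LAM (f := fun ρ n => chi (P ρ n)) dP).
Qed.

Lemma DefP_comp1 Γ A (P : dom M A -> Prop) (g : env M Γ -> dom M A) :
  DefP1 P -> Def g -> DefP (fun ρ => P (g ρ)).
Proof. exact: (Def_comp1 (f := fun x => chi (P x))). Qed.

Lemma DefP_comp2 Γ A B (P : dom M A -> dom M B -> Prop)
    (g : env M Γ -> dom M A) (h : env M Γ -> dom M B) :
  DefP2 P -> Def g -> Def h -> DefP (fun ρ => P (g ρ) (h ρ)).
Proof. exact: (Def_comp2 (f := fun x y => chi (P x y))). Qed.

(** A definable predicate is an equation between its characteristic function and 0, so
    quantifier-free induction is enough. *)
Lemma ind (P : N -> Prop) : DefP1 P -> P 0 -> (forall n, P n -> P (n + 1)) -> forall n, P n.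
Proof.
move=> dP h0 hS n; apply/chiP.
apply: (@ind_eq M (fun n => chi (P n)) (fun _ => (0 : N)) dP (Def_const _ _) _ _ n).
  exact: chi_true.
by move=> m /chiP /hS /chi_true.
Qed.

End Arithmetic.

(** * Coding of pairs and of finite sums *)

Lemma Def_addr (M : model) Γ (f g : env M Γ -> ocar (semiring_of M)) :
  Def f -> Def g -> Def (fun ρ => f ρ + g ρ).
Proof. exact: Def_add. Qed.

Lemma Def_mulr (M : model) Γ (f g : env M Γ -> ocar (semiring_of M)) :
  Def f -> Def g -> Def (fun ρ => f ρ * g ρ).
Proof. exact: Def_mul. Qed.

(* [dfn] proves definability by recursion on the syntax of the function. The
   tactics dfn_coding, ..., dfn_math are extended below as operations appear; an
   extension made in a section is lost at its end and is then repeated. *)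
Ltac dfn_hyp := match goal with
  | H : Def1 ?f |- Def (fun _ => ?f _) => apply (Def_comp1 H)
  | H : Def2 ?f |- Def (fun _ => ?f _ _) => apply (Def_comp2 H)
  | H : DefP1 ?f |- DefP (fun _ => ?f _) => apply (DefP_comp1 H)
  | H : DefP2 ?f |- DefP (fun _ => ?f _ _) => apply (DefP_comp2 H)
  end.
Ltac dfn_env := match goal with
  | H : Def _ |- Def _ =>
      first [exact (Def_etail _ H) | exact (Def_etail _ (Def_etail _ H))]
  | H : DefP _ |- DefP _ =>
      first [exact (Def_etail _ H) | exact (Def_etail _ (Def_etail _ H))]
  end.
Ltac dfn_fallback := first [dfn_hyp | assumption | dfn_env].
Ltac dfn_coding := fail.
Ltac dfn_rat := fail.
Ltac dfn_sum := fail.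
Ltac dfn_real := fail.
Ltac dfn_math := fail.
Ltac dfn_unfold := rewrite /Def1 /Def2 /DefP1 /DefP2.
Ltac dfn_more := first [dfn_coding | dfn_rat | dfn_sum | dfn_real | dfn_math].
Ltac dfn_step := lazymatch goal with
  | |- DefP (fun _ => ?P) => apply DefP_const
  | |- DefP (fun _ => _ /\ _) => apply DefP_and
  | |- DefP (fun _ => _ \/ _) => apply DefP_or
  | |- DefP (fun _ => ~ _) => apply DefP_not
  | |- DefP (fun _ => _ <-> _) => apply DefP_iff
  | |- DefP (fun _ => @eq (dom _ _) _ _) => apply DefP_eq
  | |- DefP (fun _ => @eq (ocar _) _ _) => apply DefP_eq
  | |- DefP (fun _ => olt _ _) => apply DefP_lt
  | |- DefP (fun _ => exists n, _) => apply DefP_ex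
  | |- Def (fun _ => ?d) => apply Def_const
  | |- Def (fun q => q _ _) => apply Def_var
  | |- Def (fun _ => (_ + _)%R) => apply Def_addr
  | |- Def (fun _ => (_ * _)%R) => apply Def_mulr
  | |- Def (fun _ => recS _ _ _) => apply Def_rec
  | |- Def (fun _ => dpred _) => apply Def_pred
  | |- Def (fun _ => dsub _ _) => apply Def_sub
  | |- Def (fun _ => dif0 _ _ _) => apply Def_if0
  | |- Def (fun _ => LAM _) => apply Def_LAM
  | |- Def (fun _ => chi _) => refine (_ : DefP _)
  | |- Def (fun _ => least _) => apply Def_least
  | |- Def (fun _ => app _ _) => apply Def_app
  | |- Def (fun _ => if asbool _ then _ else _) => apply Def_ite
  | |- _ => first [dfn_more | dfn_fallback
                  | lazymatch goal with |- DefP _ => first [apply DefP_imp | apply DefP_all] end]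
  end.
Ltac dfn := dfn_unfold;
  repeat (cbv beta delta [etail]; dfn_step).

Section Coding.
Variable M : model.
Local Notation N := (ocar (semiring_of M)).
Implicit Types Γ : ctx.
Implicit Types a b c n m k : N.

Lemma eval_oplus Γ (s t : tm Γ tN) (ρ : env M Γ) :
  eval ρ (s ⊕ t) = (eval ρ s : N) + (eval ρ t : N).
Proof. by []. Qed.

Lemma eval_otimes Γ (s t : tm Γ tN) (ρ : env M Γ) :
  eval ρ (s ⊗ t) = (eval ρ s : N) * (eval ρ t : N).
Proof. by []. Qed.

Lemma eval_zero Γ (ρ : env M Γ) : eval ρ (Con c0) = (0 : N). Proof. by []. Qed.
Lemma eval_lift Γ Δ (w : weakening Γ Δ) A (t : tm Γ A) (ρ : env M Δ) :
  eval ρ (lift t) = eval (fun A v => ρ A (w A v)) t.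
Proof. exact: eval_tren. Qed.

Lemma eval_lam Γ A B (F : tm (A :: Γ) A -> tm (A :: Γ) B) (ρ : env M Γ) :
  eval ρ (lam F) = LAM (fun d => eval (econs d ρ) (F (Var vz))).
Proof. exact: eval_abs. Qed.

Lemma n_cases (n : N) : n = 0 \/ exists m : N, n = m + 1.
Proof. exact: nS_or_0. Qed.

Lemma olt_addl a b c : olt a b -> olt (c + a) (c + b).
Proof. by rewrite ![c + _]addrC; apply: olt_add. Qed.

Lemma ole0 (n : N) : 0 = n \/ olt 0 n. Proof. exact: oge0. Qed.

Lemma olt_S n m : olt n (m + 1) <-> n = m \/ olt n m.
Proof.
split=> [l|[->|/olt_trans]]; last by apply; exact: nlt_S.
- have [l'|[e|l']] := olt_total n m; [by right|by left|].
  have [d d0 e] := olt_sub l'.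
  rewrite e -[oadd m d]/(m + d) in l.
  case: (oge1 d0) => [dE|d1]; first by rewrite -dE in l; case: (olt_irr l).
  by have := olt_addl m d1; move=> /(olt_trans l) /olt_irr.
- exact: nlt_S.
Qed.

Lemma olt0S n : olt 0 (n + 1).
Proof. by apply/olt_S; case: (oge0 n) => [<-|]; [left|right]. Qed.

Lemma olt_n0 n : ~ olt n 0.
Proof.
by move=> l; case: (oge0 n) => [e|/(olt_trans l) /olt_irr //]; rewrite -e in l; apply: (olt_irr l).
Qed.

Definition dpow2 n : N := recS (fun _ r => (r : N) + (r : N)) (1 : N) n.

Lemma Def_pow2 Γ (f : env M Γ -> N) : Def f -> Def (fun ρ => dpow2 (f ρ)).
Proof. by move=> ?; rewrite /dpow2; dfn. Qed.

Lemma dpow20 : dpow2 0 = 1. Proof. exact: recS0. Qed.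
Lemma dpow2S n : dpow2 (n + 1) = dpow2 n + dpow2 n.
Proof. by rewrite /dpow2 [LHS]recSS //; dfn. Qed.

Lemma eval_pow2 Γ (s : tm Γ tN) (ρ : env M Γ) : eval ρ (pow2 s) = dpow2 (eval ρ s).
Proof. exact: eval_rec. Qed.

Lemma dpow2_gt0 n : olt 0 (dpow2 n).
Proof.
apply: (ind (P := fun n => olt 0 (dpow2 n))) n => [||n IH]; last by rewrite dpow2S; apply: olt0_add.
  by dfn; apply: Def_pow2; dfn.
by rewrite dpow20; apply: olt01.
Qed.

Lemma olt_dpow2 n : olt n (dpow2 n).
Proof.
apply: (ind (P := fun n => olt n (dpow2 n))) n => [||n IH].
- by dfn; apply: Def_pow2; dfn.
- by rewrite dpow20; apply: olt01.
- rewrite dpow2S.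
  have h : olt (n + 1) (dpow2 n + 1) by apply: olt_add.
  have : 1 = dpow2 n \/ olt 1 (dpow2 n) by apply: oge1; apply: dpow2_gt0.
  by case=> [{2}<- //|/(@olt_addl _ _ (dpow2 n)) /(olt_trans h)].
Qed.

Lemma dpow2D m n : dpow2 (m + n) = dpow2 m * dpow2 n.
Proof.
apply: (ind (P := fun n => dpow2 (m + n) = dpow2 m * dpow2 n)) n => [||n IH].
- by dfn; [apply: Def_pow2|apply: Def_pow2]; dfn.
- by rewrite dpow20 addr0 mulr1.
- by rewrite addrA !dpow2S IH mulrDr.
Qed.

Definition dtri n : N := recS (fun n r => (r : N) + (n : N) + 1) (0 : N) n.

Lemma Def_tri Γ (f : env M Γ -> N) : Def f -> Def (fun ρ => dtri (f ρ)).
Proof. by move=> ?; rewrite /dtri; dfn. Qed.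

Lemma dtri0 : dtri 0 = 0. Proof. exact: recS0. Qed.
Lemma dtriS n : dtri (n + 1) = dtri n + n + 1.
Proof. by rewrite /dtri [LHS]recSS //; dfn. Qed.

Lemma eval_tri Γ (s : tm Γ tN) (ρ : env M Γ) : eval ρ (tri s) = dtri (eval ρ s).
Proof. exact: eval_rec. Qed.

Definition ddist a b : N := (dsub a b : N) + (dsub b a : N).

Lemma eval_tdist Γ (s t : tm Γ tN) (ρ : env M Γ) :
  eval ρ (tdist s t) = ddist (eval ρ s) (eval ρ t).
Proof. by rewrite eval_oplus !eval_tsub. Qed.

Lemma ddist_eq0 a b : ddist a b = 0 <-> a = b.
Proof.
rewrite /ddist; split=> [e|->]; last first.
  by have /dsub_eq0 -> := (@olt_irr _ b); rewrite addr0.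
have [l|[//|l]] := olt_total a b; have [d d0 dE] := olt_sub l; exfalso.
  move: e; rewrite dE -[oadd a d]/(a + d) [a + d]addrC.
  have -> : dsub (d + a) a = d by apply: daddK.
  have -> : dsub a (d + a) = (0 : N) by apply: dsub_add.
  by rewrite add0r => e; rewrite e in d0; apply: (olt_irr d0).
move: e; rewrite dE -[oadd b d]/(b + d) [b + d]addrC.
have -> : dsub (d + b) b = d by apply: daddK.
have -> : dsub b (d + b) = (0 : N) by apply: dsub_add.
by rewrite addr0 => e; rewrite e in d0; apply: (olt_irr d0).
Qed.

Lemma eval_tif0 Γ (a b c : tm Γ tN) (ρ : env M Γ) :
  eval ρ (tif0 a b c) = dif0 (eval ρ a) (eval ρ b) (eval ρ c).
Proof.
rewrite /tif0 /lam eval_rec /dif0; congr recS.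
by apply: funext => k; apply: funext => r; rewrite eval_lift.
Qed.

Definition ddiag n : N := recS (fun (n r : N) =>
  dif0 (ddist (n + 1) (dtri (r + 1))) (r + 1) r) (0 : N) n.

Lemma Def_dist Γ (f g : env M Γ -> N) : Def f -> Def g -> Def (fun ρ => ddist (f ρ) (g ρ)).
Proof. by move=> ? ?; rewrite /ddist; dfn. Qed.

Ltac dfn_coding ::= lazymatch goal with
  | |- Def (fun _ => ddist _ _) => apply Def_dist
  | |- Def (fun _ => dtri _) => apply Def_tri
  | |- Def (fun _ => dpow2 _) => apply Def_pow2
  end.

Lemma Def_diag Γ (f : env M Γ -> N) : Def f -> Def (fun ρ => ddiag (f ρ)).
Proof. by move=> ?; rewrite /ddiag; dfn. Qed.

Lemma ddiagS n : ddiag (n + 1)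
  = dif0 (ddist (n + 1) (dtri (ddiag n + 1))) (ddiag n + 1) (ddiag n).
Proof. by rewrite /ddiag [LHS]recSS //; dfn. Qed.

Lemma eval_diag Γ (s : tm Γ tN) (ρ : env M Γ) : eval ρ (diag s) = ddiag (eval ρ s).
Proof.
rewrite /diag /lam eval_rec /ddiag; congr recS.
apply: funext => k; apply: funext => r.
by rewrite eval_tif0 eval_tdist eval_tri.
Qed.

(** The recursion raises the diagonal exactly when s + 1 reaches the next triangular number, and
    this keeps s between consecutive ones. *)
Lemma ddiagP s : (dtri (ddiag s) = s \/ olt (dtri (ddiag s)) s) /\ olt s (dtri (ddiag s + 1)).
Proof.
apply: (ind (P := fun s => (dtri (ddiag s) = s \/ olt (dtri (ddiag s)) s)
   /\ olt s (dtri (ddiag s + 1)))) s => [||s [h1 h2]].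
- by dfn; apply: Def_diag; dfn.
- have -> : ddiag 0 = 0 by apply: recS0.
  by rewrite dtriS dtri0; split; [left|exact: olt0S].
- rewrite ddiagS; set w := ddiag s in h1 h2 *.
  have [e|e] := pselect (s + 1 = dtri (w + 1)).
    rewrite (ddist_eq0 _ _).2 // dif00 -e; split; first by left.
    by rewrite dtriS -e -addrA; have := olt_addl (s + 1) (olt0S (w + 1)); rewrite addr0.
  rewrite dif0S; last by move/ddist_eq0.
  split; first by right; apply/olt_S.
  have [//|[//|l]] := olt_total (s + 1) (dtri (w + 1)).
  by move: l => /olt_S [l|/(olt_trans h2) /olt_irr //]; rewrite l in h2; case: (olt_irr h2).
Qed.

Lemma dtri_mono a b : olt a b -> dtri (a + 1) = dtri b \/ olt (dtri (a + 1)) (dtri b).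
Proof.
apply: (ind (P := fun b => olt a b -> dtri (a + 1) = dtri b \/ olt (dtri (a + 1)) (dtri b))) b.
- by dfn.
- by move=> /olt_n0.
- move=> b IH /olt_S [->|/IH h]; first by left.
  have l : olt (dtri b) (dtri (b + 1)).
    by rewrite (dtriS b) -addrA; have := olt_addl (dtri b) (olt0S b); rewrite addr0.
  by right; case: h => [->|/olt_trans] //; apply.
Qed.

Lemma ddiag_unique w s :
  (dtri w = s \/ olt (dtri w) s) -> olt s (dtri (w + 1)) -> ddiag s = w.
Proof.
have [h1 h2] := ddiagP s => h3 h4.
have le_lt a b c : a = b \/ olt a b -> olt b c -> olt a c by move=> [->//|/olt_trans]; apply.
have [/dtri_mono l|[//|/dtri_mono l]] := olt_total (ddiag s) w.
  by have := le_lt _ _ _ h3 h2; move/(le_lt _ _ _ l)/olt_irr.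
by have := le_lt _ _ _ h1 h4; move/(le_lt _ _ _ l)/olt_irr.
Qed.

Definition dpair a b : N := dtri (a + b) + b.
Definition dsnd s : N := dsub s (dtri (ddiag s)).
Definition dfst s : N := dsub (ddiag s) (dsnd s).

Lemma ddiag_pair a b : ddiag (dpair a b) = a + b.
Proof.
apply: ddiag_unique; rewrite /dpair.
  case: (ole0 b) => [<-|]; first by left; rewrite !addr0.
  by move/(olt_addl (dtri (a + b))); rewrite addr0; right.
rewrite dtriS -!addrA; apply: olt_addl; rewrite addrA; apply/olt_S.
case: (ole0 a) => [<-|a0]; first by left; rewrite add0r.
by right; have := olt_add b a0; rewrite -[oadd 0 b]/(0 + b) add0r.
Qed.

Lemma dpairK2 a b : dsnd (dpair a b) = b.
Proof. by rewrite /dsnd ddiag_pair /dpair addrC; apply: daddK. Qed.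

Lemma dpairK1 a b : dfst (dpair a b) = a.
Proof. by rewrite /dfst dpairK2 ddiag_pair; apply: daddK. Qed.

Lemma Def_pair Γ (f g : env M Γ -> N) : Def f -> Def g -> Def (fun ρ => dpair (f ρ) (g ρ)).
Proof. by move=> ? ?; rewrite /dpair; dfn. Qed.

Lemma Def_snd Γ (f : env M Γ -> N) : Def f -> Def (fun ρ => dsnd (f ρ)).
Proof. by move=> ?; rewrite /dsnd; dfn; apply: Def_diag. Qed.

Lemma Def_fst Γ (f : env M Γ -> N) : Def f -> Def (fun ρ => dfst (f ρ)).
Proof. by move=> ?; rewrite /dfst; dfn; [apply: Def_diag|apply: Def_snd]. Qed.

Lemma eval_tpair Γ (s t : tm Γ tN) (ρ : env M Γ) :
  eval ρ (tpair s t) = dpair (eval ρ s) (eval ρ t).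
Proof. by rewrite /tpair eval_oplus eval_tri. Qed.

Lemma eval_tsnd Γ (s : tm Γ tN) (ρ : env M Γ) : eval ρ (tsnd s) = dsnd (eval ρ s).
Proof. by rewrite /tsnd eval_tsub eval_tri eval_diag. Qed.

Lemma eval_tfst Γ (s : tm Γ tN) (ρ : env M Γ) : eval ρ (tfst s) = dfst (eval ρ s).
Proof. by rewrite /tfst eval_tsub eval_diag eval_tsnd. Qed.
End Coding.

Ltac dfn_coding ::= lazymatch goal with
  | |- Def (fun _ => ddist _ _) => apply Def_dist
  | |- Def (fun _ => dtri _) => apply Def_tri
  | |- Def (fun _ => dpow2 _) => apply Def_pow2
  | |- Def (fun _ => dpair _ _) => apply Def_pair
  | |- Def (fun _ => dfst _) => apply Def_fst
  | |- Def (fun _ => dsnd _) => apply Def_snd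
  end.

(** * Real numbers in a model *)

Record completion (M : model) := Completion {
  cfield :> realFieldType;
  cι : ocar (semiring_of M) -> cfield;
  cιF : fraction_field cι;
  carch : forall e : cfield, 0 < e -> exists2 n, olt 0 n & 1 < cι n * e;
  ccomplete : forall x : ocar (semiring_of M) -> cfield,
    (forall n, exists a b c, olt 0 c /\ x n = (cι a - cι b) / cι c) ->
    (forall e, 0 < e -> exists n, forall m, n = m \/ olt n m -> `|x m - x n| < e) ->
    exists l, forall e, 0 < e -> exists n, forall m, n = m \/ olt n m -> `|l - x m| < e
}.

Section RealNumbers.
Variables (M : model) (K : completion M).
Local Notation N := (ocar (semiring_of M)).
Implicit Types Γ : ctx.
Implicit Types a b c n m k i : N.
Local Notation ι := (@cι M K).

Lemma ι0 : ι 0 = 0. Proof. exact: (fr_0 (cιF K)). Qed.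
Lemma ι1 : ι 1 = 1. Proof. exact: (fr_1 (cιF K)). Qed.
Lemma ιD a b : ι (a + b) = ι a + ι b. Proof. exact: (fr_D (cιF K) a b). Qed.
Lemma ιM a b : ι (a * b) = ι a * ι b. Proof. exact: (fr_M (cιF K) a b). Qed.
Lemma ι_lt a b : olt a b <-> ι a < ι b.
Proof.
split=> [|l]; first exact: (fr_L (cιF K)).
have [//|[e|/(fr_L (cιF K)) l']] := olt_total a b; first by rewrite e ltxx in l.
by have := lt_trans l l'; rewrite ltxx.
Qed.
Lemma ι_ge0 a : 0 <= ι a.
Proof. by case: (ole0 a) => [<-|/ι_lt]; rewrite ι0 // => /ltW. Qed.
(** This is 2^(-n), the precision of the n-th approximation of a name. *)
Definition h n : K := (ι (dpow2 n))^-1.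

Lemma h_gt0 n : 0 < h n.
Proof. by rewrite invr_gt0 -ι0; apply/ι_lt/dpow2_gt0. Qed.
Lemma h0 : h 0 = 1. Proof. by rewrite /h dpow20 ι1 invr1. Qed.
Lemma hD m n : h (m + n) = h m * h n.
Proof. by rewrite /h dpow2D ιM invfM. Qed.
Lemma hS n : h (n + 1) = h n / 2.
Proof.
rewrite hD; congr (_ * _); have := dpow2S (0 : N); rewrite add0r dpow20 => e.
by rewrite /h e ιD ι1.
Qed.
Lemma h_le1 n : h n <= 1.
Proof.
have p : 0 < ι (dpow2 n) by rewrite -ι0; apply/ι_lt/dpow2_gt0.
rewrite /h invf_le1 //; case: (oge1 (dpow2_gt0 n)) => [<-|/ι_lt/ltW].
  by rewrite [X in _ <= X]ι1.
by rewrite [X in X <= _ -> _]ι1.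
Qed.
Lemma h_le m n : h (m + n) <= h m.
Proof. by rewrite hD ler_piMr ?h_le1 // ltW ?h_gt0. Qed.
Lemma h_small (e : K) : 0 < e -> exists n, h n < e.
Proof.
move=> e0; have [n n0 ne] := carch e0; exists n.
have pn : 0 < ι (dpow2 n) by rewrite -ι0; apply/ι_lt/dpow2_gt0.
rewrite /h -[_^-1]mulr1 mulrC ltr_pdivrMr // mulrC; apply: lt_trans ne _.
by rewrite ltr_pM2r //; apply/ι_lt/olt_dpow2.
Qed.
Lemma ι_h n : ι (dpow2 n) * h n = 1.
Proof. by rewrite /h mulfV // gt_eqF // -ι0; apply/ι_lt/dpow2_gt0. Qed.

Definition qp (q : N) : N := dfst (dfst q).
Definition qn (q : N) : N := dsnd (dfst q).
Definition qd (q : N) : N := dsnd q + 1.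
Definition dmkQ a b c : N := dpair (dpair a b) c.
Definition qv (q : N) : K := (ι (qp q) - ι (qn q)) / ι (qd q).

Lemma qd_gt0 q : 0 < ι (qd q). Proof. by rewrite -ι0; apply/ι_lt/olt0S. Qed.
Lemma qd_neq0 q : ι (qd q) != 0. Proof. by rewrite gt_eqF ?qd_gt0. Qed.

Lemma qp_mk a b c : qp (dmkQ a b c) = a. Proof. by rewrite /qp /dmkQ !dpairK1. Qed.
Lemma qn_mk a b c : qn (dmkQ a b c) = b. Proof. by rewrite /qn /dmkQ dpairK1 dpairK2. Qed.
Lemma qd_mk a b c : qd (dmkQ a b c) = c + 1. Proof. by rewrite /qd /dmkQ dpairK2. Qed.
Lemma qv_mk a b c : qv (dmkQ a b c) = (ι a - ι b) / ι (c + 1).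
Proof. by rewrite /qv qp_mk qn_mk qd_mk. Qed.

Definition dqadd (p q : N) : N :=
  dmkQ (qp p * qd q + qp q * qd p) (qn p * qd q + qn q * qd p)
       (dpred (qd p * qd q)).
Definition dqopp (q : N) : N := dmkQ (qn q) (qp q) (dsnd q).
Definition dqsub (p q : N) : N := dqadd p (dqopp q).
Definition dqabs (q : N) : N := dmkQ (ddist (qp q) (qn q)) 0 (dsnd q).
Definition dqpow2 n : N := dmkQ 1 0 (dpred (dpow2 n)).
Definition dqlt (p q : N) : Prop :=
  olt (qp p * qd q + qn q * qd p) (qp q * qd p + qn p * qd q).

Lemma dpredK (n : N) : olt 0 n -> (dpred n : N) + 1 = n.
Proof.
case: (n_cases n) => [->/olt_irr//|[m ->] _].
by have -> : dpred (m + 1) = m by apply: dpredS.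
Qed.

Lemma qv_add p q : qv (dqadd p q) = qv p + qv q.
Proof.
rewrite qv_mk dpredK; last by apply: olt0_mul; apply: olt0S.
rewrite (ιD (qp p * _)) (ιD (qn p * _)) !ιM /qv.
by field; rewrite !qd_neq0.
Qed.

Lemma qv_opp q : qv (dqopp q) = - qv q.
Proof. by rewrite qv_mk -/(qd q) /qv -mulNr opprB. Qed.

Lemma qv_sub p q : qv (dqsub p q) = qv p - qv q.
Proof. by rewrite qv_add qv_opp. Qed.

Lemma ι_dist a b : ι (ddist a b) = `|ι a - ι b|.
Proof.
wlog [d ->] : a b / exists d, a = d + b.
  move=> H; have [[d e]|[d e]] := ncompare a b; first by apply: H; exists d.
  by rewrite distrC -H; [rewrite /ddist addrC|exists d].
rewrite /ddist (_ : dsub (d + b) b = d); last exact: daddK.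
rewrite (_ : dsub b (d + b) = (0 : N)); last exact: dsub_add.
by rewrite addr0 ιD addrK ger0_norm ?ι_ge0.
Qed.

Lemma qv_abs q : qv (dqabs q) = `|qv q|.
Proof.
rewrite qv_mk -/(qd q) ι0 subr0 ι_dist /qv normrM normfV.
by rewrite [`|ι (qd q)|]ger0_norm // ltW ?qd_gt0.
Qed.

Lemma qv_pow2 n : qv (dqpow2 n) = h n.
Proof. by rewrite qv_mk dpredK ?ι1 ?ι0 ?subr0 ?div1r //; apply: dpow2_gt0. Qed.

Lemma dqltP p q : dqlt p q <-> qv p < qv q.
Proof.
rewrite /dqlt /qv ltr_pdivrMr ?qd_gt0 // mulrAC ltr_pdivlMr ?qd_gt0 // ι_lt.
rewrite (ιD (qp p * _)) (ιD (qp q * _)) !ιM.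
by split=> l; rewrite !mulrBl in l *; lra.
Qed.

Lemma eval_mkQ Γ (a b c : tm Γ tN) (ρ : env M Γ) :
  eval ρ (mkQ a b c) = dmkQ (eval ρ a) (eval ρ b) (eval ρ c).
Proof. by rewrite /mkQ !eval_tpair. Qed.

Lemma eval_qpos Γ (q : tm Γ tN) (ρ : env M Γ) : eval ρ (qpos q) = qp (eval ρ q).
Proof. by rewrite /qpos !eval_tfst. Qed.
Lemma eval_qneg Γ (q : tm Γ tN) (ρ : env M Γ) : eval ρ (qneg q) = qn (eval ρ q).
Proof. by rewrite /qneg eval_tsnd eval_tfst. Qed.
Lemma eval_qden Γ (q : tm Γ tN) (ρ : env M Γ) : eval ρ (qden q) = qd (eval ρ q).
Proof. by rewrite /qden eval_oplus eval_tsnd. Qed.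

Lemma eval_qadd Γ (p q : tm Γ tN) (ρ : env M Γ) :
  eval ρ (qadd p q) = dqadd (eval ρ p) (eval ρ q).
Proof.
by rewrite /qadd eval_mkQ !eval_oplus eval_tpred !eval_otimes !eval_qpos !eval_qneg !eval_qden.
Qed.
Lemma eval_qopp Γ (q : tm Γ tN) (ρ : env M Γ) : eval ρ (qopp q) = dqopp (eval ρ q).
Proof. by rewrite /qopp eval_mkQ eval_qneg eval_qpos eval_tsnd. Qed.
Lemma eval_qsub Γ (p q : tm Γ tN) (ρ : env M Γ) :
  eval ρ (qsub p q) = dqsub (eval ρ p) (eval ρ q).
Proof. by rewrite /qsub eval_qadd eval_qopp. Qed.
Lemma eval_qabs Γ (q : tm Γ tN) (ρ : env M Γ) : eval ρ (qabs q) = dqabs (eval ρ q).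
Proof. by rewrite /qabs eval_mkQ eval_tdist eval_qneg eval_qpos eval_tsnd eval_zero. Qed.
Lemma eval_qpow2 Γ (n : tm Γ tN) (ρ : env M Γ) : eval ρ (qpow2 n) = dqpow2 (eval ρ n).
Proof. by rewrite /qpow2 eval_mkQ eval_tpred eval_pow2. Qed.
Lemma eval_qzero Γ (ρ : env M Γ) : eval ρ qzero = dmkQ 0 0 0.
Proof. by rewrite /qzero eval_mkQ. Qed.
Lemma eval_qone Γ (ρ : env M Γ) : eval ρ qone = dmkQ 1 0 0.
Proof. by rewrite /qone eval_mkQ. Qed.

Lemma sat_qlt Γ (p q : tm Γ tN) (ρ : env M Γ) :
  sat (qlt p q) ρ <-> qv (eval ρ p) < qv (eval ρ q).
Proof.
rewrite -dqltP -[sat _ _]/(olt (eval ρ (_ ⊕ _) : N) (eval ρ (_ ⊕ _))).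
by rewrite !eval_oplus !eval_otimes !eval_qpos !eval_qneg !eval_qden.
Qed.

Lemma sat_qle Γ (p q : tm Γ tN) (ρ : env M Γ) :
  sat (qle p q) ρ <-> qv (eval ρ p) <= qv (eval ρ q).
Proof.
rewrite leNgt; split=> [|/negP].
  rewrite -[sat _ _]/(olt (eval ρ (_ ⊕ _) : N) (eval ρ (_ ⊕ _)) \/
    (eval ρ (_ ⊕ _) : N) = (eval ρ (_ ⊕ _))).
  rewrite !eval_oplus !eval_otimes !eval_qpos !eval_qneg !eval_qden => l.
  apply/negP; rewrite -dqltP /dqlt; case: l => [/olt_trans l /l /olt_irr //|->].
  exact: olt_irr.
rewrite -dqltP /dqlt => l.
rewrite -[sat _ _]/(olt (eval ρ (_ ⊕ _) : N) (eval ρ (_ ⊕ _)) \/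
    (eval ρ (_ ⊕ _) : N) = (eval ρ (_ ⊕ _))).
rewrite !eval_oplus !eval_otimes !eval_qpos !eval_qneg !eval_qden.
by case: (@olt_total (semiring_of M) (qp (eval ρ p) * qd (eval ρ q) + qn (eval ρ q) * qd (eval ρ p))
  (qp (eval ρ q) * qd (eval ρ p) + qn (eval ρ p) * qd (eval ρ q))) => [|[|/l]]; [left|right|].
Qed.

Lemma Def_qadd Γ (f g : env M Γ -> N) : Def f -> Def g -> Def (fun ρ => dqadd (f ρ) (g ρ)).
Proof. by move=> ? ?; rewrite /dqadd /dmkQ /qp /qn /qd; dfn. Qed.
Lemma Def_qopp Γ (f : env M Γ -> N) : Def f -> Def (fun ρ => dqopp (f ρ)).
Proof. by move=> ?; rewrite /dqopp /dmkQ /qp /qn /qd; dfn. Qed.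
Lemma Def_qabs Γ (f : env M Γ -> N) : Def f -> Def (fun ρ => dqabs (f ρ)).
Proof. by move=> ?; rewrite /dqabs /dmkQ /qp /qn /qd; dfn. Qed.
Lemma Def_qpow2 Γ (f : env M Γ -> N) : Def f -> Def (fun ρ => dqpow2 (f ρ)).
Proof. by move=> ?; rewrite /dqpow2 /dmkQ; dfn. Qed.
Lemma Def_mkQ Γ (f g k : env M Γ -> N) :
  Def f -> Def g -> Def k -> Def (fun ρ => dmkQ (f ρ) (g ρ) (k ρ)).
Proof. by move=> ? ? ?; rewrite /dmkQ; dfn. Qed.

Ltac dfn_rat ::= lazymatch goal with
  | |- Def (fun _ => dmkQ _ _ _) => apply Def_mkQ
  | |- Def (fun _ => dqadd _ _) => apply Def_qadd
  | |- Def (fun _ => dqopp _) => apply Def_qopp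
  | |- Def (fun _ => dqabs _) => apply Def_qabs
  | |- Def (fun _ => dqpow2 _) => apply Def_qpow2
  end.

Opaque dqadd dqopp dqabs dqpow2 dmkQ dpair dfst dsnd dtri dpow2.

Local Notation name := (dom M t1).
Implicit Types x y : name.

Definition xq x n : K := qv (x • n).

Definition isreal x := forall n i, `|xq x n - xq x (n + i)| < h n.

Lemma real_limit x : isreal x -> exists l, forall n, `|l - xq x n| <= h n.
Proof.
move=> rx; have [|e e0|l hl] := @ccomplete M K (xq x).
- by move=> n; exists (qp (x • n)), (qn (x • n)), (qd (x • n)); split=> //; apply: olt0S.
- have [n hn] := h_small e0; exists n => m [<-|/olt_sub [d _ ->]].
    by rewrite subrr normr0.
  by rewrite distrC; apply: lt_trans hn; apply: rx.
exists l => n; rewrite leNgt; apply/negP => l1.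
have e0 : 0 < `|l - xq x n| - h n by lra.
have [m hm] := hl _ e0.
have [j nj mj] : exists2 j, (n = j \/ olt n j) & (m = j \/ olt m j).
  have [l'|[<-|l']] := olt_total n m; [exists m|exists n|exists n]; by auto.
have : `|xq x n - xq x j| < h n.
  by case: nj => [<-|/olt_sub [d _ ->]]; [rewrite subrr normr0 h_gt0|apply: rx].
have := hm _ mj; have := ler_distD (xq x j) l (xq x n); rewrite [`|xq x j - _|]distrC.
lra.
Qed.

Definition V x : K := if pselect (isreal x) is left r then projT1 (cid (real_limit r)) else 0.

Lemma V_near x n : isreal x -> `|V x - xq x n| <= h n.
Proof. by rewrite /V; case: pselect => // r _; case: (cid _) => l /=. Qed.

(** The factor [C] and the shift [m] absorb the changes of index and precision in the operations on
    names. *)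
Lemma V_unique x l (C : K) : isreal x ->
  (forall n, exists m, `|l - xq x (n + m)| <= C * h n) -> V x = l.
Proof.
move=> rx hl; apply/eqP; rewrite -subr_eq0 -normr_le0 leNgt; apply/negP => d0.
have C0 : 0 < `|C| + 1 by rewrite ltr_wpDl.
have [n hn] := h_small (divr_gt0 d0 C0); rewrite ltr_pdivlMr // in hn.
have [m hm] := hl n; have v := V_near (n + m) rx; have hh := h_le n m; have p := h_gt0 n.
have := ler_distD (xq x (n + m)) (V x) l; rewrite [`|xq x _ - l|]distrC.
have : C * h n <= `|C| * h n by rewrite ler_pM2r // ler_norm.
lra.
Qed.

Definition dlt x y := exists n : N, xq x n + (h n + h n) < xq y n.

Lemma dltP x y : isreal x -> isreal y -> dlt x y <-> V x < V y.
Proof.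
move=> rx ry; split=> [[n l]|l].
  have := V_near n rx; have := V_near n ry; rewrite !ler_distl => /andP[? ?] /andP[? ?].
  by lra.
have d0 : 0 < (V y - V x) / 4 by lra.
have [n hn] := h_small d0; exists n.
have := V_near n rx; have := V_near n ry; rewrite !ler_distl => /andP[? ?] /andP[? ?].
by lra.
Qed.

Lemma dreqP x y : isreal x -> isreal y ->
  (forall n, `|xq x n - xq y n| <= h n + h n) <-> V x = V y.
Proof.
move=> rx ry; split=> [e|e n].
  apply: (@V_unique x _ 3) => // n; exists 0; rewrite addr0.
  have := V_near n ry; have := e n; rewrite !ler_distl => /andP[? ?] /andP[? ?].
  by apply/andP; split; lra.
have := V_near n rx; have := V_near n ry; rewrite e !ler_distl => /andP[? ?] /andP[? ?].
by apply/andP; split; lra.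
Qed.

Definition dconst (q : N) : name := LAM (fun _ => q).
Lemma dconstE q n : dconst q • n = q.
Proof. by rewrite LAME //; dfn. Qed.

Lemma dconst_real q : isreal (dconst q).
Proof. by move=> n i; rewrite /xq !dconstE subrr normr0 h_gt0. Qed.

Lemma V_const q : V (dconst q) = qv q.
Proof.
apply: (@V_unique _ _ 0); first exact: dconst_real.
by move=> n; exists 0; rewrite /xq dconstE subrr normr0 mul0r.
Qed.

Definition dradd x y : name := LAM (fun n : N => dqadd (x • (n + 1)) (y • (n + 1))).
Lemma xq_add x y n : xq (dradd x y) n = xq x (n + 1) + xq y (n + 1).
Proof. by rewrite /xq LAME ?qv_add //; dfn. Qed.

Lemma dradd_real x y : isreal x -> isreal y -> isreal (dradd x y).
Proof.
move=> rx ry n i; rewrite !xq_add [n + i + 1]addrAC.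
have := rx (n + 1) i; have := ry (n + 1) i; rewrite hS !ltr_distlC => /andP[? ?] /andP[? ?].
by apply/andP; split; lra.
Qed.

Lemma V_add x y : isreal x -> isreal y -> V (dradd x y) = V x + V y.
Proof.
move=> rx ry; apply: (@V_unique _ _ 2); first exact: dradd_real.
move=> n; exists 0; rewrite addr0 xq_add.
have := V_near (n + 1) rx; have := V_near (n + 1) ry; have := h_gt0 n.
rewrite hS !ler_distl => ? /andP[? ?] /andP[? ?].
by apply/andP; split; lra.
Qed.

Definition dropp x : name := LAM (fun n : N => dqopp (x • n)).
Lemma xq_opp x n : xq (dropp x) n = - xq x n.
Proof. by rewrite /xq LAME ?qv_opp //; dfn. Qed.

Lemma dropp_real x : isreal x -> isreal (dropp x).
Proof. by move=> rx n i; rewrite !xq_opp -opprD normrN. Qed.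

Lemma V_opp x : isreal x -> V (dropp x) = - V x.
Proof.
move=> rx; apply: (@V_unique _ _ 1); first exact: dropp_real.
by move=> n; exists 0; rewrite addr0 xq_opp -opprD normrN mul1r V_near.
Qed.

Definition drabs x : name := LAM (fun n : N => dqabs (x • n)).
Lemma xq_abs x n : xq (drabs x) n = `|xq x n|.
Proof. by rewrite /xq LAME ?qv_abs //; dfn. Qed.

Lemma drabs_real x : isreal x -> isreal (drabs x).
Proof. by move=> rx n i; rewrite !xq_abs; apply: le_lt_trans (ler_dist_dist _ _) (rx _ _). Qed.

Lemma V_abs x : isreal x -> V (drabs x) = `|V x|.
Proof.
move=> rx; apply: (@V_unique _ _ 1); first exact: drabs_real.
move=> n; exists 0; rewrite addr0 xq_abs mul1r.
exact: le_trans (ler_dist_dist _ _) (V_near _ rx).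
Qed.

Lemma DefP_qlt Γ (f g : env M Γ -> N) : Def f -> Def g -> DefP (fun ρ => qv (f ρ) < qv (g ρ)).
Proof.
move=> df dg; apply: (@DefP_ext _ _ (fun ρ => dqlt (f ρ) (g ρ))) => [ρ|].
  exact: dqltP.
by rewrite /dqlt /qp /qn /qd; dfn.
Qed.

Lemma DefP_qle Γ (f g : env M Γ -> N) : Def f -> Def g -> DefP (fun ρ => qv (f ρ) <= qv (g ρ)).
Proof.
move=> df dg; apply: DefP_ext (DefP_not (DefP_qlt dg df)) => ρ.
by rewrite leNgt; split=> /negP.
Qed.

Definition dsumq (z : dom M (tN ~> t1)) (m n : N) : N :=
  recS (fun (k s : N) => dqadd s (z • k • m)) (dmkQ 0 0 0) n.
Definition drsum (z : dom M (tN ~> t1)) n : name :=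
  LAM (fun m : N => dsumq z (m + n) n).

Lemma qv0 : qv (dmkQ 0 0 0) = 0.
Proof. by rewrite qv_mk subrr mul0r. Qed.

Lemma dsumqS z m n : qv (dsumq z m (n + 1)) = qv (dsumq z m n) + qv (z • n • m).
Proof. by rewrite /dsumq recSS ?qv_add //; dfn. Qed.

Lemma dsumq0 z m : qv (dsumq z m 0) = 0.
Proof. by rewrite /dsumq [recS _ _ _]recS0 qv0. Qed.

Lemma Def_sumq Γ (z : env M Γ -> dom M (tN ~> t1)) (m n : env M Γ -> N) :
  Def z -> Def m -> Def n -> Def (fun ρ => dsumq (z ρ) (m ρ) (n ρ)).
Proof.
by move=> dz dm dn; rewrite /dsumq; dfn.
Qed.

Ltac dfn_sum ::= lazymatch goal with
  | |- Def (fun _ => dsumq _ _ _) => apply Def_sumq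
  end.

Lemma dsumq_dist z m i n : (forall k, isreal (z • k)) ->
  `|qv (dsumq z m n) - qv (dsumq z (m + i) n)| <= ι n * h m.
Proof.
move=> rz; apply: (ind (P := fun n =>
  `|qv (dsumq z m n) - qv (dsumq z (m + i) n)| <= ι n * h m)) n => [||n IH].
(* For the induction to be legitimate, both sides are written as values of rational codes; n 2^(-m)
   has the numerator n and the denominator 2^m. *)
- apply: (@DefP_ext _ _ (fun q =>
    qv (dqabs (dqsub (dsumq z m (q _ vz)) (dsumq z (m + i) (q _ vz))))
    <= qv (dmkQ (q _ vz) 0 (dpred (dpow2 m))))) => [ρ|].
    by rewrite qv_abs qv_sub qv_mk ι0 subr0 dpredK //; apply: dpow2_gt0.
  by apply: DefP_qle; rewrite /dqsub; dfn.
- by rewrite !dsumq0 subrr normr0 ι0 mul0r.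
- rewrite !dsumqS ιD ι1 mulrDl mul1r opprD addrACA.
  apply: le_trans (ler_normD _ _) _; apply: lerD => //.
  by apply: ltW; apply: rz.
Qed.

Lemma xq_sum z n m : xq (drsum z n) m = qv (dsumq z (m + n) n).
Proof. by rewrite /xq LAME //; dfn. Qed.

Lemma drsum_real z n : (forall k, isreal (z • k)) -> isreal (drsum z n).
Proof.
move=> rz m i; rewrite !xq_sum [m + i + n]addrAC.
apply: le_lt_trans (dsumq_dist _ _ _ rz) _.
rewrite addrC hD mulrA -[X in _ < X]mul1r ltr_pM2r ?h_gt0 // -(ι_h n) ltr_pM2r ?h_gt0 //.
exact/ι_lt/olt_dpow2.
Qed.

Lemma V_sum0 z : (forall k, isreal (z • k)) -> V (drsum z 0) = 0.
Proof.
move=> rz; apply: (@V_unique _ _ 0); first exact: drsum_real.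
by move=> n; exists 0; rewrite xq_sum dsumq0 subrr normr0 mul0r.
Qed.

Lemma V_sumS z n : (forall k, isreal (z • k)) ->
  V (drsum z (n + 1)) = V (drsum z n) + V (z • n).
Proof.
move=> rz; apply: (@V_unique _ _ 2); first exact: drsum_real.
move=> m; exists 0; rewrite addr0 xq_sum dsumqS.
have := V_near (m + 1) (drsum_real n rz); rewrite xq_sum.
rewrite -[m + 1 + n]addrA [1 + n]addrC => d1.
have := V_near (m + (n + 1)) (rz n); have := h_le m 1; have := h_le m (n + 1).
move: d1; rewrite /xq !ler_distl => /andP[? ?] ? ? /andP[? ?].
by apply/andP; split; lra.
Qed.

(** K lies outside of M, so definability of a K-valued function means that an element of M names its
    values uniformly. Comparisons of such functions are definable predicates. *)
Definition DefR Γ (f : env M Γ -> K) :=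
  exists2 c : env M Γ -> name, Def c & forall ρ, isreal (c ρ) /\ V (c ρ) = f ρ.

Definition DefR1 A (f : dom M A -> K) := DefR (fun q : env M [:: A] => f (q A vz)).
Definition DefR2 A B (f : dom M A -> dom M B -> K) :=
  DefR (fun q : env M [:: B; A] => f (q A (vs vz)) (q B vz)).

(** K is built from arbitrary families over the numbers of M and may have elements without a name in
    M. *)
Definition named (r : K) := exists2 x, isreal x & V x = r.

Lemma DefR_V Γ (c : env M Γ -> name) :
  Def c -> (forall ρ, isreal (c ρ)) -> DefR (fun ρ => V (c ρ)).
Proof. by move=> dc rc; exists c. Qed.

Lemma DefR_qv Γ (c : env M Γ -> N) : Def c -> DefR (fun ρ => qv (c ρ)).
Proof.
move=> dc; exists (fun ρ => dconst (c ρ)).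
  by rewrite /dconst; dfn.
by move=> ρ; split; [exact: dconst_real|exact: V_const].
Qed.

Lemma DefR_named Γ r : named r -> DefR (fun _ : env M Γ => r).
Proof. by move=> [x rx xr]; exists (fun _ => x) => //; exact: Def_const. Qed.

Lemma named_V x : isreal x -> named (V x). Proof. by move=> rx; exists x. Qed.
Lemma named_qv q : named (qv q).
Proof. by exists (dconst q); [exact: dconst_real|exact: V_const]. Qed.
Lemma named0 : named 0. Proof. by rewrite -qv0; exact: named_qv. Qed.
Lemma namedD r s : named r -> named s -> named (r + s).
Proof.
by move=> [x rx <-] [y ry <-]; exists (dradd x y); [exact: dradd_real|exact: V_add].
Qed.
Lemma namedN r : named r -> named (- r).
Proof. by move=> [x rx <-]; exists (dropp x); [exact: dropp_real|exact: V_opp]. Qed.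
Lemma namedB r s : named r -> named s -> named (r - s).
Proof. by move=> nr /namedN; apply: namedD. Qed.

Definition dy m j : K := ι j * h m.

Lemma dy_qv m j : dy m j = qv (dmkQ j 0 (dpred (dpow2 m))).
Proof. by rewrite qv_mk ι0 subr0 dpredK //; apply: dpow2_gt0. Qed.

Lemma DefR_dy Γ (f g : env M Γ -> N) : Def f -> Def g -> DefR (fun ρ => dy (f ρ) (g ρ)).
Proof.
move=> df dg; have -> : (fun ρ => dy (f ρ) (g ρ)) = (fun ρ => qv (dmkQ (g ρ) 0 (dpred (dpow2 (f ρ))))).
  by apply: funext => ρ; rewrite dy_qv.
by apply: DefR_qv; dfn.
Qed.

Lemma named_dy m j : named (dy m j). Proof. by rewrite dy_qv; apply: named_qv. Qed.

Lemma DefR_h Γ (f : env M Γ -> N) : Def f -> DefR (fun ρ => h (f ρ)).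
Proof.
move=> df; have -> : (fun ρ => h (f ρ)) = (fun ρ => dy (f ρ) 1).
  by apply: funext => ρ; rewrite /dy ι1 mul1r.
by apply: DefR_dy => //; apply: Def_const.
Qed.

Lemma named_h n : named (h n).
Proof. by have := named_dy n 1; rewrite /dy ι1 mul1r. Qed.

Lemma DefR_add Γ (f g : env M Γ -> K) : DefR f -> DefR g -> DefR (fun ρ => f ρ + g ρ).
Proof.
move=> [c dc cP] [d dd dP]; exists (fun ρ => dradd (c ρ) (d ρ)).
  by rewrite /dradd; dfn.
move=> ρ; have [[rc <-] [rd <-]] := (cP ρ, dP ρ).
by split; [exact: dradd_real|exact: V_add].
Qed.

Lemma DefR_opp Γ (f : env M Γ -> K) : DefR f -> DefR (fun ρ => - f ρ).
Proof.
move=> [c dc cP]; exists (fun ρ => dropp (c ρ)).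
  by rewrite /dropp; dfn.
move=> ρ; have [rc <-] := cP ρ.
by split; [exact: dropp_real|exact: V_opp].
Qed.

(** Definition by cases is available for numbers and is lifted to sequences pointwise. *)
Lemma Def_ite1 Γ (P : env M Γ -> Prop) (f g : env M Γ -> name) :
  DefP P -> Def f -> Def g -> Def (fun ρ => if `[< P ρ >] then f ρ else g ρ).
Proof.
move=> dP df dg.
have -> : (fun ρ => if `[< P ρ >] then f ρ else g ρ)
    = (fun ρ => LAM (fun n : N => if `[< P ρ >] then f ρ • n else g ρ • n)).
  by apply: funext => ρ; apply: LAM_unique => n; case: ifP.
by dfn.
Qed.

Lemma DefR_ite Γ (P : env M Γ -> Prop) (f g : env M Γ -> K) :
  DefP P -> DefR f -> DefR g -> DefR (fun ρ => if `[< P ρ >] then f ρ else g ρ).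
Proof.
move=> dP [c dc cP] [d dd dP']; exists (fun ρ => if `[< P ρ >] then c ρ else d ρ).
  exact: Def_ite1.
by move=> ρ; case: ifP.
Qed.

Lemma DefP_dlt Γ (c d : env M Γ -> name) : Def c -> Def d -> DefP (fun ρ => dlt (c ρ) (d ρ)).
Proof.
move=> dc dd; pose P ρ (n : N) :=
  qv (dqadd (c ρ • n) (dqadd (dqpow2 n) (dqpow2 n))) < qv (d ρ • n).
have dP : DefP (fun ρ => exists n, P ρ n).
  by apply: DefP_ex; apply: DefP_qlt; dfn.
apply: DefP_ext dP => ρ; rewrite /P.
have e n : P ρ n <-> xq (c ρ) n + (h n + h n) < xq (d ρ) n.
  by rewrite /P qv_add qv_add qv_pow2.
by split=> -[n /e l]; exists n.
Qed.

Lemma DefP_ltR Γ (f g : env M Γ -> K) : DefR f -> DefR g -> DefP (fun ρ => f ρ < g ρ).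
Proof.
move=> [c dc cP] [d dd dP]; apply: DefP_ext (DefP_dlt dc dd) => ρ.
by have [[rc <-] [rd <-]] := (cP ρ, dP ρ); apply: dltP.
Qed.

Lemma DefP_leR Γ (f g : env M Γ -> K) : DefR f -> DefR g -> DefP (fun ρ => f ρ <= g ρ).
Proof.
move=> df dg; apply: DefP_ext (DefP_not (DefP_ltR dg df)) => ρ.
by rewrite leNgt; split=> /negP.
Qed.

Lemma DefP_eqR Γ (f g : env M Γ -> K) : DefR f -> DefR g -> DefP (fun ρ => f ρ = g ρ).
Proof.
move=> df dg; apply: DefP_ext (DefP_and (DefP_leR df dg) (DefP_leR dg df)) => ρ.
split=> [[? ?]|->]; last by rewrite lexx.
by apply/eqP; rewrite eq_le; apply/andP.
Qed.

Lemma DefR_comp1 Γ A (f : dom M A -> K) (g : env M Γ -> dom M A) :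
  DefR1 f -> Def g -> DefR (fun ρ => f (g ρ)).
Proof.
move=> [c dc cP] dg; exists (fun ρ => c (econs (g ρ) (enil M))); last first.
  by move=> ρ; apply: (cP (econs (g ρ) (enil M))).
have e (x : dom M A) : LAM (fun d => c (econs d (enil M))) • x = c (econs x (enil M)) by apply: LAM_env.
have -> : (fun ρ => c (econs (g ρ) (enil M))) = (fun ρ => LAM (fun d => c (econs d (enil M))) • g ρ).
  by apply: funext => ρ; rewrite e.
exact: Def_app (Def_const _ _) dg.
Qed.

Lemma DefR_comp2 Γ A B (f : dom M A -> dom M B -> K) (g : env M Γ -> dom M A)
    (k : env M Γ -> dom M B) :
  DefR2 f -> Def g -> Def k -> DefR (fun ρ => f (g ρ) (k ρ)).
Proof.
move=> [c dc cP] dg dk.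
pose c2 (x : dom M A) (y : dom M B) := c (econs y (econs x (enil M))).
have d2 : Def2 c2.
  rewrite /Def2 /c2; have := dc; congr Def; apply: funext => q; congr c.
  by apply: vfun_consE => //; apply: var_case => // C v; inversion v.
exists (fun ρ => c2 (g ρ) (k ρ)); first exact: Def_comp2.
by move=> ρ; apply: (cP (econs (k ρ) (econs (g ρ) (enil M)))).
Qed.

Lemma DefR1_name (a : N -> K) : DefR1 (A := tN) a ->
  exists z : dom M (tN ~> t1), forall k, isreal (z • k) /\ V (z • k) = a k.
Proof.
move=> [c dc cP]; exists (LAM (fun d => c (econs d (enil M)))) => k.
by rewrite LAM_env //; apply: (cP (econs k (enil M))).
Qed.

(** The number n of terms may be nonstandard, so the sum is formed inside M from a name of the
    sequence; sequences that are not definable get 0. By [Sum_unique] the choice of the name is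
    immaterial. *)
Definition Sum (a : N -> K) (n : N) : K :=
  if pselect (DefR1 (A := tN) a) is left d
  then V (drsum (projT1 (cid (DefR1_name d))) n) else 0.

Lemma Sum_name (a : N -> K) : DefR1 (A := tN) a -> exists z : dom M (tN ~> t1),
  [/\ forall k, isreal (z • k), forall k, V (z • k) = a k & forall n, Sum a n = V (drsum z n)].
Proof.
move=> d; rewrite /Sum; case: pselect => // d'; case: (cid _) => z /= zP.
by exists z; split=> // k; case: (zP k).
Qed.

Lemma Sum0 (a : N -> K) : DefR1 (A := tN) a -> Sum a 0 = 0.
Proof. by move=> /Sum_name [z [rz _ ->]]; apply: V_sum0. Qed.

Lemma SumS (a : N -> K) n : DefR1 (A := tN) a -> Sum a (n + 1) = Sum a n + a n.
Proof. by move=> /Sum_name [z [rz za E]]; rewrite !E V_sumS ?za. Qed.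

Lemma DefR_Sum Γ (a : N -> K) (f : env M Γ -> N) :
  DefR1 (A := tN) a -> Def f -> DefR (fun ρ => Sum a (f ρ)).
Proof.
move=> /Sum_name [z [rz za E]] df; exists (fun ρ => drsum z (f ρ)); last first.
  by move=> ρ; rewrite E; split=> //; apply: drsum_real.
by rewrite /drsum; dfn.
Qed.

Lemma named_Sum (a : N -> K) n : DefR1 (A := tN) a -> named (Sum a n).
Proof. by move=> /Sum_name [z [rz za E]]; exists (drsum z n); rewrite ?E //; apply: drsum_real. Qed.
End RealNumbers.

Ltac dfn_unfold ::= rewrite /Def1 /Def2 /DefP1 /DefP2 /DefR1 /DefR2.
Ltac dfn_rat ::= lazymatch goal with
  | |- Def (fun _ => dmkQ _ _ _) => apply Def_mkQ
  | |- Def (fun _ => dqadd _ _) => apply Def_qadd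
  | |- Def (fun _ => dqopp _) => apply Def_qopp
  | |- Def (fun _ => dqabs _) => apply Def_qabs
  | |- Def (fun _ => dqpow2 _) => apply Def_qpow2
  end.
Ltac dfn_sum ::= lazymatch goal with
  | |- Def (fun _ => dsumq _ _ _) => apply Def_sumq
  end.
Ltac dfn_real ::= lazymatch goal with
  | |- DefR (fun _ => ?r) => apply DefR_named
  | |- DefR (fun _ => qv _ _) => apply DefR_qv
  | |- DefR (fun _ => dy _ _ _) => apply DefR_dy
  | |- DefR (fun _ => h _ _) => apply DefR_h
  | |- DefR (fun _ => Sum _ _) => apply DefR_Sum
  | |- DefR (fun _ => (_ + _)%R) => apply DefR_add
  | |- DefR (fun _ => (- _)%R) => apply DefR_opp
  | |- DefR (fun _ => if asbool _ then _ else _) => apply DefR_ite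
  | |- DefP (fun _ => is_true (_ < _)%R) => apply DefP_ltR
  | |- DefP (fun _ => is_true (_ <= _)%R) => apply DefP_leR
  | |- DefP (fun _ => dlt _ _ _) => apply DefP_dlt
  | |- DefP (fun _ => @eq _ _ _) => apply DefP_eqR
  | |- named _ => first
      [ assumption
      | lazymatch goal with
        | |- named (dy _ _ _) => apply named_dy
        | |- named (h _ _) => apply named_h
        | |- named (qv _ _) => apply named_qv
        | |- named 0%R => apply named0
        | |- named (_ + _)%R => apply namedD
        | |- named (- _)%R => apply namedN
        | |- named (Sum _ _) => apply named_Sum
        | |- named (V _ _) => apply named_V
        end ]
  | H : DefR1 ?f |- DefR (fun _ => ?f _) => apply (DefR_comp1 H)
  | H : DefR2 ?f |- DefR (fun _ => ?f _ _) => apply (DefR_comp2 H)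
  end.

(** * Meaning of the formulas on reals and measures *)

Section Meaning.
Variables (M : model) (K : completion M).
Local Notation N := (ocar (semiring_of M)).
Local Notation name := (dom M t1).
Local Notation V := (V K).
Local Notation isreal := (isreal K).
Local Notation ev := (eval (M := M)).
Implicit Types Γ : ctx.

Lemma sat_is_real Γ (x : tm Γ t1) (ρ : env M Γ) : sat (is_real x) ρ <-> isreal (ev ρ x).
Proof.
split=> H n i; [have /(sat_qlt K) := H n i|apply/(sat_qlt K); move: (H n i)];
  rewrite eval_qabs eval_qsub eval_qpow2 qv_abs qv_sub qv_pow2 /=;
  by rewrite /lift !eval_tren.
Qed.

Lemma sat_rlt_raw Γ (x y : tm Γ t1) (ρ : env M Γ) :
  sat (rlt x y) ρ <-> dlt K (ev ρ x) (ev ρ y).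
Proof.
split=> -[n H]; exists n; [move: H => /(sat_qlt K)|apply/(sat_qlt K); move: H];
  rewrite !eval_qadd qv_add qv_add eval_qpow2 qv_pow2 /=;
  by rewrite /lift !eval_tren.
Qed.

Lemma sat_rlt Γ (x y : tm Γ t1) (ρ : env M Γ) :
  isreal (ev ρ x) -> isreal (ev ρ y) -> sat (rlt x y) ρ <-> V (ev ρ x) < V (ev ρ y).
Proof. by move=> rx ry; rewrite sat_rlt_raw dltP. Qed.

Lemma sat_rle Γ (x y : tm Γ t1) (ρ : env M Γ) :
  isreal (ev ρ x) -> isreal (ev ρ y) -> sat (rle x y) ρ <-> V (ev ρ x) <= V (ev ρ y).
Proof.
move=> rx ry; rewrite leNgt; split=> [nl|/negP nl]; first by apply/negP => /(sat_rlt ry rx).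
by move=> /(sat_rlt ry rx).
Qed.

(** Under binders the value of a weakened term is known through a rewriting lemma, so the values are
    passed as equations here. *)
Lemma sat_rltE Γ (x y : tm Γ t1) (ρ : env M Γ) u v : ev ρ x = u -> ev ρ y = v ->
  isreal u -> isreal v -> sat (rlt x y) ρ <-> V u < V v.
Proof. by move=> <- <-; apply: sat_rlt. Qed.

Lemma sat_rleE Γ (x y : tm Γ t1) (ρ : env M Γ) u v : ev ρ x = u -> ev ρ y = v ->
  isreal u -> isreal v -> sat (rle x y) ρ <-> V u <= V v.
Proof. by move=> <- <-; apply: sat_rle. Qed.

Lemma sat_req Γ (x y : tm Γ t1) (ρ : env M Γ) :
  isreal (ev ρ x) -> isreal (ev ρ y) -> sat (req x y) ρ <-> V (ev ρ x) = V (ev ρ y).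
Proof.
move=> rx ry; rewrite -dreqP //.
split=> H n; [have /(sat_qle K) := H n|apply/(sat_qle K); move: (H n)];
  rewrite eval_qabs eval_qsub eval_qadd eval_qpow2 qv_abs qv_sub qv_add qv_pow2 /=;
  by rewrite /lift !eval_tren.
Qed.

Lemma sat_reqE Γ (x y : tm Γ t1) (ρ : env M Γ) u v : ev ρ x = u -> ev ρ y = v ->
  isreal u -> isreal v -> sat (req x y) ρ <-> V u = V v.
Proof. by move=> <- <-; apply: sat_req. Qed.

Lemma sat_is_realE Γ (x : tm Γ t1) (ρ : env M Γ) u : ev ρ x = u ->
  sat (is_real x) ρ <-> isreal u.
Proof. by move=> <-; apply: sat_is_real. Qed.

Lemma eval_rconst Γ (q : tm Γ tN) (ρ : env M Γ) : ev ρ (rconst q) = dconst (ev ρ q).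
Proof.
rewrite /rconst eval_lam /dconst; congr LAM; apply: funext => n.
by rewrite /lift eval_tren.
Qed.

Lemma eval_radd Γ (x y : tm Γ t1) (ρ : env M Γ) : ev ρ (radd x y) = dradd (ev ρ x) (ev ρ y).
Proof.
rewrite /radd eval_lam /dradd; congr LAM; apply: funext => n.
by rewrite eval_qadd /= /lift !eval_tren.
Qed.

Lemma eval_ropp Γ (x : tm Γ t1) (ρ : env M Γ) : ev ρ (ropp x) = dropp (ev ρ x).
Proof.
rewrite /ropp eval_lam /dropp; congr LAM; apply: funext => n.
by rewrite eval_qopp /= /lift !eval_tren.
Qed.

Lemma eval_rsub Γ (x y : tm Γ t1) (ρ : env M Γ) :
  ev ρ (rsub x y) = dradd (ev ρ x) (dropp (ev ρ y)).
Proof. by rewrite /rsub eval_radd eval_ropp. Qed.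

Lemma eval_rabs Γ (x : tm Γ t1) (ρ : env M Γ) : ev ρ (rabs x) = drabs (ev ρ x).
Proof.
rewrite /rabs eval_lam /drabs; congr LAM; apply: funext => n.
by rewrite eval_qabs /= /lift !eval_tren.
Qed.

Lemma eval_rsum Γ (z : tm Γ (tN ~> t1)) n (ρ : env M Γ) :
  ev ρ (rsum z n) = drsum (ev ρ z) (ev ρ n).
Proof.
rewrite /rsum eval_lam /drsum; congr LAM; apply: funext => m.
rewrite /lam eval_rec /dsumq eval_qzero /lift eval_tren; congr recS.
apply: funext => k; apply: funext => s.
by rewrite eval_qadd /= !eval_tren.
Qed.

Lemma V_rzero : V (dconst (dmkQ (M := M) 0 0 0)) = 0.
Proof. by rewrite V_const qv0. Qed.

Lemma V_rone : V (dconst (dmkQ (M := M) 1 0 0)) = 1.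
Proof. by rewrite V_const qv_mk ι0 subr0 add0r ι1 divr1. Qed.

Lemma eval_rzero Γ (ρ : env M Γ) : ev ρ rzero = dconst (dmkQ 0 0 0).
Proof. by rewrite /rzero eval_rconst eval_qzero. Qed.
Lemma eval_rone Γ (ρ : env M Γ) : ev ρ rone = dconst (dmkQ 1 0 0).
Proof. by rewrite /rone eval_rconst eval_qone. Qed.

Lemma named1 : named (1 : K).
Proof. by exists (dconst (dmkQ 1 0 0)); [exact: dconst_real|exact: V_rone]. Qed.

Definition in01 (x : name) : Prop := 0 <= V x <= 1.

Lemma sat_in_I Γ (x : tm Γ t1) (ρ : env M Γ) :
  isreal (ev ρ x) -> sat (in_I x) ρ <-> in01 (ev ρ x).
Proof.
move=> rx; rewrite /in01 -V_rzero -V_rone -(eval_rzero ρ) -(eval_rone ρ).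
have r0 : isreal (ev ρ rzero) by rewrite eval_rzero; apply: dconst_real.
have r1 : isreal (ev ρ rone) by rewrite eval_rone; apply: dconst_real.
split=> [[/(sat_rle r0 rx) -> /(sat_rle rx r1) ->] //|/andP[h1 h2]].
by split; [apply/(sat_rle r0 rx)|apply/(sat_rle rx r1)].
Qed.

Lemma sat_in_IE Γ (x : tm Γ t1) (ρ : env M Γ) u : ev ρ x = u ->
  isreal u -> sat (in_I x) ρ <-> in01 u.
Proof. by move=> <-; apply: sat_in_I. Qed.

Lemma sat_is_in Γ (x : tm Γ t1) (P : cls Γ) (ρ : env M Γ) :
  sat (is_in x P) ρ = sat P (econs (ev ρ x) ρ).
Proof.
rewrite /is_in /inst sat_fsubst; congr sat.
exact: vfun_consE.
Qed.

Lemma sat_wkcls Γ Δ (w : weakening Γ Δ) (P : cls Γ) d (ρ : env M Δ) :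
  sat (wkcls P) (econs d ρ) = sat P (econs d (fun A v => ρ A (w A v))).
Proof.
rewrite /wkcls sat_fren; congr sat.
exact: vfun_consE.
Qed.

Definition covers_by (a b : N -> K) (P : name -> Prop) :=
  [/\ DefR1 (A := tN) a, DefR1 (A := tN) b, forall k, a k <= b k
    & forall x, isreal x -> P x -> exists k, a k < V x < b k].

Definition len (a b : N -> K) := fun k => b k - a k.

Lemma len_def a b : DefR1 (A := tN) a -> DefR1 (A := tN) b -> DefR1 (A := tN) (len a b).
Proof. by move=> da db; apply: DefR_add => //; apply: DefR_opp. Qed.

Lemma DefR1_of_name (z : dom M (tN ~> t1)) :
  (forall k, isreal (z • k)) -> DefR1 (A := tN) (fun k : N => V (z • k)).
Proof. by move=> rz; apply: DefR_V => // ; dfn. Qed.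

(** Two names of one sequence give internal sums with the same recursion equations. *)
Lemma Sum_unique (z : dom M (tN ~> t1)) (a : N -> K) n :
  (forall k, isreal (z • k)) -> (forall k, V (z • k) = a k) -> V (drsum z n) = Sum a n.
Proof.
move=> rz za.
have da : DefR1 (A := tN) a.
  by have -> : a = fun k => V (z • k) by [apply: funext => k; rewrite za]; apply: DefR1_of_name.
apply: (ind (P := fun n => V (drsum z n) = Sum a n)) n => [||n IH].
- apply: DefP_eqR; last by apply: DefR_Sum => //; dfn.
  apply: DefR_V; last by move=> ρ; apply: drsum_real.
  by rewrite /drsum; dfn.
- by rewrite V_sum0 // Sum0.
- by rewrite V_sumS // SumS // IH za.
Qed.

Lemma eval_lengths Γ (a b : tm Γ (tN ~> t1)) (ρ : env M Γ) k :
  ev ρ (lengths a b) • k = dradd (ev ρ b • k) (dropp (ev ρ a • k)).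
Proof.
rewrite /lengths /lam eval_abs (LAM_env ρ k (Def_eval M _)).
by rewrite eval_rsub /= /lift !eval_tren.
Qed.

Lemma V_lengths Γ (a b : tm Γ (tN ~> t1)) (ρ : env M Γ) n :
  (forall k, isreal (ev ρ a • k)) -> (forall k, isreal (ev ρ b • k)) ->
  V (drsum (ev ρ (lengths a b)) n)
  = Sum (len (fun k => V (ev ρ a • k)) (fun k => V (ev ρ b • k))) n.
Proof.
move=> ra rb; apply: Sum_unique => k; rewrite eval_lengths.
  by apply: dradd_real => //; apply: dropp_real.
by rewrite V_add ?V_opp //; apply: dropp_real.
Qed.

Lemma lengths_real Γ (a b : tm Γ (tN ~> t1)) (ρ : env M Γ) k :
  (forall k, isreal (ev ρ a • k)) -> (forall k, isreal (ev ρ b • k)) ->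
  isreal (ev ρ (lengths a b) • k).
Proof.
move=> ra rb; rewrite eval_lengths.
by apply: dradd_real => //; apply: dropp_real.
Qed.

Lemma eval_lift1 Γ B C (f : tm Γ C) (d : dom M B) (ρ : env M Γ) :
  ev (econs d ρ) (lift f) = ev ρ f.
Proof. exact: eval_tren. Qed.

Lemma eval_lift2 Γ B B' C (f : tm Γ C) (d : dom M B) (d' : dom M B') (ρ : env M Γ) :
  ev (econs d' (econs d ρ)) (lift f) = ev ρ f.
Proof. exact: eval_tren. Qed.

Lemma eval_app Γ B C (f : tm Γ (B ~> C)) (s : tm Γ B) (ρ : env M Γ) :
  ev ρ (f · s) = ev ρ f • ev ρ s.
Proof. by []. Qed.

Lemma sat_intervals Γ (a b : tm Γ (tN ~> t1)) (ρ : env M Γ) :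
  let A := ev ρ a in let B := ev ρ b in
  sat (intervals a b) ρ <->
  [/\ forall k, isreal (A • k), forall k, isreal (B • k) & forall k, V (A • k) <= V (B • k)].
Proof.
move=> A B.
have eA k : ev (econs k ρ) (lift a · Var vz) = A • k by rewrite eval_app eval_lift1.
have eB k : ev (econs k ρ) (lift b · Var vz) = B • k by rewrite eval_app eval_lift1.
split=> [hi|[ra rb hab] k].
  have ra k : isreal (A • k) by have [/sat_is_real] := hi k; rewrite eA.
  have rb k : isreal (B • k) by have [_ [/sat_is_real]] := hi k; rewrite eB.
  split=> // k; have [_ [_ hk]] := hi k.
  exact: (proj1 (sat_rleE (eA k) (eB k) (ra k) (rb k)) hk).
split; first by apply/sat_is_real; rewrite eA.
split; first by apply/sat_is_real; rewrite eB.
exact: (proj2 (sat_rleE (eA k) (eB k) (ra k) (rb k)) (hab k)).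
Qed.

Lemma sat_covers Γ (a b : tm Γ (tN ~> t1)) (P : cls Γ) (ρ : env M Γ) :
  let A := ev ρ a in let B := ev ρ b in
  (forall k, isreal (A • k)) -> (forall k, isreal (B • k)) ->
  sat (covers a b P) ρ <->
  (forall x, isreal x -> sat P (econs x ρ) -> exists k, V (A • k) < V x < V (B • k)).
Proof.
move=> A B ra rb.
have eA (k : N) (x : name) : ev (econs k (econs x ρ)) (lift a · Var vz) = A • k.
  by rewrite eval_app eval_lift2.
have eB (k : N) (x : name) : ev (econs k (econs x ρ)) (lift b · Var vz) = B • k.
  by rewrite eval_app eval_lift2.
have ex (k : N) (x : name) : ev (econs k (econs x ρ)) (lift (Var vz)) = x.
  by rewrite eval_lift1.
split=> [hc x rx Px|hc x /sat_is_real rx].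
  have hx : sat (is_in (Var vz) (wkcls P)) (econs x ρ) by rewrite sat_is_in sat_wkcls.
  have hr : sat (is_real (Var vz)) (econs x ρ) by apply/sat_is_real.
  have [k [h1 h2]] := hc x hr hx.
  exists k; apply/andP; split.
    exact: (proj1 (sat_rltE (eA k x) (ex k x) (ra k) rx) h1).
  exact: (proj1 (sat_rltE (ex k x) (eB k x) rx (rb k)) h2).
move=> hx; have {hx} Px : sat P (econs x ρ).
  have <- // : sat (is_in (Var vz) (wkcls P)) (econs x ρ) = sat P (econs x ρ).
  by rewrite sat_is_in sat_wkcls.
have [k /andP[h1 h2]] := hc x rx Px.
exists k; split.
  exact: (proj2 (sat_rltE (eA k x) (ex k x) (ra k) rx) h1).
exact: (proj2 (sat_rltE (ex k x) (eB k x) rx (rb k)) h2).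
Qed.

Lemma sat_is_cover Γ (a b : tm Γ (tN ~> t1)) (P : cls Γ) (ρ : env M Γ) :
  let A := ev ρ a in let B := ev ρ b in
  sat (is_cover a b P) ρ <->
  [/\ forall k, isreal (A • k), forall k, isreal (B • k)
    & covers_by (fun k => V (A • k)) (fun k => V (B • k)) (fun x => sat P (econs x ρ))].
Proof.
move=> A B; split.
  move=> [/sat_intervals [ra rb hab] /(sat_covers _ ra rb) hc].
  by split=> //; split=> //; apply: DefR1_of_name.
move=> [ra rb [_ _ hab hc]]; split; first exact/sat_intervals.
exact/sat_covers.
Qed.
Lemma sat_le_series Γ (r : tm Γ t1) (z : tm Γ (tN ~> t1)) (ρ : env M Γ) :
  isreal (ev ρ r) -> (forall k, isreal (ev ρ z • k)) ->
  sat (le_series r z) ρ <->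
  (forall t, isreal t -> V t < V (ev ρ r) -> exists n, V t < V (drsum (ev ρ z) n)).
Proof.
move=> rr rz.
have er (t : name) : ev (econs t ρ) (lift r) = ev ρ r by rewrite eval_lift1.
have e0 (t : name) : ev (econs t ρ) (Var vz) = t by [].
have ez (n : N) (t : name) :
    ev (econs n (econs t ρ)) (rsum (lift z) (Var vz)) = drsum (ev ρ z) n.
  by rewrite eval_rsum eval_lift2.
have et (n : N) (t : name) : ev (econs n (econs t ρ)) (lift (Var vz)) = t.
  by rewrite eval_lift1.
have rs n : isreal (drsum (ev ρ z) n) by apply: drsum_real.
split=> [H t rt l|H t /sat_is_real rt l].
  have hr : sat (is_real (Var vz)) (econs t ρ) by apply/sat_is_real.
  have hl : sat (rlt (Var vz) (lift r)) (econs t ρ).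
    exact: (proj2 (sat_rltE (e0 t) (er t) rt rr) l).
  have [n hn] := H t hr hl; exists n.
  exact: (proj1 (sat_rltE (et n t) (ez n t) rt (rs n)) hn).
have hl := proj1 (sat_rltE (e0 t) (er t) rt rr) l.
have [n hn] := H t rt hl; exists n.
exact: (proj2 (sat_rltE (et n t) (ez n t) rt (rs n)) hn).
Qed.

Lemma sat_series2_le Γ (z z' : tm Γ (tN ~> t1)) (r : tm Γ t1) (ρ : env M Γ) :
  isreal (ev ρ r) -> (forall k, isreal (ev ρ z • k)) -> (forall k, isreal (ev ρ z' • k)) ->
  sat (series2_le z z' r) ρ <->
  (forall n m, V (drsum (ev ρ z) n) + V (drsum (ev ρ z') m) <= V (ev ρ r)).
Proof.
move=> rr rz rz'.
have rs n : isreal (drsum (ev ρ z) n) by apply: drsum_real.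
have rs' n : isreal (drsum (ev ρ z') n) by apply: drsum_real.
have e (n m : N) : ev (econs m (econs n ρ))
   (radd (rsum (lift z) (lift (Var vz : tm (tN :: Γ) tN))) (rsum (lift z') (Var vz)))
   = dradd (drsum (ev ρ z) n) (drsum (ev ρ z') m).
  by rewrite eval_radd !eval_rsum !eval_lift2 eval_lift1.
have er (n m : N) : ev (econs m (econs n ρ)) (lift r) = ev ρ r by rewrite eval_lift2.
have ra n m : isreal (dradd (drsum (ev ρ z) n) (drsum (ev ρ z') m)) by apply: dradd_real.
split=> [H n m|H n m].
  rewrite -V_add //.
  exact: (proj1 (sat_rleE (e n m) (er n m) (ra n m) rr) (H n m)).
apply: (proj2 (sat_rleE (e n m) (er n m) (ra n m) rr)).
by rewrite V_add.
Qed.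

(** The bound t ranges over named elements, since the formula quantifies over names and not over
    K. *)
Definition mge (P : name -> Prop) (r : K) :=
  forall a b, covers_by a b P ->
  forall t, named t -> t < r -> exists n, t < Sum (len a b) n.

Lemma covers_by_names a b P : covers_by a b P ->
  exists za zb : dom M (tN ~> t1), [/\ forall k, isreal (za • k), forall k, isreal (zb • k),
     a = (fun k => V (za • k)) & b = (fun k => V (zb • k))].
Proof.
move=> [/DefR1_name [za ha] /DefR1_name [zb hb] _ _]; exists za, zb.
split=> [k|k||]; [by case: (ha k)|by case: (hb k)| |].
  by apply: funext => k; case: (ha k).
by apply: funext => k; case: (hb k).
Qed.

Lemma sat_measure_ge Γ (P : cls Γ) (r : tm Γ t1) (ρ : env M Γ) :
  isreal (ev ρ r) ->
  sat (measure_ge P r) ρ <-> mge (fun x => sat P (econs x ρ)) (V (ev ρ r)).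
Proof.
move=> rr.
pose wa : tm [:: tN ~> t1, tN ~> t1 & Γ] (tN ~> t1) := Var (vs vz).
pose wb : tm [:: tN ~> t1, tN ~> t1 & Γ] (tN ~> t1) := Var vz.
have ea (za zb : dom M (tN ~> t1)) : ev (econs zb (econs za ρ)) wa = za.
  by [].
have er (za zb : dom M (tN ~> t1)) : ev (econs zb (econs za ρ)) (lift r) = ev ρ r.
  by rewrite eval_lift2.
have eP (za zb : dom M (tN ~> t1)) :
    (fun x => sat (wkcls P) (econs x (econs zb (econs za ρ)))) = (fun x => sat P (econs x ρ)).
  by apply: funext => x; rewrite sat_wkcls.
split=> [H a b cab t [x rx <-] l|H za zb].
  have [za [zb [ra rb aE bE]]] := covers_by_names cab.
  have /sat_is_cover c : [/\ forall k, isreal (ev (econs zb (econs za ρ)) wa • k),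
     forall k, isreal (ev (econs zb (econs za ρ)) wb • k)
     & covers_by (fun k => V (ev (econs zb (econs za ρ)) wa • k))
        (fun k => V (ev (econs zb (econs za ρ)) wb • k))
        (fun x => sat (wkcls P) (econs x (econs zb (econs za ρ))))].
    by rewrite eP ea -[ev _ wb]/zb -aE -bE.
  have hle : sat (le_series (lift r) (lengths wa wb)) (econs zb (econs za ρ)) := H za zb c.
  have ra' k : isreal (ev (econs zb (econs za ρ)) wa • k) by rewrite ea.
  have rb' k : isreal (ev (econs zb (econs za ρ)) wb • k) by [].
  have rr' : isreal (ev (econs zb (econs za ρ)) (lift r)) by rewrite er.
  have := proj1 (sat_le_series rr' (fun k => lengths_real k ra' rb')) hle x rx.
  rewrite er => /(_ l) [n hn]; exists n.
  by rewrite (V_lengths _ ra' rb') ea -[ev _ wb]/zb -aE -bE in hn.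
move=> /sat_is_cover [ra rb c].
rewrite eP in c.
have rr' : isreal (ev (econs zb (econs za ρ)) (lift r)) by rewrite er.
apply: (proj2 (sat_le_series rr' (fun k => lengths_real k ra rb))) => t rt.
rewrite er => l; have [n hn] := H _ _ c _ (named_V rt) l; exists n.
by rewrite (V_lengths _ ra rb).
Qed.

Definition meas (P : name -> Prop) :=
  forall δ : K, named δ -> 0 < δ -> exists a b c d,
    [/\ covers_by a b P, covers_by c d (fun x => in01 x /\ ~ P x)
      & forall n m, Sum (len a b) n + Sum (len c d) m <= 1 + δ].

Lemma covers_by_ext a b (P Q : name -> Prop) :
  (forall x, isreal x -> P x <-> Q x) -> covers_by a b P -> covers_by a b Q.
Proof. by move=> e [da db ab c]; split=> // x rx /(e x rx); apply: c. Qed.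

Lemma meas_ext (P Q : name -> Prop) :
  (forall x, isreal x -> P x <-> Q x) -> meas P -> meas Q.
Proof.
move=> e H δ nδ δ0; have [a [b [c [d [h1 h2 h3]]]]] := H δ nδ δ0.
exists a, b, c, d; split=> //; first exact: covers_by_ext h1.
by apply: covers_by_ext h2 => x rx; have := e x rx; tauto.
Qed.

Lemma sat_pos Γ (ε : tm Γ t1) (ρ : env M Γ) :
  isreal (ev ρ ε) -> sat (rlt rzero ε) ρ <-> 0 < V (ev ρ ε).
Proof.
move=> r; have := sat_rltE (eval_rzero ρ) (erefl (ev ρ ε)) (dconst_real K _) r.
by rewrite V_rzero.
Qed.

Lemma sat_measurable Γ (P : cls Γ) (ρ : env M Γ) :
  sat (measurable P) ρ <-> meas (fun x => sat P (econs x ρ)).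
Proof.
pose e4 (δ : name) (a b c d : dom M (tN ~> t1)) :=
  econs d (econs c (econs b (econs a (econs δ ρ)))).
have eP δ a b c d :
    (fun x => sat (wkcls P) (econs x (e4 δ a b c d))) = (fun x => sat P (econs x ρ)).
  by apply: funext => x; rewrite sat_wkcls.
(* The class of the complement has its intended meaning only at names of reals, hence the detour
   through [covers_by_ext]. *)
pose (co := fun (δ : name) (a b c d : dom M (tN ~> t1)) (x : name) =>
  sat (⟦ x | in_I x ∧ ¬ is_in x (wkcls P) ⟧)%fm (econs x (e4 δ a b c d))).
have eco δ a b c d x : isreal x -> co δ a b c d x <-> in01 x /\ ~ sat P (econs x ρ).
  move=> rx; have hI : sat (in_I (Var vz)) (econs x (e4 δ a b c d)) <-> in01 x by apply: sat_in_I.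
  have hP : sat (is_in (Var vz) (wkcls P)) (econs x (e4 δ a b c d)) = sat P (econs x ρ).
    by rewrite sat_is_in sat_wkcls.
  rewrite -hP; split=> -[h1 h2]; split=> //; exact/hI.
pose w1 : tm [:: tN ~> t1, tN ~> t1, tN ~> t1, tN ~> t1, t1 & Γ] (tN ~> t1) := Var (vs (vs (vs vz))).
pose w2 : tm [:: tN ~> t1, tN ~> t1, tN ~> t1, tN ~> t1, t1 & Γ] (tN ~> t1) := Var (vs (vs vz)).
pose w3 : tm [:: tN ~> t1, tN ~> t1, tN ~> t1, tN ~> t1, t1 & Γ] (tN ~> t1) := Var (vs vz).
pose w4 : tm [:: tN ~> t1, tN ~> t1, tN ~> t1, tN ~> t1, t1 & Γ] (tN ~> t1) := Var vz.
pose w5 : tm [:: tN ~> t1, tN ~> t1, tN ~> t1, tN ~> t1, t1 & Γ] t1 := Var (vs (vs (vs (vs vz)))).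
pose (body := fun (δ : name) (a b c d : dom M (tN ~> t1)) =>
  sat (is_cover w1 w2 (wkcls P)) (e4 δ a b c d)
  /\ sat (is_cover w3 w4 (⟦ x | in_I x ∧ ¬ is_in x (wkcls P) ⟧)%fm) (e4 δ a b c d)
  /\ sat (series2_le (lengths w1 w2) (lengths w3 w4) (radd rone w5)) (e4 δ a b c d)).
have bodyP (δ : name) (a b c d : dom M (tN ~> t1)) : isreal δ -> body δ a b c d <->
  [/\ forall k, isreal (a • k), forall k, isreal (b • k), forall k, isreal (c • k)
     & forall k, isreal (d • k)]
  /\ [/\ covers_by (fun k => V (a • k)) (fun k => V (b • k)) (fun x => sat P (econs x ρ)),
         covers_by (fun k => V (c • k)) (fun k => V (d • k))
           (fun x => in01 x /\ ~ sat P (econs x ρ))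
       & forall n m, Sum (len (fun k => V (a • k)) (fun k => V (b • k))) n
           + Sum (len (fun k => V (c • k)) (fun k => V (d • k))) m <= 1 + V δ].
  move=> rδ.
  have r1 : isreal (ev (e4 δ a b c d) (radd rone w5)).
    by rewrite eval_radd eval_rone; apply: dradd_real => //; apply: dconst_real.
  have v1 : V (ev (e4 δ a b c d) (radd rone w5)) = 1 + V δ.
    by rewrite eval_radd eval_rone V_add ?V_rone //; apply: dconst_real.
  have S3 : (forall k, isreal (a • k)) -> (forall k, isreal (b • k)) ->
     (forall k, isreal (c • k)) -> (forall k, isreal (d • k)) ->
     sat (series2_le (lengths w1 w2) (lengths w3 w4) (radd rone w5)) (e4 δ a b c d) <->
     forall n m, Sum (len (fun k => V (a • k)) (fun k => V (b • k))) n
           + Sum (len (fun k => V (c • k)) (fun k => V (d • k))) m <= 1 + V δ.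
    move=> ra rb rc rd.
    have ra' k : isreal (ev (e4 δ a b c d) w1 • k) := ra k.
    have rb' k : isreal (ev (e4 δ a b c d) w2 • k) := rb k.
    have rc' k : isreal (ev (e4 δ a b c d) w3 • k) := rc k.
    have rd' k : isreal (ev (e4 δ a b c d) w4 • k) := rd k.
    apply: (iff_trans (sat_series2_le r1 (fun k => lengths_real k ra' rb')
      (fun k => lengths_real k rc' rd'))).
    by rewrite v1; split=> h n m; have := h n m; rewrite (V_lengths _ ra' rb') (V_lengths _ rc' rd').
  have S1 : sat (is_cover w1 w2 (wkcls P)) (e4 δ a b c d) <->
      [/\ forall k, isreal (a • k), forall k, isreal (b • k)
        & covers_by (fun k => V (a • k)) (fun k => V (b • k)) (fun x => sat P (econs x ρ))].
    rewrite -(eP δ a b c d).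
    exact: (sat_is_cover w1 w2 (wkcls P) (e4 δ a b c d)).
  have S2 : sat (is_cover w3 w4 (⟦ x | in_I x ∧ ¬ is_in x (wkcls P) ⟧)%fm) (e4 δ a b c d) <->
      [/\ forall k, isreal (c • k), forall k, isreal (d • k)
        & covers_by (fun k => V (c • k)) (fun k => V (d • k)) (co δ a b c d)].
    exact: (sat_is_cover w3 w4 (⟦ x | in_I x ∧ ¬ is_in x (wkcls P) ⟧)%fm (e4 δ a b c d)).
  split=> [[/S1 [ra rb cab] [/S2 [rc rd ccd] /S3 h]]|[[ra rb rc rd] [cab ccd h]]].
    split=> //; split; [exact: cab|by apply: covers_by_ext ccd => x; apply: eco|exact: h].
  split; [exact/S1|split; [apply/S2|exact/S3]].
  split; [exact: rc|exact: rd|].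
  by apply: covers_by_ext ccd => x rx; apply: iff_sym; apply: (eco δ a b c d).
split=> [H _ [δ rδ <-] δ0|H δ /sat_is_real rδ hδ].
  have hr : sat (is_real (Var vz)) (econs δ ρ) by apply/sat_is_real.
  have hp : sat (rlt rzero (Var vz)) (econs δ ρ).
    exact: (proj2 (sat_pos (ε := Var vz) (ρ := econs δ ρ) rδ)).
  have [a [b [c [d h]]]] : exists a b c d, body δ a b c d := H δ hr hp.
  have [_ h'] := proj1 (bodyP δ a b c d rδ) h.
  by exists (fun k => V (a • k)), (fun k => V (b • k)), (fun k => V (c • k)), (fun k => V (d • k)).
have δ0 := proj1 (sat_pos (ε := Var vz) (ρ := econs δ ρ) rδ) hδ.
have [a [b [c [d [h1 h2 h3]]]]] := H _ (named_V rδ) δ0.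
have [za [zb [ra rb aE bE]]] := covers_by_names h1.
have [zc [zd [rc rd cE dE]]] := covers_by_names h2.
subst a b c d; exists za, zb, zc, zd.
exact: (proj2 (bodyP δ za zb zc zd rδ)).
Qed.

Definition dmem (Y : dom M (t1 ~> t1)) (x : name) := dlt K (dconst (dmkQ 0 0 0)) (Y • x).

Lemma dmemP Y x : isreal (Y • x) -> dmem Y x <-> 0 < V (Y • x).
Proof. by move=> r; rewrite /dmem dltP ?V_rzero //; apply: dconst_real. Qed.

Lemma sat_mem Γ (x : tm Γ t1) Y (ρ : env M Γ) :
  sat (mem x Y) ρ <-> dmem (ev ρ Y) (ev ρ x).
Proof. by rewrite /mem sat_rlt_raw eval_rzero. Qed.

Definition dfun_R (Y : dom M (t1 ~> t1)) :=
  (forall x, isreal x -> isreal (Y • x)) /\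
  (forall x y, isreal x -> isreal y -> V x = V y -> V (Y • x) = V (Y • y)).

(** The values of f are compared by [dlt] instead of [V], as nothing here makes [f • x] a name of a
    real. *)
Definition dcont (f Y : dom M (t1 ~> t1)) := forall x, isreal x -> dmem Y x ->
  forall e, isreal e -> 0 < V e -> exists d, [/\ isreal d, 0 < V d
    & forall y, isreal y -> dmem Y y -> `|V x - V y| < V d ->
      dlt K (drabs (dradd (f • x) (dropp (f • y)))) e].

Lemma sat_fun_R Γ (Y : tm Γ (t1 ~> t1)) (ρ : env M Γ) : sat (fun_R Y) ρ <-> dfun_R (ev ρ Y).
Proof.
have e1 (x : name) : ev (econs x ρ) (lift Y · Var vz) = ev ρ Y • x.
  by rewrite eval_app eval_lift1.
have e2 (x y : name) : ev (econs y (econs x ρ)) (lift Y · lift (Var vz : tm (t1 :: Γ) t1))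
   = ev ρ Y • x by rewrite eval_app eval_lift2 eval_lift1.
have e3 (x y : name) : ev (econs y (econs x ρ)) (lift Y · Var vz) = ev ρ Y • y.
  by rewrite eval_app eval_lift2.
have e4 (x : name) : ev (econs x ρ) (Var vz) = x by [].
have e5 (x y : name) : ev (econs y (econs x ρ)) (Var vz) = y by [].
have e6 (x y : name) : ev (econs y (econs x ρ)) (lift (Var vz : tm (t1 :: Γ) t1)) = x.
  by rewrite eval_lift1.
split=> -[h1 h2].
  have h1' x : isreal x -> isreal (ev ρ Y • x).
    by move=> rx; apply: (proj1 (sat_is_realE (e1 x)) (h1 x (proj2 (sat_is_realE (e4 x)) rx))).
  split=> // x y rx ry exy.
  have hx := proj2 (sat_is_realE (e4 x)) rx.
  have hy := proj2 (sat_is_realE (e5 x y)) ry.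
  have hxy := proj2 (sat_reqE (e6 x y) (e5 x y) rx ry) exy.
  exact: (proj1 (sat_reqE (e2 x y) (e3 x y) (h1' x rx) (h1' y ry)) (h2 x hx y hy hxy)).
split=> [x hx|x hx y hy hxy].
  exact: (proj2 (sat_is_realE (e1 x)) (h1 x (proj1 (sat_is_realE (e4 x)) hx))).
have rx := proj1 (sat_is_realE (e4 x)) hx.
have ry := proj1 (sat_is_realE (e5 x y)) hy.
have exy := proj1 (sat_reqE (e6 x y) (e5 x y) rx ry) hxy.
exact: (proj2 (sat_reqE (e2 x y) (e3 x y) (h1 x rx) (h1 y ry)) (h2 x y rx ry exy)).
Qed.

Lemma sat_subset_I Γ (Y : tm Γ (t1 ~> t1)) (ρ : env M Γ) :
  sat (subset_I Y) ρ <-> (forall x, isreal x -> dmem (ev ρ Y) x -> in01 x).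
Proof.
have em (x : name) : sat (mem (Var vz) (lift Y)) (econs x ρ) <-> dmem (ev ρ Y) x.
  by apply: (iff_trans (sat_mem _ _ _)); rewrite eval_lift1.
have e0 (x : name) : ev (econs x ρ) (Var vz) = x by [].
split=> [h x rx m|h x hx m].
  have hx := proj2 (sat_is_realE (e0 x)) rx.
  exact: (proj1 (sat_in_IE (e0 x) rx) (h x hx (proj2 (em x) m))).
have rx := proj1 (sat_is_realE (e0 x)) hx.
exact: (proj2 (sat_in_IE (e0 x) rx) (h x rx (proj1 (em x) m))).
Qed.

Lemma sat_continuous_on Γ (f Y : tm Γ (t1 ~> t1)) (ρ : env M Γ) :
  sat (continuous_on f Y) ρ <-> dcont (ev ρ f) (ev ρ Y).
Proof.
pose (e1 := fun x : name => econs x ρ).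
pose (e2 := fun x e : name => econs e (econs x ρ)).
pose (e3 := fun x e d : name => econs d (econs e (econs x ρ))).
pose (e4 := fun x e d y : name => econs y (econs d (econs e (econs x ρ)))).
pose wx : tm [:: t1, t1, t1, t1 & Γ] t1 := Var (vs (vs (vs vz))).
pose we : tm [:: t1, t1, t1, t1 & Γ] t1 := Var (vs (vs vz)).
pose wd : tm [:: t1, t1, t1, t1 & Γ] t1 := Var (vs vz).
pose wy : tm [:: t1, t1, t1, t1 & Γ] t1 := Var vz.
pose (f4 := lift f : tm [:: t1, t1, t1, t1 & Γ] (t1 ~> t1)).
pose (Y4 := lift Y : tm [:: t1, t1, t1, t1 & Γ] (t1 ~> t1)).
pose (Y1 := lift Y : tm [:: t1 & Γ] (t1 ~> t1)).
have f4E x e d y : ev (e4 x e d y) f4 = ev ρ f by exact: eval_tren.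
have Y4E x e d y : ev (e4 x e d y) Y4 = ev ρ Y by exact: eval_tren.
have Y1E x : ev (e1 x) Y1 = ev ρ Y by exact: eval_tren.
have m1 x : sat (mem (Var vz) Y1) (e1 x) <-> dmem (ev ρ Y) x.
  by apply: (iff_trans (sat_mem _ _ _)); rewrite Y1E.
have m4 x e d y : sat (mem wy Y4) (e4 x e d y) <-> dmem (ev ρ Y) y.
  by apply: (iff_trans (sat_mem _ _ _)); rewrite Y4E.
have dist x e d y : isreal x -> isreal d -> isreal y ->
    sat (rlt (rabs (rsub wx wy)) wd) (e4 x e d y) <-> `|V x - V y| < V d.
  move=> rx rd ry.
  have E : ev (e4 x e d y) (rabs (rsub wx wy)) = drabs (dradd x (dropp y)).
    by rewrite eval_rabs eval_rsub.
  have rr : isreal (dradd x (dropp y)) by apply: dradd_real => //; apply: dropp_real.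
  apply: (iff_trans (sat_rltE E (erefl (ev (e4 x e d y) wd)) (drabs_real rr) rd)).
  by rewrite V_abs // V_add ?V_opp //; apply: dropp_real.
have fdist x e d y : sat (rlt (rabs (rsub (f4 · wx) (f4 · wy))) we) (e4 x e d y) <->
    dlt K (drabs (dradd (ev ρ f • x) (dropp (ev ρ f • y)))) e.
  apply: (iff_trans (sat_rlt_raw _ _ _)).
  by rewrite eval_rabs eval_rsub !eval_app f4E.
pose w1 : tm [:: t1 & Γ] t1 := Var vz.
pose w2 : tm [:: t1, t1 & Γ] t1 := Var vz.
pose w3 : tm [:: t1, t1, t1 & Γ] t1 := Var vz.
have p2 x e : isreal e -> sat (rlt rzero w2) (e2 x e) <-> 0 < V e.
  exact: (@sat_pos _ w2 (e2 x e)).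
have p3 x e d : isreal d -> sat (rlt rzero w3) (e3 x e d) <-> 0 < V d.
  exact: (@sat_pos _ w3 (e3 x e d)).
pose Inner x e d := forall y, sat (is_real wy) (e4 x e d y) -> sat (mem wy Y4) (e4 x e d y) ->
  sat (rlt (rabs (rsub wx wy)) wd) (e4 x e d y) ->
  sat (rlt (rabs (rsub (f4 · wx) (f4 · wy))) we) (e4 x e d y).
have InnerP x e d : isreal x -> isreal d -> Inner x e d <->
    (forall y, isreal y -> dmem (ev ρ Y) y -> `|V x - V y| < V d ->
      dlt K (drabs (dradd (ev ρ f • x) (dropp (ev ρ f • y)))) e).
  move=> rx rd; split=> h y.
    move=> ry my l; apply/(fdist x e d y)/h; first exact/(sat_is_real wy (e4 x e d y)).
      exact/m4.
    exact/(dist x e d y).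
  move=> /(sat_is_real wy (e4 x e d y)) ry /m4 my /(dist x e d y rx rd ry) l.
  exact/(fdist x e d y)/h.
split=> [H x rx mx e re e0|H].
  have [d [hd [hd0 hi]]] : exists d, sat (is_real w3) (e3 x e d) /\
      sat (rlt rzero w3) (e3 x e d) /\ Inner x e d.
    apply: (H x) => //.
    - exact/(sat_is_real w1 (e1 x)).
    - exact/m1.
    - exact/(sat_is_real w2 (e2 x e)).
    - exact/p2.
  have rd := proj1 (sat_is_real w3 (e3 x e d)) hd.
  exists d; split=> //; first exact/(p3 x e d).
  exact/InnerP.
have goal : forall x, sat (is_real w1) (e1 x) -> sat (mem w1 Y1) (e1 x) ->
   forall e, sat (is_real w2) (e2 x e) -> sat (rlt rzero w2) (e2 x e) ->
   exists d, sat (is_real w3) (e3 x e d) /\ sat (rlt rzero w3) (e3 x e d) /\ Inner x e d.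
  move=> x /(sat_is_real w1 (e1 x)) rx /m1 mx e /(sat_is_real w2 (e2 x e)) re /(p2 x e re) e0.
  have [d [rd d0 h]] := H x rx mx e re e0; exists d.
  split; first exact/(sat_is_real w3 (e3 x e d)).
  split; first exact/(p3 x e d).
  exact/InnerP.
exact: goal.
Qed.

Lemma sat_RM_closed Γ (Y : tm Γ (t1 ~> t1)) (ρ : env M Γ) :
  sat (RM_closed Y) ρ <-> exists a b : name, forall x, isreal x ->
    dmem (ev ρ Y) x <-> in01 x /\ ~ exists n : N, qv K (a • n) < V x < qv K (b • n).
Proof.
pose (e3 := fun a b x : name => econs x (econs b (econs a ρ))).
pose (e4 := fun (a b x : name) (n : N) => econs n (econs x (econs b (econs a ρ)))).
pose wa : tm [:: tN, t1, t1, t1 & Γ] t1 := Var (vs (vs (vs vz))).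
pose wb : tm [:: tN, t1, t1, t1 & Γ] t1 := Var (vs (vs vz)).
pose wx : tm [:: tN, t1, t1, t1 & Γ] t1 := Var (vs vz).
pose wn : tm [:: tN, t1, t1, t1 & Γ] tN := Var vz.
pose w3 : tm [:: t1, t1, t1 & Γ] t1 := Var vz.
pose (Y3 := lift Y : tm [:: t1, t1, t1 & Γ] (t1 ~> t1)).
have Y3E a b x : ev (e3 a b x) Y3 = ev ρ Y by exact: eval_tren.
have m3 a b x : sat (mem w3 Y3) (e3 a b x) <-> dmem (ev ρ Y) x.
  by apply: (iff_trans (sat_mem _ _ _)); rewrite Y3E.
have i3 a b x : isreal x -> sat (in_I w3) (e3 a b x) <-> in01 x.
  exact: (@sat_in_I _ w3 (e3 a b x)).
have ha a b x n : isreal x -> sat (rlt (rconst (wa · wn)) wx) (e4 a b x n) <-> qv K (a • n) < V x.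
  move=> rx; have E : ev (e4 a b x n) (rconst (wa · wn)) = dconst (a • n) by rewrite eval_rconst.
  by rewrite -V_const; apply: (sat_rltE E (erefl (ev (e4 a b x n) wx)) (dconst_real K _) rx).
have hb a b x n : isreal x -> sat (rlt wx (rconst (wb · wn))) (e4 a b x n) <-> V x < qv K (b • n).
  move=> rx; have E : ev (e4 a b x n) (rconst (wb · wn)) = dconst (b • n) by rewrite eval_rconst.
  by rewrite -V_const; apply: (sat_rltE (erefl (ev (e4 a b x n) wx)) E rx (dconst_real K _)).
pose U a b x := exists n : N, sat (rlt (rconst (wa · wn)) wx) (e4 a b x n)
  /\ sat (rlt wx (rconst (wb · wn))) (e4 a b x n).
have UP a b x : isreal x -> U a b x <-> exists n : N, qv K (a • n) < V x < qv K (b • n).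
  move=> rx; split=> -[n].
    by move=> [/(ha a b x n rx) h1 /(hb a b x n rx) h2]; exists n; rewrite h1 h2.
  by move=> /andP[h1 h2]; exists n; split; [apply/ha|apply/hb].
pose B a b x := (sat (mem w3 Y3) (e3 a b x) -> sat (in_I w3) (e3 a b x) /\ ~ U a b x) /\
  (sat (in_I w3) (e3 a b x) /\ ~ U a b x -> sat (mem w3 Y3) (e3 a b x)).
have BP a b x : isreal x -> B a b x <->
    (dmem (ev ρ Y) x <-> in01 x /\ ~ exists n : N, qv K (a • n) < V x < qv K (b • n)).
  move=> rx; have h1 := m3 a b x; have h2 := i3 a b x rx; have h3 := UP a b x rx.
  rewrite /B; tauto.
have -> : sat (RM_closed Y) ρ <-> exists a b : name,
    forall x, sat (is_real w3) (e3 a b x) -> B a b x by [].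
split=> -[a [b h]]; exists a, b => x.
  by move=> rx; apply/BP => //; apply: h; apply/(sat_is_real w3 (e3 a b x)).
by move=> /(sat_is_real w3 (e3 a b x)) rx; apply/BP => //; apply: h.
Qed.

Definition dlusin (f : dom M (t1 ~> t1)) (r : K) (Y : dom M (t1 ~> t1)) :=
  dfun_R Y /\ (forall x, isreal x -> dmem Y x -> in01 x) /\ meas (dmem Y)
  /\ mge (dmem Y) (1 - r) /\ dcont f Y.

Lemma sat_lusin_set Γ (f : tm Γ (t1 ~> t1)) ε (Y : tm Γ (t1 ~> t1)) (ρ : env M Γ) :
  isreal (ev ρ ε) -> sat (lusin_set f ε Y) ρ <-> dlusin (ev ρ f) (V (ev ρ ε)) (ev ρ Y).
Proof.
move=> re; have e1 : (fun x => sat (⟦ x | mem x (lift Y) ⟧)%fm (econs x ρ)) = dmem (ev ρ Y).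
  apply: funext => x; apply: propext; apply: (iff_trans (sat_mem _ _ _)).
  by rewrite eval_lift1.
have h1 := sat_fun_R Y ρ; have h2 := sat_subset_I Y ρ.
have h3 : sat (measurable (⟦ x | mem x (lift Y) ⟧)%fm) ρ <-> meas (dmem (ev ρ Y)).
  by rewrite -e1; exact: sat_measurable.
have rr : isreal (ev ρ (rsub rone ε)).
  by rewrite eval_rsub eval_rone; apply: dradd_real; [exact: dconst_real|exact: dropp_real].
have h5 := sat_continuous_on f Y ρ.
have vr : V (ev ρ (rsub rone ε)) = 1 - V (ev ρ ε).
  by rewrite eval_rsub eval_rone V_add ?V_rone ?V_opp //; [exact: dconst_real|exact: dropp_real].
have h4 : sat (measure_ge (⟦ x | mem x (lift Y) ⟧)%fm (rsub rone ε)) ρ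
    <-> mge (dmem (ev ρ Y)) (1 - V (ev ρ ε)).
  by rewrite -e1 -vr; exact: sat_measure_ge.
rewrite /dlusin -h1 -h2 -h3 -h4 -h5.
by [].
Qed.

End Meaning.

(** * Compactness of the unit interval *)

Section Dyadic.
Variables (M : model) (K : completion M).
Local Notation N := (ocar (semiring_of M)).
Local Notation name := (dom M t1).
Local Notation V := (V K).
Local Notation isreal := (isreal K).
Local Notation ι := (@cι M K).
Local Notation dy := (@dy M K).
Local Notation h := (@h M K).
Implicit Types (i j m n p q : N).

Lemma dyS m j : dy m (j + 1) = dy m j + h m.
Proof. by rewrite /dy ιD ι1 mulrDl mul1r. Qed.

Lemma dy0 m : dy m 0 = 0. Proof. by rewrite /dy ι0 mul0r. Qed.

Lemma dy_double m j : dy (m + 1) (j + j) = dy m j.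
Proof. by rewrite /dy ιD hS mulrDl -mulrDr -splitr. Qed.

Lemma dy_pow2 m : dy m (dpow2 m) = 1. Proof. exact: ι_h. Qed.

Lemma dy_lt m i j : olt i j <-> dy m i < dy m j.
Proof. by rewrite /dy ltr_pM2r ?h_gt0 //; exact: ι_lt. Qed.

Lemma dy_ge0 m j : 0 <= dy m j.
Proof. by rewrite mulr_ge0 ?ι_ge0 // ltW // h_gt0. Qed.

Lemma dy_le m i j : olt i (j + 1) -> dy m i <= dy m j.
Proof. by move=> /olt_S [->//|/dy_lt /ltW]. Qed.

(** k pieces of length 2^(-k-m) have total length at most 2^(-m), as k < 2^k. This fixes the level
    at which k given intervals can be handled. *)
Lemma dy_small_index m k : dy (k + m) k <= h m.
Proof.
rewrite /dy hD mulrA -[X in _ <= X]mul1r ler_pM2r ?h_gt0 // -(ι_h K k) ler_pM2r ?h_gt0 //.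
by apply/ltW/ι_lt/olt_dpow2.
Qed.

Lemma n_parity j : exists i, j = i + i \/ j = i + i + 1.
Proof.
apply: (ind (P := fun j => exists i, j = i + i \/ j = i + i + 1)) j => [||j [i [->|->]]].
- by dfn.
- by exists 0; left; rewrite addr0.
- by exists i; right.
- by exists (i + 1); left; ring.
Qed.

Lemma olt_double i j : olt i j -> olt (i + i) (j + j) /\ olt (i + i + 1) (j + j).
Proof.
move=> l; have [[k ->] k0] : (exists k, j = i + k + 1) /\ True.
  split=> //; have [d d0 E] := olt_sub l; case: (n_cases d) => [e|[k e]].
    by rewrite e in d0; case: (olt_irr d0).
  by exists k; rewrite -addrA -e.
have E : i + k + 1 + (i + k + 1) = (i + i + 1) + (k + k + 1) by ring.
rewrite E; split.
  have -> : i + i + 1 + (k + k + 1) = (i + i) + (k + k + 1 + 1) by ring.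
  by have := olt_addl (i + i) (olt0S (k + k + 1)); rewrite addr0.
by have := olt_addl (i + i + 1) (olt0S (k + k)); rewrite addr0.
Qed.

Lemma half_lt_pow2 i p : olt (i + i) (dpow2 (p + 1)) -> olt i (dpow2 p).
Proof.
rewrite dpow2S => l; have [//|[e|/olt_double [l' _]]] := olt_total i (dpow2 p).
  by rewrite e in l; case: (olt_irr l).
by case: (olt_irr (olt_trans l l')).
Qed.

Definition inD m j x : Prop := dy m j <= V x <= dy m (j + 1).

(** Repeated halving. Cells are closed, so neither half loses the midpoint, and comparisons with
    [V x] are definable because it has a name. *)
Lemma locate x m j p : isreal x -> inD m j x ->
  exists i, olt i (dpow2 p) /\ inD (m + p) (dpow2 p * j + i) x.
Proof.
move=> rx hx; have nx := named_V rx.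
apply: (ind (P := fun p => exists i, olt i (dpow2 p) /\ inD (m + p) (dpow2 p * j + i) x)) p.
- rewrite /inD; apply: (@DefP_ext _ _ (fun q : env M [:: tN] => exists i : N,
    olt i (dpow2 (q tN vz)) /\ (dy (m + q tN vz) (dpow2 (q tN vz) * j + i) <= V x /\
      V x <= dy (m + q tN vz) (dpow2 (q tN vz) * j + i + 1)))) => [ρ|].
    by split=> -[i [h1 h2]]; exists i; split=> //; [case: h2 => -> ->|case/andP: h2].
  by dfn.
- exists 0; rewrite dpow20 mul1r !addr0; split=> //; exact: olt01.
- move=> p [i [l /andP[h1 h2]]]; rewrite /inD.
  set a := dpow2 p * j + i in h1 h2.
  have e0 : dpow2 (p + 1) * j + (i + i) = a + a by rewrite dpow2S /a; ring.
  have e1 : dpow2 (p + 1) * j + (i + i + 1) = a + a + 1 by rewrite dpow2S /a; ring.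
  have [l0 l1] := olt_double l; rewrite -dpow2S in l0 l1.
  have d0 : dy (m + (p + 1)) (a + a) = dy (m + p) a by rewrite addrA dy_double.
  have d2 : dy (m + (p + 1)) (a + a + 1 + 1) = dy (m + p) (a + 1).
    have E : a + a + 1 + 1 = (a + 1) + (a + 1) by ring.
    by rewrite addrA E dy_double.
  have [c|c] := leP (V x) (dy (m + (p + 1)) (a + a + 1)).
    by exists (i + i); rewrite e0 d0 h1 c.
  by exists (i + i + 1); rewrite e1 d2 h2 (ltW c).
Qed.

Lemma locate01 x p : isreal x -> in01 K x -> exists i, olt i (dpow2 p) /\ inD p i x.
Proof.
move=> rx /andP[h1 h2]; have [|i [l hi]] := @locate x 0 0 p rx.
  by rewrite /inD dy0 h1 add0r -(dpow20 M) dy_pow2 h2.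
by exists i; move: hi; rewrite add0r mulr0 add0r.
Qed.

(** * Uniform levels for hereditary properties of dyadic cells *)

Section Compactness.
Variable good : N -> N -> Prop.
Hypothesis good_def : DefP2 (A := tN) (B := tN) good.
Hypothesis good_half : forall m j, good m j -> good (m + 1) (j + j) /\ good (m + 1) (j + j + 1).

Definition allgood m j p := forall i, olt i (dpow2 p) -> good (m + p) (dpow2 p * j + i).
(** An arithmetical condition: the search operator decides it, and the path below can branch on it
    inside M. *)
Definition cov m j := exists p, allgood m j p.

Lemma cov_def : DefP2 (A := tN) (B := tN) cov.
Proof. by rewrite /cov /allgood; dfn. Qed.

Lemma allgood_add m j p q : allgood m j p -> allgood m j (p + q).
Proof.
move=> hp; apply: (ind (P := fun q => allgood m j (p + q))) q => [||q IH].
- by rewrite /allgood; dfn.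
- by rewrite addr0.
- move=> i; have [i' [->|->]] := n_parity i => l; rewrite addrA in l *; rewrite addrA.
    have l' := half_lt_pow2 l; have [h1 _] := good_half (IH _ l').
    by rewrite dpow2S; congr good: h1; ring.
  have l0 : olt (i' + i') (dpow2 (p + q + 1)) by apply: olt_trans l; apply: nlt_S.
  have l' := half_lt_pow2 l0; have [_ h1] := good_half (IH _ l').
  by rewrite dpow2S; congr good: h1; ring.
Qed.

Lemma good_cov m j : good m j -> cov m j.
Proof.
move=> g; exists 0 => i; rewrite dpow20 -[X in olt _ X]add0r => /olt_S [->|/olt_n0//].
by rewrite mul1r !addr0.
Qed.

(** The children may need different levels p and q. Heredity raises both to p + q, which is p + q +
    1 as seen from the parent. *)
Lemma cov_children m j : cov (m + 1) (j + j) -> cov (m + 1) (j + j + 1) -> cov m j.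
Proof.
move=> [p /allgood_add hp] [q /allgood_add hq]; have {}hp := hp q; have {}hq := hq p.
rewrite [q + p]addrC in hq; exists (p + q + 1) => i l.
have e : m + (p + q + 1) = m + 1 + (p + q) by ring.
have [l'|l'] := pselect (olt i (dpow2 (p + q))).
  by have := hp _ l'; rewrite e dpow2S; congr good; ring.
have [k ik] : exists k, i = k + dpow2 (p + q).
  have [//|[->|/olt_sub [d _ ->]]] := olt_total i (dpow2 (p + q)); first by exists 0; rewrite add0r.
  by exists d; exact: (addrC (dpow2 (p + q)) d).
have lk : olt k (dpow2 (p + q)).
  rewrite ik dpow2S in l; have [//|[ek|lk]] := olt_total k (dpow2 (p + q)).
    by rewrite ek in l; case: (olt_irr l).
  by case: (olt_irr (olt_trans l (olt_add (dpow2 (p + q)) lk))).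
by have := hq _ lk; rewrite e dpow2S ik; congr good; ring.
Qed.

(* The path descends to a child that no level covers, to the left one if possible. *)
Definition path m j p : N :=
  recS (fun q (r : N) => if `[< cov (m + q + 1) (r + r) >] then r + r + 1 else r + r) j p.

Lemma Def_path Γ (f g k : env M Γ -> N) : Def f -> Def g -> Def k ->
  Def (fun ρ => path (f ρ) (g ρ) (k ρ)).
Proof. by move=> *; have cd := cov_def; rewrite /path; dfn. Qed.

Ltac dfn_math ::= lazymatch goal with
  | |- Def (fun _ => path _ _ _) => apply Def_path
  end.

Lemma path0 m j : path m j 0 = j. Proof. exact: recS0. Qed.
Lemma pathS m j p : path m j (p + 1) =
  if `[< cov (m + p + 1) (path m j p + path m j p) >]
  then path m j p + path m j p + 1 else path m j p + path m j p.
Proof. by have cd := cov_def; rewrite {1}/path recSS //; dfn. Qed.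

Lemma path_not_cov m j p : ~ cov m j -> ~ cov (m + p) (path m j p).
Proof.
move=> nc; have cd := cov_def.
apply: (ind (P := fun p => ~ cov (m + p) (path m j p))) p => [||p IH].
- by dfn.
- by rewrite path0 addr0.
- rewrite pathS addrA; case: asboolP => // c c'; apply: IH; exact: cov_children.
Qed.

Lemma path_bounds m j p q : dy (m + p) (path m j p) <= dy (m + (p + q)) (path m j (p + q)) /\
  dy (m + (p + q)) (path m j (p + q)) + h (m + (p + q)) <= dy (m + p) (path m j p) + h (m + p).
Proof.
apply: (ind (P := fun q => dy (m + p) (path m j p) <= dy (m + (p + q)) (path m j (p + q)) /\
  dy (m + (p + q)) (path m j (p + q)) + h (m + (p + q)) <= dy (m + p) (path m j p) + h (m + p))) q
  => [||q [h1 h2]].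
- by dfn.
- by rewrite addr0.
- have hp := h_gt0 K (m + (p + q)).
  have -> : m + (p + (q + 1)) = m + (p + q) + 1 by ring.
  have -> : p + (q + 1) = p + q + 1 by ring.
  rewrite pathS hS; case: ifP => _; rewrite ?dyS dy_double ?hS; lra.
Qed.

(** The n-th approximation lies on level m + n, which gives the required rate of convergence. The
    point exists for every cell; that it avoids good cells is claimed only for cells that are not
    covered. *)
Definition point m j : name :=
  LAM (fun n : N => dmkQ (path m j n) 0 (dpred (dpow2 (m + n)))).

Lemma Def_point Γ (f g : env M Γ -> N) : Def f -> Def g -> Def (fun ρ => point (f ρ) (g ρ)).
Proof.
by move=> df dg; rewrite /point; dfn.
Qed.

Lemma xq_point m j n : xq K (point m j) n = dy (m + n) (path m j n).
Proof. by rewrite /xq LAME -?dy_qv //; dfn. Qed.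

Lemma point_real m j : isreal (point m j).
Proof.
move=> n i; rewrite !xq_point; have [h1 h2] := path_bounds m j n i.
have := h_gt0 K (m + (n + i)); have := h_le K n m; rewrite [n + m]addrC => ? ?.
by rewrite ltr_distlC; apply/andP; split; lra.
Qed.

(** The approximations give the bounds up to 2^(-q) for every q, and a closed cell keeps them in the
    limit. *)
Lemma point_in m j p : inD (m + p) (path m j p) (point m j).
Proof.
have hq q : dy (m + p) (path m j p) - h q <= V (point m j) <= dy (m + p) (path m j p) + h (m + p) + h q.
  have := V_near (p + q) (point_real m j); rewrite xq_point ler_distl => /andP[h1 h2].
  have [h3 h4] := path_bounds m j p q; have := h_le K q p; rewrite [q + p]addrC => h5.
  by have := h_gt0 K (m + (p + q)) => h6; apply/andP; split; lra.
rewrite /inD dyS; apply/andP; split; rewrite leNgt; apply/negP => l;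
  rewrite -subr_gt0 in l; have [q lq] := h_small l; have /andP[h1 h2] := hq q; lra.
Qed.

Lemma point_not_good m j p : ~ cov m j ->
  exists i, ~ good (m + p) i /\ inD (m + p) i (point m j).
Proof.
move=> nc; exists (path m j p); split; last exact: point_in.
by move=> /good_cov; apply: path_not_cov.
Qed.

Lemma point_inD m j : inD m j (point m j).
Proof. by have := point_in m j 0; rewrite addr0 path0. Qed.

(** The hypothesis speaks of all cells of a level that contain x: a dyadic point lies in two of
    them, and the path may run through either. *)
Theorem compactness m j : (forall x, isreal x -> inD m j x ->
  exists p, forall i, inD (m + p) i x -> good (m + p) i) -> cov m j.
Proof.
move=> H; apply: contrapT => nc.
have [p hp] := H _ (point_real m j) (point_inD m j).
by have [i [ng /hp]] := point_not_good p nc.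
Qed.

Theorem compactness01 : (forall x, isreal x -> in01 K x ->
  exists p, forall i, inD p i x -> good p i) ->
  exists p, forall i, olt i (dpow2 p) -> good p i.
Proof.
move=> H; have e1 : dy 0 1 = 1 by rewrite -(dpow20 M) dy_pow2.
have [|p hp] := @compactness 0 0.
  move=> x rx h01; have [|p hp] := H x rx; first by move: h01; rewrite /inD dy0 add0r e1.
  by exists p => i; rewrite add0r; exact: hp.
by exists p => i /hp; rewrite add0r mulr0 add0r.
Qed.

End Compactness.
End Dyadic.

(** * Covers by intervals *)

Section Sums.
Variables (M : model) (K : completion M).
Local Notation N := (ocar (semiring_of M)).
Local Notation name := (dom M t1).
Local Notation V := (V K).
Local Notation isreal := (isreal K).
Local Notation ι := (@cι M K).
Local Notation dy := (@dy M K).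
Local Notation h := (@h M K).
Local Notation DefR1 := (@DefR1 M K tN).
Implicit Types Γ : ctx.
Implicit Types i j k m n p q : N.
Implicit Types a b c d : N -> K.

(** Here the sequence may depend on parameters. Its names are uniform in them, and by [Sum_unique]
    they may replace the ones chosen in [Sum]. *)
Lemma DefR_Sum2 Γ (a : env M Γ -> N -> K) (f : env M Γ -> N) :
  DefR (fun q : env M (tN :: Γ) => a (etail q) (q tN vz)) -> Def f ->
  DefR (fun ρ => Sum (a ρ) (f ρ)).
Proof.
move=> [u du uP] df; pose z ρ := LAM (fun e : N => u (econs e ρ)).
have zE ρ (k : N) : z ρ • k = u (econs k ρ) by exact: LAM_env.
have dz : Def z.
  have du' : Def (fun q : env M (tN :: Γ) => u (econs (q tN vz) (etail q))).
    have := du; congr Def; apply: funext => q; congr u; apply: vfun_consE => //.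
  exact: (@Def_LAM M Γ tN t1 (fun ρ (e : N) => u (econs e ρ)) du').
exists (fun ρ => drsum (z ρ) (f ρ)); first by rewrite /drsum; dfn.
move=> ρ; have rz k : isreal (z ρ • k) by rewrite zE; case: (uP (econs k ρ)).
split; first exact: drsum_real.
by apply: Sum_unique => // k; rewrite zE; case: (uP (econs k ρ)).
Qed.

Lemma DefR_len Γ (a b : N -> K) (f : env M Γ -> N) : DefR1 a -> DefR1 b -> Def f ->
  DefR (fun ρ => len a b (f ρ)).
Proof. by move=> da db df; rewrite /len; dfn. Qed.
End Sums.

Ltac dfn_math ::= lazymatch goal with
  | |- DefR (fun _ => Sum _ _) => apply DefR_Sum2
  | |- DefR (fun _ => len _ _ _) => apply DefR_len
  end.

Section Sums.
Variables (M : model) (K : completion M).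
Local Notation N := (ocar (semiring_of M)).
Local Notation name := (dom M t1).
Local Notation V := (V K).
Local Notation isreal := (isreal K).
Local Notation ι := (@cι M K).
Local Notation dy := (@dy M K).
Local Notation h := (@h M K).
Local Notation DefR1 := (@DefR1 M K tN).
Local Notation in01 := (@in01 M K).
Implicit Types Γ : ctx.
Implicit Types i j k m n p q : N.
Implicit Types a b c d : N -> K.

Lemma DefR1_named a k : DefR1 a -> named (a k).
Proof. by move=> [u _ uP]; exists (u (econs k (enil M))); case: (uP (econs k (enil M))). Qed.

Lemma oltS n : olt n (n + 1). Proof. by apply/olt_S; left. Qed.

Lemma Sum_le_lt a b n : DefR1 a -> DefR1 b -> (forall i, olt i n -> a i <= b i) ->
  Sum a n <= Sum b n.
Proof.
move=> da db H; suff : (forall i, olt i n -> a i <= b i) -> Sum a n <= Sum b n by apply.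
clear H; apply: (ind (P := fun n => (forall i, olt i n -> a i <= b i) -> Sum a n <= Sum b n)) n.
- by dfn.
- by rewrite !Sum0.
- move=> n IH H; rewrite !SumS //; apply: lerD; last by apply: H; apply: oltS.
  by apply: IH => i l; apply: H; apply: olt_trans l (oltS _).
Qed.

Lemma Sum_le a b n : DefR1 a -> DefR1 b -> (forall i, a i <= b i) -> Sum a n <= Sum b n.
Proof. by move=> da db H; apply: Sum_le_lt. Qed.

Lemma Sum_eq_lt a b n : DefR1 a -> DefR1 b -> (forall i, olt i n -> a i = b i) ->
  Sum a n = Sum b n.
Proof. by move=> da db H; apply: le_anti; rewrite !Sum_le_lt // => i /H ->. Qed.

Lemma Sum_add a b n : DefR1 a -> DefR1 b -> Sum (fun i => a i + b i) n = Sum a n + Sum b n.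
Proof.
move=> da db; have dab : DefR1 (fun i => a i + b i) by exact: DefR_add.
apply: (ind (P := fun n => Sum (fun i => a i + b i) n = Sum a n + Sum b n)) n.
- by dfn.
- by rewrite !Sum0 // addr0.
- by move=> n IH; rewrite !SumS // IH addrACA.
Qed.

Lemma Sum_h m n : Sum (fun _ => h m) n = dy m n.
Proof.
have dh : DefR1 (fun _ => h m) by dfn.
apply: (ind (P := fun n => Sum (fun _ => h m) n = dy m n)) n.
- by dfn.
- by rewrite Sum0 // dy0.
- by move=> n IH; rewrite SumS // dyS IH.
Qed.

Lemma Sum_zero n : Sum (fun _ => 0) n = 0 :> K.
Proof.
have d0 : DefR1 (fun _ => 0) by dfn.
apply: (ind (P := fun n => Sum (fun _ => 0) n = 0 :> K)) n.
- by dfn.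
- exact: Sum0.
- by move=> n IH; rewrite SumS // IH addr0.
Qed.

Lemma Sum_mono a n m : DefR1 a -> (forall i, 0 <= a i) -> Sum a n <= Sum a (n + m).
Proof.
move=> da a0; apply: (ind (P := fun m => Sum a n <= Sum a (n + m))) m.
- by dfn.
- by rewrite addr0.
- by move=> m IH; rewrite addrA SumS //; have := a0 (n + m); lra.
Qed.

Lemma len_ge0 a b i : (forall i, a i <= b i) -> 0 <= len a b i.
Proof. by move=> ab; rewrite subr_ge0. Qed.

(** The integer part of k / 2. *)
Definition half k : N := least (fun i => olt k (i + i + 1 + 1)).

Lemma Def_half Γ (f : env M Γ -> N) : Def f -> Def (fun ρ => half (f ρ)).
Proof. by move=> ?; rewrite /half; dfn. Qed.

Lemma half_unique k i : olt k (i + i + 1 + 1) -> ~ olt k (i + i) -> half k = i.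
Proof.
move=> l nl; have [||hk hmin] := @leastP M (fun i => olt k (i + i + 1 + 1)); first by dfn.
  by exists i.
rewrite -/(half k) in hk hmin; have [l'|[//|/hmin/(_ l) //]] := olt_total (half k) i.
have [_ l2] := olt_double l'; case: nl.
case/olt_S: hk => [->//|hk]; exact: olt_trans hk l2.
Qed.

Lemma half_even i : half (i + i) = i.
Proof.
apply: half_unique; last exact: olt_irr.
by apply: olt_trans (oltS _); apply: oltS.
Qed.

Lemma half_odd i : half (i + i + 1) = i.
Proof.
apply: half_unique; first exact: oltS.
by move=> /(olt_trans (oltS _)) /olt_irr.
Qed.

Lemma odd_not_even i : ~ exists j, i + i + 1 = j + j.
Proof.
move=> [j e]; have [/olt_double [_ l]|[e'|/olt_double [l _]]] := olt_total i j.
- by rewrite e in l; apply: (olt_irr l).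
- by have := oltS (i + i); rewrite e e' => /olt_irr.
- by rewrite -e in l; apply: (olt_irr (olt_trans (oltS (i + i)) l)).
Qed.

(** Interleaving, because both sequences are infinite and cannot be concatenated. *)
Definition join a b k : K := if `[< exists i, k = i + i >] then a (half k) else b (half k).

Lemma join_even a b i : join a b (i + i) = a i.
Proof. by rewrite /join asboolT ?half_even //; exists i. Qed.

Lemma join_odd a b i : join a b (i + i + 1) = b i.
Proof. by rewrite /join asboolF ?half_odd //; apply: odd_not_even. Qed.

Lemma join_def a b : DefR1 a -> DefR1 b -> DefR1 (join a b).
Proof.
move=> da db; rewrite /join; have dh : Def1 half by apply: Def_half; dfn.
by dfn.
Qed.

Lemma Sum_join a b n : DefR1 a -> DefR1 b -> Sum (join a b) (n + n) = Sum a n + Sum b n.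
Proof.
move=> da db; have dj := join_def da db.
apply: (ind (P := fun n => Sum (join a b) (n + n) = Sum a n + Sum b n)) n.
- by dfn.
- by rewrite addr0 !Sum0 // addr0.
- move=> n IH; have -> : n + 1 + (n + 1) = n + n + 1 + 1 by ring.
  by rewrite !SumS // join_odd join_even IH addrACA addrA.
Qed.

Lemma Sum_join_le a b n : DefR1 a -> DefR1 b -> (forall i, 0 <= a i) -> (forall i, 0 <= b i) ->
  Sum (join a b) n <= Sum a n + Sum b n.
Proof.
move=> da db a0 b0; rewrite -Sum_join //; apply: Sum_mono; first exact: join_def.
by move=> i; rewrite /join; case: ifP.
Qed.

Lemma len_join a b c d : len (join a c) (join b d) = join (len a b) (len c d).
Proof. by apply: funext => k; rewrite /len /join; case: ifP. Qed.

Lemma covers_join a b c d (P Q : name -> Prop) : covers_by a b P -> covers_by c d Q ->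
  covers_by (join a c) (join b d) (fun x => P x \/ Q x).
Proof.
move=> [da db ab cP] [dc dd cd cQ]; split; [exact: join_def|exact: join_def| |].
  by move=> k; rewrite /join; case: ifP.
move=> x rx [/(cP x rx) [k hk]|/(cQ x rx) [k hk]].
  by exists (k + k); rewrite !join_even.
by exists (k + k + 1); rewrite !join_odd.
Qed.

Lemma count1 (r s : K) p n : named r -> named s -> r <= s ->
  Sum (fun i => if `[< r < dy p i /\ dy p (i + 1) < s >] then h p else 0) n <= s - r.
Proof.
move=> nr ns rs; set f := fun i => _.
have df : DefR1 f by rewrite /f; dfn.
(* The second conjunct makes the bound inductive: the cells counted so far lie between r and
   [dy p n], unless none has been counted. *)
suff : Sum f n <= s - r /\ (Sum f n <= dy p n - r \/ Sum f n = 0) by case.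
apply: (ind (P := fun n => Sum f n <= s - r /\ (Sum f n <= dy p n - r \/ Sum f n = 0))) n.
- by dfn.
- by rewrite Sum0 //; split; [lra|right].
- move=> n [h1 h2]; rewrite SumS // /f; have hp := h_gt0 K p.
  rewrite dyS; case: asboolP => [[l1]|_]; last first.
    by rewrite addr0; split=> //; case: h2 => h2; [left; lra|right].
  by move=> l2; split; [|left]; case: h2 => h2; lra.
Qed.

Definition inside a b n p i := exists k, olt k n /\ (a k < dy p i /\ dy p (i + 1) < b k).

(** Induction over the intervals: by [count1] a new interval contributes cells of total length at
    most its own. *)
Lemma count a b n p m : DefR1 a -> DefR1 b -> (forall k, a k <= b k) ->
  Sum (fun i => if `[< inside a b n p i >] then h p else 0) m <= Sum (len a b) n.
Proof.
move=> da db ab; rewrite /inside; have dl := len_def da db.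
apply: (ind (P := fun n => Sum (fun i => if `[< exists k, olt k n /\
  (a k < dy p i /\ dy p (i + 1) < b k) >] then h p else 0) m <= Sum (len a b) n)) n.
- by dfn.
- rewrite Sum0 //; apply: (@le_trans _ _ (Sum (fun _ => 0) m)).
    apply: Sum_le; [by dfn|by dfn|move=> i].
    by rewrite asboolF // => -[k [/olt_n0]].
  by rewrite Sum_zero.
- move=> n IH; rewrite SumS //.
  have na := DefR1_named n da; have nb := DefR1_named n db.
  apply: le_trans (lerD IH (count1 p m na nb (ab n))); rewrite -Sum_add; [|by dfn|by dfn].
  apply: Sum_le; [by dfn|by dfn|move=> i].
  have hp := h_gt0 K p; case: asboolP => [[k [/olt_S [->|l] hk]]|_].
  + by rewrite [in X in _ <= _ + X]asboolT //; case: asboolP => _; lra.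
  + by rewrite asboolT; [case: asboolP => _; lra|exists k].
  + by case: asboolP => _; case: asboolP => _; lra.
Qed.

(** Collection for finitely many cells. Finite is meant in the sense of M, so the bound is found by
    definable induction on n. *)
Lemma inside_bound a b p n : DefR1 a -> DefR1 b ->
  (forall i, olt i n -> exists k, a k < dy p i /\ dy p (i + 1) < b k) ->
  exists m, forall i, olt i n -> inside a b m p i.
Proof.
move=> da db; rewrite /inside.
apply: (ind (P := fun n => (forall i, olt i n -> exists k, a k < dy p i /\ dy p (i + 1) < b k) ->
  exists m, forall i, olt i n -> exists k, olt k m /\ (a k < dy p i /\ dy p (i + 1) < b k))) n.
- by dfn.
- by move=> _; exists 0 => i /olt_n0.
- move=> n IH H; have [|m hm] := IH; first by move=> i l; apply: H; apply: olt_trans l (oltS _).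
  have [k hk] := H n (oltS _); exists (m + (k + 1)) => i /olt_S [->|l].
    exists k; split=> //; rewrite addrA; apply/olt_S; case: (ole0 m) => [<-|l]; first by left; rewrite add0r.
    by right; have := olt_addl k l; rewrite addr0 addrC.
  have [k' [l' h']] := hm i l; exists k'; split=> //; apply: olt_trans l' _.
  by have := olt_addl m (olt0S k); rewrite addr0.
Qed.

(** It suffices that 2^(-p) is less than the distance of x to both ends. The claim covers all finer
    levels, so that it can be combined with a level chosen for another purpose. *)
Lemma cell_inside x (r s : K) : isreal x -> r < V x < s ->
  exists p, forall q i, inD K (p + q) i x -> r < dy (p + q) i /\ dy (p + q) (i + 1) < s.
Proof.
move=> rx /andP[l1 l2]; rewrite -subr_gt0 in l1; rewrite -subr_gt0 in l2.
have [p1 h1] := h_small l1; have [p2 h2] := h_small l2.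
exists (p1 + p2) => q i; rewrite /inD dyS => /andP[h3 h4].
have := h_le K p1 (p2 + q); have := h_le K p2 (p1 + q).
have -> : p2 + (p1 + q) = p1 + p2 + q by ring.
have -> : p1 + (p2 + q) = p1 + p2 + q by ring.
by split; lra.
Qed.

(** A cell counts as good if a single interval contains it together with its end-points. This is
    inherited by halves and holds near every point of [0,1]. *)
Lemma subdivision a b : covers_by a b in01 ->
  exists p n, forall i, olt i (dpow2 p) -> inside a b n p i.
Proof.
move=> [da db ab cov]; pose good p i := exists k, a k < dy p i /\ dy p (i + 1) < b k.
have dg : DefP2 (A := tN) (B := tN) good by rewrite /good; dfn.
have [|x rx hx|p hp] := @compactness01 M K good dg.
- move=> m j [k [l1 l2]]; rewrite dyS in l2; have hm := h_gt0 K m; split; exists k.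
    by rewrite dyS dy_double hS; split; lra.
  by rewrite !dyS dy_double hS; split; lra.
- have [k hk] := cov x rx hx; have [p hp] := cell_inside rx hk.
  by exists p => i; have := hp 0 i; rewrite addr0 => H /H; exists k.
by have [n hn] := inside_bound da db hp; exists p, n.
Qed.

(** The 2^p cells of the level given by [subdivision] have total length 1, and [count] bounds this
    by the sum of the lengths. *)
Theorem cover_measure a b : covers_by a b in01 -> exists n, 1 <= Sum (len a b) n.
Proof.
move=> cov; have [p [n hn]] := subdivision cov; have [da db ab _] := cov; exists n.
apply: le_trans (count n p (dpow2 p) da db ab).
rewrite -[X in X <= _](dy_pow2 K p) -Sum_h; apply: Sum_le_lt; [by dfn| |].
  by rewrite /inside; dfn.
by move=> i l; rewrite asboolT //; apply: hn.
Qed.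

Lemma finite_subcover a b : covers_by a b in01 ->
  exists n, forall x, isreal x -> in01 x -> exists k, olt k n /\ a k < V x < b k.
Proof.
move=> cov; have [p [n hn]] := subdivision cov; exists n => x rx h01.
have [i [l /andP[h1 h2]]] := locate01 p rx h01; have [k [lk [h3 h4]]] := hn i l.
by exists k; split=> //; apply/andP; split; lra.
Qed.

End Sums.

(** * Closed sets are measurable *)

Section ClosedSets.
Variables (M : model) (K : completion M).
Local Notation N := (ocar (semiring_of M)).
Local Notation name := (dom M t1).
Local Notation V := (V K).
Local Notation isreal := (isreal K).
Local Notation ι := (@cι M K).
Local Notation dy := (@dy M K).
Local Notation h := (@h M K).
Local Notation DefR1 := (@DefR1 M K tN).
Local Notation in01 := (@in01 M K).
Local Notation qv := (qv K).
Implicit Types Γ : ctx.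
Implicit Types i j k m n p q : N.
Implicit Types a b c d α β : N -> K.

(** The search operator decides membership and so gives a characteristic function with values 1 and
    0. Stated with [dlt], the condition is definable on all elements of type 1, names of reals or
    not. *)
Lemma closed_set (A B : name) : exists Y : dom M (t1 ~> t1), dfun_R K Y /\
  forall x, isreal x -> dmem K Y x <-> in01 x /\ ~ exists n : N, qv (A • n) < V x < qv (B • n).
Proof.
pose P x := [/\ ~ dlt K x (dconst (dmkQ 0 0 0)), ~ dlt K (dconst (dmkQ 1 0 0)) x
  & ~ exists n : N, dlt K (dconst (A • n)) x /\ dlt K x (dconst (B • n))].
have dc Γ (f : env M Γ -> N) : Def f -> Def (fun ρ => dconst (f ρ)).
  by move=> df; rewrite /dconst; dfn.
have dP : DefP1 P.
  apply: (@DefP_ext _ _ (fun q : env M [:: t1] => ~ dlt K (q t1 vz) (dconst (dmkQ 0 0 0)) /\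
    (~ dlt K (dconst (dmkQ 1 0 0)) (q t1 vz) /\
     ~ exists n : N, dlt K (dconst (A • n)) (q t1 vz) /\ dlt K (q t1 vz) (dconst (B • n))))) => [ρ|].
    by rewrite /P; split=> [[? []]|[]].
  by dfn; apply: dc; dfn.
have PP x : isreal x -> P x <-> in01 x /\ ~ exists n : N, qv (A • n) < V x < qv (B • n).
  move=> rx; have c q := dconst_real K q.
  have e1 n : dlt K (dconst (A • n)) x <-> qv (A • n) < V x by rewrite dltP // V_const.
  have e2 n : dlt K x (dconst (B • n)) <-> V x < qv (B • n) by rewrite dltP // V_const.
  have e3 : dlt K x (dconst (dmkQ 0 0 0)) <-> V x < 0 by rewrite dltP // V_rzero.
  have e4 : dlt K (dconst (dmkQ 1 0 0)) x <-> 1 < V x by rewrite dltP // V_rone.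
  rewrite /P /in01; split.
    move=> [/e3 /negP n1 /e4 /negP n2 n3]; rewrite -leNgt in n1; rewrite -leNgt in n2.
    rewrite n1 n2; split=> // -[n /andP[/e1 l1 /e2 l2]]; by apply: n3; exists n.
  move=> [/andP[l1 l2] n3]; split.
  - by move/e3; rewrite ltNge l1.
  - by move/e4; rewrite ltNge l2.
  - by move=> [n [/e1 h1 /e2 h2]]; apply: n3; exists n; rewrite h1.
pose F (x : name) : name := if `[< P x >] then dconst (dmkQ 1 0 0) else dconst (dmkQ 0 0 0).
have dF : Def1 F by apply: Def_ite1 => //; apply: dc; dfn.
have FE x : LAM F • x = F x by rewrite LAME.
have rF x : isreal (F x) by rewrite /F; case: ifP => _; exact: dconst_real.
have VF x : V (F x) = if `[< P x >] then 1 else 0.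
  by rewrite /F; case: ifP => _; rewrite ?V_rone ?V_rzero.
exists (LAM F); split; last first.
  move=> x rx; rewrite dmemP FE // VF -(PP x rx).
  by case: asboolP => p; rewrite ?ltxx ?ltr01.
split=> [x _|x y rx ry e]; first by rewrite FE.
rewrite !FE !VF; congr (if `[< _ >] then _ else _); apply: propext.
by rewrite !PP // /in01 e.
Qed.

(* Otherwise the sum increases by h s after every index, and exceeds B by induction
   on the number of increases. *)
Lemma small_tail a (B e : K) : DefR1 a -> (forall k, 0 <= a k) -> (forall n, Sum a n <= B) ->
  0 < e -> exists n, forall m, Sum a (n + m) <= Sum a n + e.
Proof.
move=> da a0 aB e0; have [s hs] := h_small e0.
suff [n hn] : exists n, forall m, ~ Sum a n + h s < Sum a (n + m).
  by exists n => m; have /negP := hn m; rewrite -leNgt => /le_trans -> //; rewrite lerD2l ltW.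
apply: contrapT => H.
have {}H n : exists m, Sum a n + h s < Sum a (n + m).
  by apply: contrapT => H'; apply: H; exists n => m l; apply: H'; exists m.
have G j : exists n, dy s j <= Sum a n.
  apply: (ind (P := fun j => exists n, dy s j <= Sum a n)) j; first by dfn.
    by exists 0; rewrite dy0 Sum0.
  move=> j [n hn]; have [m hm] := H n; exists (n + m); rewrite dyS; lra.
have p0 : 0 < h s / (`|B| + 1) by rewrite divr_gt0 ?h_gt0 // ltr_wpDl.
have [j _ hj] := carch p0; have [n hn] := G j; have := aB n.
rewrite mulrA ltr_pdivlMr ?mul1r in hj; last by rewrite ltr_wpDl.
by rewrite -/(dy s j) in hj; have := ler_norm B; lra.
Qed.

Lemma Sum_head_le a n k : DefR1 a -> (forall k, 0 <= a k) ->
  Sum (fun i => if `[< olt i k >] then a i else 0) n <= Sum a k.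
Proof.
move=> da a0; set f := fun i => _; have df : DefR1 f by rewrite /f; dfn.
have fa m : Sum f m <= Sum a m by apply: Sum_le => // i; rewrite /f; case: ifP.
have f0 i : 0 <= f i by rewrite /f; case: ifP.
have [l|[->|/olt_sub [d _ ->]]] := olt_total n k; last first.
- apply: (ind (P := fun j => Sum f (k + j) <= Sum a k)) d.
  + by dfn.
  + by rewrite addr0.
  + move=> j IH; rewrite addrA SumS // {2}/f asboolF ?addr0 //.
    case: (ole0 j) => [<-|l]; first by rewrite addr0; exact: olt_irr.
    by move=> l'; have := olt_addl k l; rewrite addr0 => /olt_trans /(_ l') /olt_irr.
- exact: fa.
- have [d _ ->] := olt_sub l; exact: le_trans (fa n) (Sum_mono _ _ _ _).
Qed.

Lemma Sum_tail_le a n k (e : K) : DefR1 a -> (forall k, 0 <= a k) ->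
  (forall m, Sum a (k + m) <= Sum a k + e) ->
  Sum (fun i => if `[< olt i k >] then 0 else a i) n <= e.
Proof.
move=> da a0 H; set f := fun i => _; have df : DefR1 f by rewrite /f; dfn.
have f0 i : 0 <= f i by rewrite /f; case: ifP.
apply: (@le_trans _ _ (Sum f (k + n))); first by rewrite addrC; apply: Sum_mono.
suff -> : Sum f (k + n) = Sum a (k + n) - Sum a k by rewrite lerBlDl.
apply: (ind (P := fun n => Sum f (k + n) = Sum a (k + n) - Sum a k)) n.
- by dfn.
- rewrite addr0 subrr -(Sum_zero K k); apply: Sum_eq_lt => //; first by dfn.
  by move=> i l; rewrite /f asboolT.
- move=> n IH; rewrite addrA !SumS // IH {1}/f asboolF; first by rewrite addrAC.
  case: (ole0 n) => [<-|l]; first by rewrite addr0; exact: olt_irr.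
  by move=> l'; have := olt_addl k l; rewrite addr0 => /olt_trans /(_ l') /olt_irr.
Qed.

(** A selected cell is widened to an open interval; for all 2^n cells together this costs 2 h u. The
    other indices get the empty interval (0, 0). *)
Definition cellL (P : N -> Prop) n u i : K := if `[< P i >] then dy n i - h (n + u) else 0.
Definition cellR (P : N -> Prop) n u i : K := if `[< P i >] then dy n (i + 1) + h (n + u) else 0.

Lemma cells_cover (P : N -> Prop) n u (Q : name -> Prop) : DefP1 (A := tN) P ->
  (forall x, isreal x -> Q x -> exists i, P i /\ inD K n i x) ->
  covers_by (cellL P n u) (cellR P n u) Q.
Proof.
move=> dP H; split; [by rewrite /cellL; dfn|by rewrite /cellR; dfn| |].
  move=> k; rewrite /cellL /cellR; case: ifP => // _; rewrite dyS.
  by have := h_gt0 K n; have := h_gt0 K (n + u); lra.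
move=> x rx /(H x rx) [i [p /andP[l1 l2]]]; exists i; rewrite /cellL /cellR asboolT //.
by have := h_gt0 K (n + u) => ?; apply/andP; split; lra.
Qed.

Lemma cells_len (P : N -> Prop) n u i : len (cellL P n u) (cellR P n u) i =
  if `[< P i >] then h n + (h (n + u) + h (n + u)) else 0.
Proof. by rewrite /len /cellL /cellR; case: ifP => _; rewrite ?dyS ?subr0 //; ring. Qed.

(* Up to a tail of length e, the removed set consists of the first k intervals. At
   a fine level n, they are covered by the dyadic cells that they contain and by
   neighbourhoods of their 2k end-points; the other cells cover the closed set. *)
Theorem closed_meas α β (B : K) : DefR1 α -> DefR1 β -> (forall k, α k <= β k) ->
  (forall n, Sum (len α β) n <= B) ->
  meas K (fun x => in01 x /\ ~ exists k, α k < V x < β k).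
Proof.
move=> dα dβ αβ hB δ nδ δ0; have dl : DefR1 (len α β) by apply: len_def.
have l0 k : 0 <= len α β k by apply: len_ge0.
have e0 : 0 < δ / 2 by lra.
have [k hk] := small_tail dl l0 hB e0; have e1 : 0 < δ / 32 by lra.
(* The cells will cost 1 + 2 h t, the neighbourhoods of the 2k end-points 8 h t, as each has length
   4 h n and k h n is at most h t, and the tail δ / 2. With h t below δ / 32 the total stays below 1
   + δ. *)
have [t ht] := h_small e1; pose n := k + t.
have kn : dy n k <= h t by exact: dy_small_index.
pose good i := olt i (dpow2 n) /\ inside α β k n i.
pose bad i := olt i (dpow2 n) /\ ~ inside α β k n i.
have dg : DefP1 (A := tN) good by rewrite /good /inside; dfn.
have db : DefP1 (A := tN) bad by rewrite /bad /inside; dfn.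
pose αl i := if `[< olt i k >] then α i - (h n + h n) else α i.
pose αr i := if `[< olt i k >] then α i + (h n + h n) else α i.
pose βl i := if `[< olt i k >] then β i - (h n + h n) else β i.
pose βr i := if `[< olt i k >] then β i + (h n + h n) else β i.
(* The first k intervals collapse to their right ends, so that only the tail keeps its length. *)
pose tl i := if `[< olt i k >] then β i else α i.
have dαl : DefR1 αl by rewrite /αl; dfn.
have dαr : DefR1 αr by rewrite /αr; dfn.
have dβl : DefR1 βl by rewrite /βl; dfn.
have dβr : DefR1 βr by rewrite /βr; dfn.
have dtl : DefR1 tl by rewrite /tl; dfn.
have hn := h_gt0 K n.
pose near γ x := exists i, olt i k /\ γ i - (h n + h n) < V x < γ i + (h n + h n).
have cα : covers_by αl αr (near α).
  split=> // [i|x rx [i [l hx]]]; first by rewrite /αl /αr; case: ifP => _; lra.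
  by exists i; rewrite /αl /αr asboolT.
have cβ : covers_by βl βr (near β).
  split=> // [i|x rx [i [l hx]]]; first by rewrite /βl /βr; case: ifP => _; lra.
  by exists i; rewrite /βl /βr asboolT.
have ct : covers_by tl β (fun x => exists i, ~ olt i k /\ α i < V x < β i).
  split=> // [i|x rx [i [l hx]]]; first by rewrite /tl; case: ifP.
  by exists i; rewrite /tl asboolF.
have cg : covers_by (cellL good n t) (cellR good n t) (fun x => exists i, good i /\ inD K n i x).
  by apply: cells_cover.
exists (cellL bad n t), (cellR bad n t).
exists (join (cellL good n t) (join (join αl βl) tl)).
exists (join (cellR good n t) (join (join αr βr) β)).
have cov := covers_join cg (covers_join (covers_join cα cβ) ct); split.
- apply: cells_cover => // x rx [h01 hx]; have [i [l hi]] := locate01 n rx h01.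
  exists i; split=> //; split=> // -[j [_ [h1 h2]]]; apply: hx; exists j.
  by move: hi => /andP[h3 h4]; apply/andP; split; lra.
- case: cov => d1 d2 d3 d4; split=> // x rx [h01 nx]; apply: d4 => //.
  have [j hj] : exists j, α j < V x < β j by apply: contrapT => e; apply: nx.
  have [lj|lj] := pselect (olt j k); last by right; right; exists j.
  have [i [l hi]] := locate01 n rx h01; have hi' := hi; move: hi' hj => /andP[h1 h2] /andP[h3 h4].
  (* If an end-point of interval j lies in the cell of x, then x is within h n of it; the radius 2 h
     n leaves room for open intervals. *)
  rewrite dyS in h2; have [l1|l1] := ltP (α j) (dy n i); last first.
    by right; left; left; exists j; split=> //; apply/andP; split; lra.
  have [l2|l2] := ltP (dy n (i + 1)) (β j); last first.
    by rewrite dyS in l2; right; left; right; exists j; split=> //; apply/andP; split; lra.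
  by left; exists i; split=> //; split=> //; exists j.
- move=> m1 m2; rewrite !len_join.
  have Lb0 P i : 0 <= len (cellL P n t) (cellR P n t) i.
    by rewrite cells_len; have ? := h_gt0 K (n + t); case: ifP => // _; lra.
  have db' : DefR1 (len (cellL bad n t) (cellR bad n t)).
    by apply: len_def; rewrite /cellL /cellR; dfn.
  have dg' : DefR1 (len (cellL good n t) (cellR good n t)).
    by apply: len_def; rewrite /cellL /cellR; dfn.
  have lα : len αl αr = fun i => if `[< olt i k >] then (h n + h n) + (h n + h n) else 0.
    by apply: funext => i; rewrite /len /αl /αr; case: ifP => _; ring.
  have lβ : len βl βr = fun i => if `[< olt i k >] then (h n + h n) + (h n + h n) else 0.
    by apply: funext => i; rewrite /len /βl /βr; case: ifP => _; ring.
  have lt : len tl β = fun i => if `[< olt i k >] then 0 else len α β i.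
    by apply: funext => i; rewrite /len /tl; case: ifP => _; rewrite ?subrr.
  have dlα : DefR1 (len αl αr) by apply: len_def.
  have dlβ : DefR1 (len βl βr) by apply: len_def.
  have dlt : DefR1 (len tl β) by apply: len_def.
  have dh : DefR1 (fun _ => (h n + h n) + (h n + h n)) by dfn.
  have hb : Sum (fun i => if `[< olt i k >] then (h n + h n) + (h n + h n) else 0) m2 <= 4 * h t.
    apply: le_trans (Sum_head_le m2 k dh _) _; first by move=> _; lra.
    rewrite 3?Sum_add ?Sum_h; [lra|by dfn..].
  have j1 : Sum (join (join (len αl αr) (len βl βr)) (len tl β)) m2 <= 8 * h t + δ / 2.
    have h0 i : 0 <= len αl αr i by rewrite lα; case: ifP => _; lra.
    have h0' i : 0 <= len βl βr i by rewrite lβ; case: ifP => _; lra.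
    have h0'' i : 0 <= len tl β i by rewrite lt; case: ifP.
    apply: le_trans (Sum_join_le m2 (join_def dlα dlβ) dlt _ h0'') _.
      by move=> i; rewrite /join; case: ifP.
    have h1 := Sum_join_le m2 dlα dlβ h0 h0'.
    have h2 : Sum (len tl β) m2 <= δ / 2 by rewrite lt; exact: Sum_tail_le.
    rewrite {2}lα {2}lβ in h1; lra.
  have j0 i : 0 <= join (join (len αl αr) (len βl βr)) (len tl β) i.
    have ? := l0 (half i); rewrite /join lα lβ lt.
    by case: ifP => _; [case: ifP => _|]; case: ifP => _; rewrite ?l0 //; lra.
  have dj : DefR1 (join (join (len αl αr) (len βl βr)) (len tl β)).
    by apply: join_def => //; apply: join_def.
  have h1 := Sum_join_le m2 dg' dj (Lb0 good) j0.
  (* The two partial sums may have different lengths. Both are extended to m1 + m2, where the good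
     and the bad cells together make up all cells of level n. *)
  have h2 := Sum_mono m1 m2 db' (Lb0 bad).
  have h3 := Sum_mono m2 m1 dg' (Lb0 good); rewrite addrC in h3.
  have h4 := Sum_add (m1 + m2) db' dg'.
  have E : (fun i => len (cellL bad n t) (cellR bad n t) i + len (cellL good n t) (cellR good n t) i)
      = fun i => if `[< olt i (dpow2 n) >] then h n + (h (n + t) + h (n + t)) else 0.
    apply: funext => i; rewrite !cells_len /good /bad.
    have [l|l] := pselect (olt i (dpow2 n)); have [b|b] := pselect (inside α β k n i).
    - by rewrite asboolF ?asboolT ?add0r //; case.
    - by rewrite asboolT // asboolF ?asboolT ?addr0 //; case.
    - by rewrite !asboolF ?addr0 //; case.
    - by rewrite !asboolF ?addr0 //; case.
  rewrite E in h4; have dw : DefR1 (fun _ => h n + (h (n + t) + h (n + t))) by dfn.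
  have w0 : 0 <= h n + (h (n + t) + h (n + t)) by have := h_gt0 K (n + t); lra.
  have h5 : Sum (fun i => if `[< olt i (dpow2 n) >] then h n + (h (n + t) + h (n + t)) else 0)
      (m1 + m2) <= 1 + (h t + h t).
    apply: le_trans (Sum_head_le _ _ dw (fun _ => w0)) _.
    have e2 : dy (n + t) (dpow2 n) = h t by rewrite /dy hD mulrA ι_h mul1r.
    by rewrite 2?Sum_add ?Sum_h ?dy_pow2 ?e2 //; dfn.
  lra.
Qed.
End ClosedSets.

(** * Closed sets of continuity *)

Section Lusin.
Variables (M : model) (K : completion M).
Local Notation N := (ocar (semiring_of M)).
Local Notation name := (dom M t1).
Local Notation V := (V K).
Local Notation isreal := (isreal K).
Local Notation ι := (@cι M K).
Local Notation dy := (@dy M K).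
Local Notation h := (@h M K).
Local Notation DefR1 := (@DefR1 M K tN).
Local Notation in01 := (@in01 M K).
Local Notation qv := (qv K).
Implicit Types i j k m n p q : N.
Implicit Types x y : name.
Implicit Types a b c d : N -> K.

(** The k-th end-points are approximated to within h (k + s) and moved outwards by that much. Each
    interval grows by at most 4 h (k + s), and the series sums to 8 h s. *)
Lemma outer_rational c d (s : N) : DefR1 c -> DefR1 d ->
  exists A B : name, [/\ forall k : N, qv (A • k) <= c k, forall k : N, d k <= qv (B • k)
    & forall n, Sum (len (fun k => qv (A • k)) (fun k => qv (B • k))) n
        <= Sum (len c d) n + 8 * h s].
Proof.
move=> dc dd; have [zc zcP] := DefR1_name dc; have [zd zdP] := DefR1_name dd.
pose A : name := LAM (fun k : N => dqadd (zc • k • (k + s)) (dqopp (dqpow2 (k + s)))).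
pose B : name := LAM (fun k : N => dqadd (zd • k • (k + s)) (dqpow2 (k + s))).
have AE k : qv (A • k) = xq K (zc • k) (k + s) - h (k + s).
  have e : A • k = dqadd (zc • k • (k + s)) (dqopp (dqpow2 (k + s))) by apply: LAME; dfn.
  by rewrite e qv_add qv_opp qv_pow2 /xq.
have BE k : qv (B • k) = xq K (zd • k) (k + s) + h (k + s).
  have e : B • k = dqadd (zd • k • (k + s)) (dqpow2 (k + s)) by apply: LAME; dfn.
  by rewrite e qv_add qv_pow2 /xq.
have hA k : c k - (h (k + s) + h (k + s)) <= qv (A • k) <= c k.
  have [rz <-] := zcP k; rewrite AE.
  by have := V_near (k + s) rz; rewrite ler_distl => /andP[? ?]; apply/andP; split; lra.
have hB k : d k <= qv (B • k) <= d k + (h (k + s) + h (k + s)).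
  have [rz <-] := zdP k; rewrite BE.
  by have := V_near (k + s) rz; rewrite ler_distl => /andP[? ?]; apply/andP; split; lra.
have dA : DefR1 (fun k => qv (A • k)) by dfn.
have dB : DefR1 (fun k => qv (B • k)) by dfn.
have dl : DefR1 (len c d) by apply: len_def.
have dl' : DefR1 (len (fun k => qv (A • k)) (fun k => qv (B • k))) by apply: len_def.
exists A, B; split=> [k|k|n]; [by case/andP: (hA k)|by case/andP: (hB k)|].
(* The invariant adds the rest 8 h (s + n) of the geometric series, written out as a sum because
   [dfn] does not treat products in K. *)
suff : Sum (len (fun k => qv (A • k)) (fun k => qv (B • k))) n +
    (h (s + n) + h (s + n) + (h (s + n) + h (s + n)) + (h (s + n) + h (s + n) + (h (s + n) + h (s + n))))
    <= Sum (len c d) n + (h s + h s + (h s + h s) + (h s + h s + (h s + h s))).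
  by have := h_gt0 K (s + n); lra.
apply: (ind (P := fun n => Sum (len (fun k => qv (A • k)) (fun k => qv (B • k))) n +
    (h (s + n) + h (s + n) + (h (s + n) + h (s + n)) + (h (s + n) + h (s + n) + (h (s + n) + h (s + n))))
    <= Sum (len c d) n + (h s + h s + (h s + h s) + (h s + h s + (h s + h s))))) n.
- by dfn.
- by rewrite !Sum0 // addr0 add0r.
- move=> {}n IH; have e : s + (n + 1) = s + n + 1 by exact: addrA.
  have el : len (fun k => qv (A • k)) (fun k => qv (B • k)) n = qv (B • n) - qv (A • n) by [].
  have el' : len c d n = d n - c n by [].
  rewrite !SumS // e hS; have := hA n; have := hB n; rewrite [n + s]addrC => /andP[? ?] /andP[? ?].
  by lra.
Qed.

Definition represented (A B : name) (Y : dom M (t1 ~> t1)) := forall x, isreal x ->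
  dmem K Y x <-> in01 x /\ ~ exists n : N, qv (A • n) < V x < qv (B • n).

(** The factor 3: Y has measure at least 1 - h s, and Y with its complement has covers of total at
    most 1 + h s, so the complement is covered by at most 2 h s. Rational end-points add another h
    s. *)
Theorem lusin_closed f s (r : K) Y : dlusin f (h s) Y -> 3 * h s <= r ->
  exists Y' A B, [/\ dlusin f r Y', represented A B Y' & forall k : N, qv (A • k) <= qv (B • k)].
Proof.
move=> [fY [Y01 [mY [gY cY]]]] hr; have hs := h_gt0 K s.
have [a [b [c [d [cab ccd hsum]]]]] := mY (h s) (named_h K s) hs.
have [da db ab _] := cab; have [dc dd cd cdP] := ccd.
have hcd m : Sum (len c d) m <= 2 * h s.
  rewrite leNgt; apply/negP => l.
  (* If the cover of the complement exceeded 2 h s, this number would lie below 1 - h s, so the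
     cover of Y would exceed it, against [hsum]. *)
  have [||n hn] := gY a b cab (1 + h s - Sum (len c d) m).
  - have := len_def dc dd; have := named1 K => ? ?.
    by repeat first [apply: namedB|apply: namedD|apply: named_h|apply: named_Sum|assumption].
  - by lra.
  - by have := hsum n m; lra.
(* Three more levels turn the loss of 8 h (s + 3) into h s. *)
have [A [B [hA hB hAB]]] := outer_rational (s + 1 + 1 + 1) dc dd.
have [Y' [fY' Y'P]] := closed_set K A B.
have AB k : qv (A • k) <= qv (B • k) by apply: le_trans (hA k) (le_trans (cd k) (hB k)).
have dA : DefR1 (fun k => qv (A • k)) by dfn.
have dB : DefR1 (fun k => qv (B • k)) by dfn.
have dl : DefR1 (len (fun k => qv (A • k)) (fun k => qv (B • k))) by apply: len_def.
have l3 n : Sum (len (fun k => qv (A • k)) (fun k => qv (B • k))) n <= 3 * h s.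
  by have := hAB n; have := hcd n; rewrite 3!hS; lra.
have sub x : isreal x -> dmem K Y' x -> dmem K Y x.
  move=> rx /(Y'P x rx) [h01 nx]; apply: contrapT => nY; apply: nx.
  have [k /andP[h1 h2]] := cdP x rx (conj h01 nY); exists k.
  by apply/andP; split; [apply: le_lt_trans (hA k) h1|apply: lt_le_trans h2 (hB k)].
exists Y', A, B; split=> //; split=> //; split; first by move=> x rx /(Y'P x rx) [].
split; [|split].
- apply: (@meas_ext _ _ (fun x => in01 x /\ ~ exists k : N, qv (A • k) < V x < qv (B • k))).
    by move=> x rx; apply: iff_sym; apply: Y'P.
  exact: (closed_meas dA dB AB l3).
(* A cover of the new set joined with the removed intervals covers [0,1] and has length at least 1,
   of which the removed part accounts for at most 3 h s. *)
- move=> a' b' cab' t nt tr; have [da' db' ab' abP] := cab'.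
  have cov : covers_by (join a' (fun k => qv (A • k))) (join b' (fun k => qv (B • k))) in01.
    have h2 : covers_by (fun k => qv (A • k)) (fun k => qv (B • k))
        (fun x => exists k : N, qv (A • k) < V x < qv (B • k)) by split.
    have [j1 j2 j3 j4] := covers_join cab' h2; split=> // x rx h01; apply: j4 => //.
    have [e|e] := pselect (exists k : N, qv (A • k) < V x < qv (B • k)); first by right.
    by left; apply/Y'P.
  have [n hn] := cover_measure cov; exists n; rewrite len_join in hn.
  have := Sum_join_le n (len_def da' db') dl (fun i => len_ge0 i ab') (fun i => len_ge0 i AB).
  by have := l3 n; lra.
- move=> x rx mx e re e0; have [δ [rδ δ0 H]] := cY x rx (sub x rx mx) e re e0.
  by exists δ; split=> // y ry my; apply: H => //; apply: sub.
Qed.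

(* [good] cells avoid Y, so [point good p i] lies in Y as soon as the cell i of
   level p meets Y. *)
Section Balls.
Variables (Ψ : dom M (t1 ~> t1)) (A B : name) (Y : dom M (t1 ~> t1)).
Hypothesis Ψpos : forall x, isreal x -> in01 x -> isreal (Ψ • x) /\ 0 < V (Ψ • x).
Hypothesis repr : represented A B Y.
Hypothesis AB : forall k : N, qv (A • k) <= qv (B • k).
Hypothesis cont : dcont K Ψ Y.

Let good p i := exists k : N, qv (A • k) < dy p i /\ dy p (i + 1) < qv (B • k).

Let good_def : DefP2 (A := tN) (B := tN) good.
Proof. by rewrite /good; dfn. Qed.

Let good_half m j : good m j -> good (m + 1) (j + j) /\ good (m + 1) (j + j + 1).
Proof.
move=> [k [l1 l2]]; rewrite dyS in l2; have hm := h_gt0 K m; split; exists k.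
  by rewrite dyS dy_double hS; split; lra.
by rewrite !dyS dy_double hS; split; lra.
Qed.

(** The number n codes a level and an index. An index beyond the level is replaced by 0, so that
    every point lies in [0,1]. *)
Let pt n : name := point good (dfst n)
  (if `[< olt (dsnd n) (dpow2 (dfst n)) >] then dsnd n else 0).

Let pt_def : Def1 (A := tN) pt.
Proof.
rewrite /pt; apply: Def_point => //; dfn.
Qed.

Lemma cell_in01 p i x : isreal x -> olt i (dpow2 p) -> inD K p i x -> in01 x.
Proof.
move=> rx l /andP[h1 h2]; have := dy_ge0 K p i.
have : dy p (i + 1) <= dy p (dpow2 p) by apply: dy_le; apply: olt_add.
by rewrite dy_pow2 => ? ?; apply/andP; split; lra.
Qed.

Let pt_real n : isreal (pt n).
Proof. exact: point_real. Qed.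

Let pt01 n : in01 (pt n).
Proof.
have := pt_real n; rewrite /pt; case: asboolP => [l|_] r.
  exact: (cell_in01 r l (point_inD K good_def _ _)).
exact: (cell_in01 r (dpow2_gt0 _) (point_inD K good_def _ _)).
Qed.

(** A cell that contains a point of Y is not covered, so its point lies in a cell that is not good
    at every finer level. In a removed interval, all sufficiently small cells around it would be
    good. *)
Lemma point_mem p i x : isreal x -> dmem K Y x -> olt i (dpow2 p) -> inD K p i x ->
  dmem K Y (point good p i).
Proof.
move=> rx mx l hx; have [h01 nx] := proj1 (repr rx) mx.
have nc : ~ cov good p i.
  move=> [q hq]; have [j [lj /andP[h1 h2]]] := locate q rx hx; have [k [l1 l2]] := hq j lj.
  by apply: nx; exists k; apply/andP; split; lra.
have rp : isreal (point good p i) by exact: point_real.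
apply/repr => //; split.
  exact: (cell_in01 rp l (point_inD K good_def _ _)).
move=> [k hk]; have [q hq] := cell_inside rp hk.
have [j [ng hj]] := point_not_good K good_def good_half q nc; apply: ng; exists k.
by have := hq p j; rewrite [q + p]addrC; apply.
Qed.

Lemma near_point x : isreal x -> dmem K Y x ->
  exists n, V (pt n) - V (Ψ • pt n) < V x < V (pt n) + V (Ψ • pt n).
Proof.
move=> rx mx; have [h01 _] := proj1 (repr rx) mx; have [rΨ Ψ0] := Ψpos rx h01.
(* Let y be the point of a cell of x so small that continuity gives |Ψ(x) - Ψ(y)| < h t and that |x
   - y| is at most h t. Then Ψ(y) > Ψ(x) / 2 > |x - y|. *)
have [t ht] : exists t, h t < V (Ψ • x) / 2 by apply: h_small; lra.
have re := dconst_real K (dqpow2 t).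
have ve : V (dconst (dqpow2 t)) = h t by rewrite V_const qv_pow2.
have [|δ [rδ δ0 H]] := cont rx mx re; first by rewrite ve h_gt0.
have [q hq] := h_small δ0; pose p := q + t.
have [i [l hi]] := locate01 p rx h01.
have rp : isreal (point good p i) by exact: point_real.
have mp := point_mem rx mx l hi; have [p01 _] := proj1 (repr rp) mp.
have [rΨp _] := Ψpos rp p01.
have hpq : h p <= h q by exact: h_le.
have hpt : h p <= h t by rewrite /p addrC; exact: h_le.
have /andP[h1 h2] := point_inD K good_def p i; have /andP[h3 h4] := hi.
rewrite dyS in h2 h4.
have := H _ rp mp; rewrite ltr_distlC => H'.
have {H'} : dlt K (drabs (dradd (Ψ • x) (dropp (Ψ • point good p i)))) (dconst (dqpow2 t)).
  by apply: H'; apply/andP; split; lra.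
rewrite dltP // ?ve; last by apply: drabs_real; apply: dradd_real => //; apply: dropp_real.
rewrite V_abs; last by apply: dradd_real => //; apply: dropp_real.
rewrite V_add //; last exact: dropp_real.
rewrite V_opp // ltr_distlC => /andP[h5 h6].
exists (dpair p i); rewrite /pt dpairK1 dpairK2 asboolT //.
by apply/andP; split; lra.
Qed.

(** The sequence also lists the points of cells that miss Y. This is harmless, since the task is
    only to cover Y by finitely many balls around points of [0,1]. *)
Theorem balls_cover : exists (y : dom M (tN ~> t1)) n,
  (forall i : N, isreal (y • i) /\ in01 (y • i)) /\
  forall x, isreal x -> dmem K Y x -> exists i : N, olt i n /\
    V (y • i) - V (Ψ • (y • i)) < V x < V (y • i) + V (Ψ • (y • i)).
Proof.
pose y := LAM pt : dom M (tN ~> t1); have yE (n : N) : y • n = pt n by rewrite LAME.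
have y01 (i : N) : isreal (y • i) /\ in01 (y • i) by rewrite yE.
have rΨ (i : N) : isreal (Ψ • (y • i)) /\ 0 < V (Ψ • (y • i)) by case: (y01 i); apply: Ψpos.
have dy' : DefR1 (fun n : N => V (y • n)) by apply: DefR1_of_name => i; case: (y01 i).
have dΨ : DefR1 (fun n : N => V (Ψ • (y • n))).
  by apply: DefR_V => [|ρ]; [dfn|case: (rΨ (ρ tN vz))].
pose l (n : N) := V (y • n) - V (Ψ • (y • n)); pose r (n : N) := V (y • n) + V (Ψ • (y • n)).
have c1 : covers_by l r (dmem K Y).
  split; [by rewrite /l; dfn|by rewrite /r; dfn|by move=> i; have [_ ?] := rΨ i; rewrite /l /r; lra|].
  by move=> x rx /(near_point rx) [n hn]; exists n; rewrite /l /r yE.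
have c2 : covers_by (fun k => qv (A • k)) (fun k => qv (B • k))
    (fun x => exists k : N, qv (A • k) < V x < qv (B • k)) by split=> //; dfn.
have cov : covers_by (join l (fun k => qv (A • k))) (join r (fun k => qv (B • k))) in01.
  have [j1 j2 j3 j4] := covers_join c1 c2; split=> // x rx h01; apply: j4 => //.
  have [e|e] := pselect (exists k : N, qv (A • k) < V x < qv (B • k)); first by right.
  by left; apply/repr.
have [n hn] := finite_subcover cov.
exists y, n; split=> // x rx mx; have [h01 nx] := proj1 (repr rx) mx.
have [k [lk]] := hn x rx h01; have [i [e|e]] := n_parity k; rewrite e in lk *.
  (* The ball with number i has the index i + i in the joined cover, so i is below n as well; i = 0
     is treated apart because then i < i + i fails. *)
  rewrite !join_even => hx; exists i; split=> //; case: (ole0 i) => [i0|i_gt0].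
    by rewrite -i0 addr0 in lk *.
  by apply: olt_trans lk; have := olt_addl i i_gt0; rewrite addr0.
by rewrite !join_odd => hx; case: nx; exists i.
Qed.

End Balls.
End Lusin.

(** * The principles *)

Lemma completion_exists (M : model) : inhabited (completion M).
Proof.
have [K [ι [h1 h2 h3]]] := complete_ordered_field (semiring_of M).
exact: (inhabits (Completion h1 h2 h3)).
Qed.

Section Principles.
Variables (M : model) (K : completion M).
Local Notation N := (ocar (semiring_of M)).
Local Notation name := (dom M t1).
Local Notation fn := (dom M (t1 ~> t1)).
Local Notation V := (V K).
Local Notation isreal := (isreal K).
Local Notation ev := (eval (M := M)).
Local Notation in01 := (@in01 M K).
Local Notation ρ0 := (enil M).
Implicit Types x y ε : name.

Let e1 (f : fn) := econs f ρ0.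
Let e2 (f : fn) ε := econs ε (e1 f).
Let e3 (f : fn) ε (E : fn) := econs E (e2 f ε).

(** The bound variables of the principles as explicit terms: the unfolded formulas are convertible
    to statements about them, to which the lemmas on satisfaction apply. *)
Let wf1 : tm [:: t1 ~> t1] (t1 ~> t1) := Var vz.
Let wε : tm [:: t1; t1 ~> t1] t1 := Var vz.
Let wE : tm [:: t1 ~> t1; t1; t1 ~> t1] (t1 ~> t1) := Var vz.
Let wε3 : tm [:: t1 ~> t1; t1; t1 ~> t1] t1 := Var (vs vz).
Let wf3 : tm [:: t1 ~> t1; t1; t1 ~> t1] (t1 ~> t1) := Var (vs (vs vz)).

(** Left as satisfaction of a formula, because measurability of f is only handed on to the
    hypothesis [dLUS]. *)
Definition dmeasurable (f : fn) := sat (And (fun_I wf1) (measurable_fun wf1)) (e1 f).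

Definition dLUS := forall f, dmeasurable f -> forall ε, isreal ε -> 0 < V ε ->
  exists E, dlusin f (V ε) E.

Definition dLUS_RM := forall f, dmeasurable f -> forall ε, isreal ε -> 0 < V ε ->
  exists E, dlusin f (V ε) E /\ exists A B, represented K A B E.

Let posP f ε : isreal ε -> sat (rlt rzero wε) (e2 f ε) <-> 0 < V ε.
Proof. exact: (@sat_pos _ K _ wε (e2 f ε)). Qed.

Let realP f ε : sat (is_real wε) (e2 f ε) <-> isreal ε.
Proof. exact: (sat_is_real K wε (e2 f ε)). Qed.

Let lusinP f ε E : isreal ε -> sat (lusin_set wf3 wε3 wE) (e3 f ε E) <-> dlusin f (V ε) E.
Proof. exact: (@sat_lusin_set _ K _ wf3 wε3 wE (e3 f ε E)). Qed.

Let closedP f ε E : sat (RM_closed wE) (e3 f ε E) <-> exists A B, represented K A B E.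
Proof. exact: (sat_RM_closed K wE (e3 f ε E)). Qed.

Lemma sat_LUS : sat LUS ρ0 <-> dLUS.
Proof.
(* This holds by conversion: [sat] unfolds the binders and the weakened variables. *)
have -> : sat LUS ρ0 = forall f, dmeasurable f -> forall ε, sat (is_real wε) (e2 f ε) ->
  sat (rlt rzero wε) (e2 f ε) -> exists E, sat (lusin_set wf3 wε3 wE) (e3 f ε E) by [].
split=> H f mf ε.
  move=> rε ε0; have [E hE] := H f mf ε (proj2 (realP f ε) rε) (proj2 (posP f rε) ε0).
  by exists E; exact: (proj1 (lusinP f E rε) hE).
move=> /realP rε /(posP f rε) ε0; have [E hE] := H f mf ε rε ε0.
by exists E; exact: (proj2 (lusinP f E rε) hE).
Qed.

Lemma sat_LUS_RM : sat LUS_RM ρ0 <-> dLUS_RM.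
Proof.
have -> : sat LUS_RM ρ0 = forall f, dmeasurable f -> forall ε, sat (is_real wε) (e2 f ε) ->
  sat (rlt rzero wε) (e2 f ε) -> exists E, sat (lusin_set wf3 wε3 wE) (e3 f ε E) /\
    sat (RM_closed wE) (e3 f ε E) by [].
split=> H f mf ε.
  move=> rε ε0; have [E [hE cE]] := H f mf ε (proj2 (realP f ε) rε) (proj2 (posP f rε) ε0).
  by exists E; split; [exact: (proj1 (lusinP f E rε) hE)|exact: (proj1 (closedP f ε E) cE)].
move=> /realP rε /(posP f rε) ε0; have [E [hE cE]] := H f mf ε rε ε0.
by exists E; split; [exact: (proj2 (lusinP f E rε) hE)|exact: (proj2 (closedP f ε E) cE)].
Qed.

Lemma dLUS_closed : dLUS -> forall f, dmeasurable f -> forall ε, isreal ε -> 0 < V ε ->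
  exists E A B, [/\ dlusin f (V ε) E, represented K A B E
    & forall k : N, qv K (A • k) <= qv K (B • k)].
Proof.
(* Closing the set costs a factor of 3, so LUS is applied to a dyadic number below a third of ε. *)
move=> H f mf ε rε ε0; have [s hs] : exists s, h K s < V ε / 3 by apply: h_small; lra.
have vs : V (dconst (dqpow2 s)) = h K s by rewrite V_const qv_pow2.
have [|E hE] := H f mf (dconst (dqpow2 s)) (dconst_real _ _).
  by rewrite vs h_gt0.
by rewrite vs in hE; apply: lusin_closed hE _; lra.
Qed.

Lemma dLUS_iff : dLUS <-> dLUS_RM.
Proof.
split=> H f mf ε rε ε0; last by have [E [hE _]] := H f mf ε rε ε0; exists E.
have [E [A [B [hE cE _]]]] := dLUS_closed H mf rε ε0.
by exists E; split=> //; exists A, B.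
Qed.

Lemma fun_I_real f : sat (fun_I wf1) (e1 f) ->
  forall x, isreal x -> in01 x -> isreal (f • x).
Proof.
move=> [H _] x rx hx.
pose wx : tm [:: t1; t1 ~> t1] t1 := Var vz.
pose wg : tm [:: t1; t1 ~> t1] (t1 ~> t1) := Var (vs vz).
have H' : forall x, sat (is_real wx) (e2 f x) -> sat (in_I wx) (e2 f x) ->
  sat (is_real (wg · wx)) (e2 f x) by exact: H.
apply/(sat_is_real K (wg · wx) (e2 f x))/H'; first exact/(sat_is_real K wx (e2 f x)).
exact: (proj2 (@sat_in_I _ K _ wx (e2 f x) rx) hx).
Qed.

Let dpositive (f : fn) := sat (allR (fun u => Imp (in_I u) (rlt rzero (Var (vs vz) · u)))) (e1 f).

Lemma positiveP f : sat (fun_I wf1) (e1 f) -> dpositive f ->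
  forall x, isreal x -> in01 x -> isreal (f • x) /\ 0 < V (f • x).
Proof.
move=> If H x rx hx; have rf := fun_I_real If rx hx; split=> //.
pose wx : tm [:: t1; t1 ~> t1] t1 := Var vz.
pose wg : tm [:: t1; t1 ~> t1] (t1 ~> t1) := Var (vs vz).
have H' : forall x, sat (is_real wx) (e2 f x) -> sat (in_I wx) (e2 f x) ->
  sat (rlt rzero (wg · wx)) (e2 f x) by exact: H.
apply/(@sat_pos _ K _ (wg · wx) (e2 f x) rf)/H'; first exact/(sat_is_real K wx (e2 f x)).
exact: (proj2 (@sat_in_I _ K _ wx (e2 f x) rx) hx).
Qed.

Lemma mge_sub (P Q : name -> Prop) (r : K) : (forall x, isreal x -> P x -> Q x) ->
  mge P r -> mge Q r.
Proof.
move=> PQ H a b [da db ab cov]; apply: H; split=> // x rx /(PQ x rx).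
exact: cov.
Qed.

Let e4 (f : fn) ε (y : dom M (tN ~> t1)) (n : N) := econs n (econs y (e2 f ε)).
Let e5 (f : fn) ε (y : dom M (tN ~> t1)) (n : N) (i : N) := econs i (e4 f ε y n).
Let e6 (f : fn) ε (y : dom M (tN ~> t1)) (n : N) x (i : N) := econs i (econs x (e4 f ε y n)).
Let wε4 : tm [:: tN; tN ~> t1; t1; t1 ~> t1] t1 := Var (vs (vs vz)).
Let wi5 : tm [:: tN; tN; tN ~> t1; t1; t1 ~> t1] tN := Var vz.
Let wn5 : tm [:: tN; tN; tN ~> t1; t1; t1 ~> t1] tN := Var (vs vz).
Let wy5 : tm [:: tN; tN; tN ~> t1; t1; t1 ~> t1] (tN ~> t1) := Var (vs (vs vz)).
Let wi6 : tm [:: tN; t1; tN; tN ~> t1; t1; t1 ~> t1] tN := Var vz.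
Let wx6 : tm [:: tN; t1; tN; tN ~> t1; t1; t1 ~> t1] t1 := Var (vs vz).
Let wn6 : tm [:: tN; t1; tN; tN ~> t1; t1; t1 ~> t1] tN := Var (vs (vs vz)).
Let wy6 : tm [:: tN; t1; tN; tN ~> t1; t1; t1 ~> t1] (tN ~> t1) := Var (vs (vs (vs vz))).
Let wΨ6 : tm [:: tN; t1; tN; tN ~> t1; t1; t1 ~> t1] (t1 ~> t1) := Var (vs (vs (vs (vs (vs vz))))).
Let ball : fm [:: tN; t1; tN; tN ~> t1; t1; t1 ~> t1] :=
  And (tle wi6 wn6) (And (rlt (rsub (wy6 · wi6) (wΨ6 · (wy6 · wi6))) wx6)
    (rlt wx6 (radd (wy6 · wi6) (wΨ6 · (wy6 · wi6))))).

Theorem dLUS_WHBU : dLUS -> sat WHBU_m ρ0.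
Proof.
move=> HL.
have -> : sat WHBU_m ρ0 = forall f, sat (fun_I wf1) (e1 f) /\ dpositive f /\
    sat (measurable_fun wf1) (e1 f) -> forall ε, sat (is_real wε) (e2 f ε) ->
    sat (rlt rzero wε) (e2 f ε) -> exists (y : dom M (tN ~> t1)) (n : N),
    (forall i, sat (tle wi5 wn5) (e5 f ε y n i) ->
      sat (is_real (wy5 · wi5)) (e5 f ε y n i) /\ sat (in_I (wy5 · wi5)) (e5 f ε y n i)) /\
    sat (measure_ge (Ex ball) (rsub rone wε4)) (e4 f ε y n) by [].
move=> f [If [pf mf]] ε /realP rε /(posP f rε) ε0.
have [Y [A [B [[_ [_ [_ [gY cY]]]] reprY AB]]]] := dLUS_closed HL (conj If mf) rε ε0.
have fpos := positiveP If pf.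
have [y [n [y01 hy]]] := balls_cover fpos reprY AB cY.
exists y, n; split.
  move=> i _; have [ry h01] := y01 i; split.
    exact: (proj2 (sat_is_real K (wy5 · wi5) (e5 f ε y n i)) ry).
  exact: (proj2 (@sat_in_I _ K _ (wy5 · wi5) (e5 f ε y n i) ry) h01).
have er : ev (e4 f ε y n) (rsub rone wε4) = dradd (dconst (dmkQ 1 0 0)) (dropp ε).
  by rewrite eval_rsub eval_rone.
have rr : isreal (ev (e4 f ε y n) (rsub rone wε4)).
  by rewrite er; apply: dradd_real; [exact: dconst_real|exact: dropp_real].
have vr : V (ev (e4 f ε y n) (rsub rone wε4)) = 1 - V ε.
  by rewrite er (V_add (dconst_real K _) (dropp_real rε)) (V_opp rε) V_rone.
have {}gY : mge (dmem K Y) (V (ev (e4 f ε y n) (rsub rone wε4))) by rewrite vr.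
apply: (proj2 (@sat_measure_ge _ K _ (Ex ball) (rsub rone wε4) (e4 f ε y n) rr)).
apply: (mge_sub _ gY) => x rx mx; have [i [l hx]] := hy x rx mx; have [ry h01] := y01 i.
have [rΨ _] := fpos _ ry h01; move: hx => /andP[h1 h2].
have ro := dropp_real rΨ.
have E1 : ev (e6 f ε y n x i) (rsub (wy6 · wi6) (wΨ6 · (wy6 · wi6)))
    = dradd (y • i) (dropp (f • (y • i))) by rewrite eval_rsub.
have E2 : ev (e6 f ε y n x i) (radd (wy6 · wi6) (wΨ6 · (wy6 · wi6)))
    = dradd (y • i) (f • (y • i)) by rewrite eval_radd.
have Ex : ev (e6 f ε y n x i) wx6 = x by [].
exists i; split; first by left.
split.
  apply: (proj2 (sat_rltE E1 Ex (dradd_real ry ro) rx)).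
  by rewrite V_add // V_opp.
apply: (proj2 (sat_rltE Ex E2 rx (dradd_real ry rΨ))).
by rewrite V_add.
Qed.
End Principles.

Theorem theorem3p14 :
  (ACA0w ⊢ LUS ⇔ LUS_RM) /\ (ACA0w ⊢ LUS ⇒ WHBU_m).
Proof.
split; apply: completeness => [Γ Δ ψ r|Γ ψ|M ext val];
  [exact: ACA0w_fren|exact: ACA0w_RCA0w| |exact: ACA0w_fren|exact: ACA0w_RCA0w|].
- have [K] := completion_exists (Model ext val).
  have h := dLUS_iff K; have h1 := sat_LUS K; have h2 := sat_LUS_RM K.
  split=> H.
    exact: (proj2 h2 (proj1 h (proj1 h1 H))).
  exact: (proj2 h1 (proj2 h (proj1 h2 H))).
- have [K] := completion_exists (Model ext val).
  move=> H; exact: (dLUS_WHBU (proj1 (sat_LUS K) H)).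
Qed.
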